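(* Let $\lambda\in P_c$, $\xi\in\mathcal{P}_c$, and let $\omega\in P^+$ be minuscule or quasi-minuscule. Then $$\mathrm m_\omega(e^{i\xi})\,M_\lambda^{(c)}(\xi)=U_{\lambda,\omega}(t)\,M_\lambda^{(c)}(\xi)+\sum_{\substack{\nu\in W_0\omega\\ \lambda+\nu\in P_c}}V_{\lambda,\nu}(t)\,M_{\lambda+\nu}^{(c)}(\xi),$$ where $$V_{\lambda,\nu}(t)=\prod_{\substack{\beta\in\hat R_0^+\\ \langle\lambda,\beta\rangle=0\\ \langle\nu,\beta\rangle>0}}\frac{1-t_\beta\hat e_t(\beta)}{1-\hat e_t(\beta)}\prod_{\substack{\beta\in\hat R_0^+\\ \langle\lambda,\beta\rangle=c\\ \langle\nu,\beta\rangle<0}}\frac{1-t_\beta\hat h_t\hat e_t(-\beta)}{1-\hat h_t\hat e_t(-\beta)}$$ and $$U_{\lambda,\omega}(t)=\sum_{\substack{\nu\in W_0\omega\\ (\lambda+\nu)_+=\lambda}}t[\lambda+\nu]+(1-t_\vartheta^{-1})\sum_{\substack{\nu\in W_0\omega\\ w_{\lambda+\nu}\lambda=\lambda}}d_{\lambda,\nu}$$ (which implies in particular that $U_{\lambda,\omega}(t)$ vanishes when $\omega$ is minuscule).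
   Context: Root data. $V$ is a real finite-dimensional Euclidean vector space with inner product $\langle\cdot,\cdot\rangle$, spanned by an irreducible reduced crystallographic root system $R_0$ of rank $n$, with root lattice $Q$, weight lattice $P$, Weyl group $W_0$, a fixed choice of positive roots $R_0^+$ with simple roots $\alpha_1,\dots,\alpha_n$, and the corresponding cone of dominant weights $P^+$. For $x\in V\setminus\{0\}$ put $x^\vee:=2x/\langle x,x\rangle$, and $R_0^\vee=\{\alpha^\vee\mid\alpha\in R_0\}$, $R_0^{\vee,+}=\{\alpha^\vee\mid\alpha\in R_0^+\}$. Let $\varphi$ and $\vartheta$ be the highest root and the highest short root of $R_0^+$ (equal if $R_0$ is simply-laced), and $u_\varphi=2/\langle\varphi,\varphi\rangle$. Fix an admissible pair $(R_0,\hat R_0)$: $\hat R_0$ is either $R_0^\vee$ or $u_\varphi R_0$. For $\alpha\in R_0$ let $\hat\alpha:=\alpha^\vee$ if $\hat R_0=R_0^\vee$, and $\hat\alpha:=u_\varphi\alpha$ if $\hat R_0=u_\varphi R_0$; $m_\alpha:=2/\langle\alpha,\hat\alpha\rangle$, so $\alpha^\vee=m_\alpha\hat\alpha$; $\hat R_0^+=\{\hat\alpha\mid\alpha\in R_0^+\}$; $\hat Q,\hat P$ are the root and weight lattices of $\hat R_0$. Let $-\alpha_0$ be the highest short root of $\hat R_0^{\vee,+}$, i.e. $\alpha_0=-\vartheta$ if $\hat R_0=R_0^\vee$ and $\alpha_0=-\varphi$ if $\hat R_0=u_\varphi R_0$. Let $t:R_0\cup R_0^\vee\cup\hat R_0\to(-1,1)\setminus\{0\}$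 satisfy $t_{w\alpha}=t_\alpha$ and $t_{\hat\alpha}=t_{\alpha^\vee}=t_\alpha$ for all $w\in W_0$, $\alpha\in R_0$. Fix an integer $c>1$. Macdonald spherical functions. For $\lambda\in P^+$, $M_\lambda:V\to\mathbb{C}$ is the $W_0$-invariant trigonometric polynomial $M_\lambda(\xi)=\sum_{v\in W_0}C(v\xi)e^{i\langle v\xi,\lambda\rangle}$ with $C(\xi)=\prod_{\alpha\in R_0^+}\frac{1-t_\alpha e^{-i\langle\xi,\alpha\rangle}}{1-e^{-i\langle\xi,\alpha\rangle}}$. Alcoves and nodes. $P_c=\{\lambda\in P\mid 0\le\langle\lambda,\beta\rangle\le c\ \forall\beta\in\hat R_0^+\}$ and $\hat P_c=\{\mu\in\hat P\mid 0\le\langle\mu,\alpha\rangle\le c\ \forall\alpha\in R_0^+\}$. For $\mu\in\hat P$, $\xi_\mu=\xi_\mu(t)\in V$ is the unique global minimum of the radially unbounded strictly convex function $$\mathcal{V}_\mu(\xi)=\frac c2\langle\xi,\xi\rangle-2\pi\langle\hat\rho+\mu,\xi\rangle+\sum_{\alpha\in R_0^+}\frac{2}{\langle\alpha,\hat\alpha^\vee\rangle}\int_0^{\langle\xi,\alpha\rangle}v_\alpha(x)\,dx\qquad(\xi\in V),$$ where $\hat\rho=\frac12\sum_{\beta\in\hat R_0^+}\beta$ and $v_\alpha(x)=(1-t_\alpha^2)\int_0^x\frac{dy}{1-2t_\alpha\cos(y)+t_\alpha^2}$. Put $\mathcal{P}_c=\{\xi_\mu\mid\mu\in\hat P_c\}$.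 For $\lambda\in P_c$, $M_\lambda^{(c)}:\mathcal{P}_c\to\mathbb{C}$ is the restriction of $M_\lambda$ to $\mathcal{P}_c$. (Quasi-)minuscule weights. $\mu\in P$ is minuscule if $0\le\langle\mu,\alpha^\vee\rangle\le1$ for all $\alpha\in R_0^+$, and quasi-minuscule if $0\le\langle\mu,\alpha^\vee\rangle\le2$ for all $\alpha\in R_0^+$ with the upper bound $2$ realized exactly once (the quasi-minuscule weight is unique and equals $\vartheta$). For $\lambda\in P$, $\mathrm m_\lambda(e^{i\xi})=\sum_{\nu\in W_0\lambda}e^{i\langle\nu,\xi\rangle}$. The functions $\hat e_t,\hat h_t,e_t,h_t$. For $\eta\in\hat Q$, $\hat e_t(\eta)=\prod_{\beta\in\hat R_0^+}t_\beta^{\langle\eta,\beta^\vee\rangle/2}$, understood as $t_\vartheta^{\langle\hat\rho_s^\vee,\eta\rangle}t_\varphi^{\langle\rho(\hat R_0^\vee)-\hat\rho_s^\vee,\eta\rangle}$ with $\hat\rho_s^\vee=\frac12\sum_{\alpha\in W_0\vartheta\cap R_0^+}\hat\alpha^\vee$ and $\rho(\hat R_0^\vee)=\frac12\sum_{\alpha\in R_0^+}\hat\alpha^\vee$ (integer exponents); $\hat h_t=t_{\alpha_0}\hat e_t(-\alpha_0^\vee)$. Similarly, for $\nu\in Q$, $e_t(\nu)=\prod_{\alpha\in R_0^+}t_\alpha^{\langle\nu,\alpha^\vee\rangle/2}$ (exponents of equal parameters being collected, which gives integer exponents), and $h_t=t_\vartheta\,e_t(-\alpha_0)$. Affine Weyl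 group. The affine root system is $R=\{\alpha^\vee+m_\alpha rc\mid\alpha\in R_0,r\in\mathbb{Z}\}$; $a=\alpha^\vee+m_\alpha rc$ is regarded as the affine function $a(x)=\langle x,\alpha^\vee\rangle+m_\alpha rc$ on $V$, with differential $a'=\alpha^\vee$ and reflection $s_a(x)=x-a(x)\alpha$. Positive affine roots: $R^+=R_0^{\vee,+}\cup\{\alpha^\vee+m_\alpha rc\mid\alpha\in R_0,r\ge1\}$; simple affine roots: $a_0=\alpha_0^\vee+c$, $a_j=\alpha_j^\vee$ $(1\le j\le n)$. $W$ is the group generated by all $s_a$, $a\in R$; it is a Coxeter group with generators $s_j=s_{a_j}$ $(0\le j\le n)$ and length function $\ell$. A fundamental domain is $A_c=\{x\in V\mid0\le\langle x,\beta\rangle\le c\ \forall\beta\in\hat R_0^+\}$. For $x\in V$, $w_x\in W$ is the unique shortest element with $x_+:=w_xx\in A_c$. For $\lambda\in P$: $R[\lambda]=\{a\in R^+\mid a(\lambda)<0\}$, $t[\lambda]=\prod_{a\in R[\lambda]}t_{a'}$, $\theta(\lambda)=|\{a\in R^+\mid a(\lambda)=-2\}|$. Coefficient $d_{\lambda,\nu}$. $d_{\lambda,\nu}=\theta(\lambda+\nu)\,e_t(-\nu)\,h_t^{\operatorname{sign}(\langle\lambda,\hat\nu\rangle)}$ if $\nu\in W_0\vartheta$ (with $\operatorname{sign}(0)=0$), and $d_{\lambda,\nu}=0$ otherwise.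
   Formalization: The weight ω is taken nonzero (for ω=0 the formula would read M=2M), and h_t is t_{α_0}e_t(-α_0) instead of t_ϑ e_t(-α_0), since for R̂_0=u_φR_0 of type B_2 with t_ϑ≠t_φ the latter makes U_{λ,ω}(t) wrong. *)

(* Defs.v *)
From HB Require Import structures.
From mathcomp Require Import all_boot all_order all_algebra finmap.
From mathcomp Require Import all_classical all_reals all_analysis.
From mathcomp Require Import complex.
Set Implicit Arguments.
Unset Strict Implicit.
Unset Printing Implicit Defensive.
Import Order.TTheory GRing.Theory Num.Theory.
Local Open Scope classical_set_scope.
Local Open Scope ring_scope.

(* The generators used below are involutions, so the generated monoid is the
   generated group. *)
Inductive generated (T : Type) (S : set (T -> T)) : (T -> T) -> Prop :=
| generated_id : generated S id
| generated_comp s w : S s -> generated S w -> generated S (s \o w).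

Section RootSystems.
Context (R : realType) (V : vectType R).
Implicit Types (ip : {dot V for idfun}) (Phi : {fset V}).

Definition vee ip (x : V) : V := (2 / ip x x) *: x.

Definition refl ip (a x : V) : V := x - ip x (vee ip a) *: a.

Definition root_system ip Phi : Prop :=
  [/\ <<enum_fset Phi>>%VS = fullv,
      0 \notin Phi,
      forall a b, a \in Phi -> b \in Phi -> refl ip a b \in Phi,
      forall a b, a \in Phi -> b \in Phi -> ip b (vee ip a) \is a Num.int
    & forall (a : V) (k : R), a \in Phi -> k *: a \in Phi -> k = 1 \/ k = -1].

Definition irreducible_system ip Phi : Prop :=
  Phi != fset0 /\
  forall A B : {fset V}, Phi = (A `|` B)%fset ->
    (forall a b, a \in A -> b \in B -> ip a b = 0) -> A = fset0 \/ B = fset0.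

Definition nat_comb n (base : n.-tuple V) (x : V) : Prop :=
  forall i, coord base i x \is a Num.nat.

Definition root_base n (base : n.-tuple V) Phi : Prop :=
  [/\ basis_of fullv base,
      forall i, tnth base i \in Phi
    & forall a, a \in Phi -> nat_comb base a \/ nat_comb base (- a)].

(* All roots count as short when they have the same length. *)
Definition short_root ip Phi (a : V) : Prop :=
  a \in Phi /\ forall b, b \in Phi -> ip a a <= ip b b.

Definition highest n (base : n.-tuple V) (S : set V) (a : V) : Prop :=
  S a /\ forall b, S b -> nat_comb base (a - b).

End RootSystems.

(* The two admissible choices: hat R_0 = R_0^vee and hat R_0 = u_phi R_0. *)
Variant hat_kind := HatDual | HatScaled.

Record root_datum (R : realType) (V : vectType R) (n : nat) := RootDatum {
  ip : {dot V for idfun};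
  roots : {fset V};
  base : n.-tuple V;
  phi : V;
  vartheta : V;
  kind : hat_kind;
  root_systemP : root_system ip roots;
  irreducibleP : irreducible_system ip roots;
  baseP : root_base base roots;
  phiP : highest base [set` roots] phi;
  varthetaP : highest base (short_root ip roots) vartheta }.

Section Weights.
Context (R : realType) (V : vectType R) (n : nat) (D : root_datum V n).
Local Notation "''[' x , y ]" := (ip D x y) (at level 0).
Local Notation vee := (vee (ip D)).

Definition posroots : {fset V} :=
  [fset a in roots D | [forall i, 0 <= coord (base D) i a]]%fset.

Definition weyl : set (V -> V) :=
  generated [set refl (ip D) a | a in [set` roots D]].

Definition weyl_orbit (x : V) : set V := [set w x | w in weyl].

Definition hat (a : V) : V :=
  match kind D with
  | HatDual => vee a
  | HatScaled => (2 / '[phi D, phi D]) *: a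
  end.

Definition hatroots : {fset V} := [fset hat a | a in roots D]%fset.
Definition hatpos : {fset V} := [fset hat a | a in posroots]%fset.

Definition mult (a : V) : R := 2 / '[a, hat a].

Definition alpha0 : V :=
  match kind D with HatDual => - vartheta D | HatScaled => - phi D end.

Definition weight (la : V) : Prop :=
  forall a, a \in roots D -> '[la, vee a] \is a Num.int.

Definition hatweight (mu : V) : Prop :=
  forall b, b \in hatroots -> '[mu, vee b] \is a Num.int.

Definition dominant_weight (la : V) : Prop :=
  weight la /\ forall a, a \in posroots -> 0 <= '[la, vee a].

Definition minuscule (mu : V) : Prop :=
  weight mu /\ forall a, a \in posroots -> 0 <= '[mu, vee a] <= 1.

Definition quasiminuscule (mu : V) : Prop :=
  [/\ weight mu,
      forall a, a \in posroots -> 0 <= '[mu, vee a] <= 2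
    & exists! a, a \in posroots /\ '[mu, vee a] = 2].

Definition parameters (t : V -> R) : Prop :=
  [/\ forall a, a \in roots D -> -1 < t a < 1 /\ t a != 0,
      forall w a, weyl w -> a \in roots D -> t (w a) = t a
    & forall a, a \in roots D -> t (hat a) = t a /\ t (vee a) = t a].

Definition expi (x : R) : complex R := Complex (cos x) (sin x).

Definition orbit_sum (la xi : V) : complex R :=
  \sum_(nu \in weyl_orbit la) expi '[nu, xi].

Section Spherical.
Context (t : V -> R).

Definition cfun (xi : V) : complex R :=
  \prod_(a <- posroots)
    ((1 - real_complex R (t a) * expi (- '[xi, a])) / (1 - expi (- '[xi, a]))).

(* This expression has removable singularities on the walls
   <xi, a> in 2 pi Z, where the quotients in cfun are not meaningful; the
   points of the spectrum below lie off these walls. *)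
Definition macdonald (la xi : V) : complex R :=
  \sum_(v \in weyl) cfun (v xi) * expi '[v xi, la].

Definition hatrho : V := 2^-1 *: \sum_(b <- hatpos) b.

Definition rhov : V := 2^-1 *: \sum_(a <- posroots) vee a.
Definition rhov_short : V :=
  2^-1 *: \sum_(a <- posroots | a \in weyl_orbit (vartheta D)) vee a.
Definition hatrhov : V := 2^-1 *: \sum_(a <- posroots) vee (hat a).
Definition hatrhov_short : V :=
  2^-1 *: \sum_(a <- posroots | a \in weyl_orbit (vartheta D)) vee (hat a).

(* The exponents are integers for eta in hat Q, resp. nu in Q, so that the
   floors are exact there. *)
Definition hat_e (eta : V) : R :=
  t (vartheta D) ^ Num.floor '[hatrhov_short, eta] *
  t (phi D) ^ Num.floor '[hatrhov - hatrhov_short, eta].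

Definition e_ (nu : V) : R :=
  t (vartheta D) ^ Num.floor '[rhov_short, nu] *
  t (phi D) ^ Num.floor '[rhov - rhov_short, nu].

Definition hat_h : R := t alpha0 * hat_e (- vee alpha0).

(* The leading factor is t_{alpha0}, as in hat_h.  It equals t_vartheta when
   hat R_0 = R_0^vee (or all parameters agree); when hat R_0 = u_phi R_0 it is
   t_phi, and t_vartheta in its place would make the Pieri formula fail, e.g.
   for R_0 of type B_2. *)
Definition h_ : R := t alpha0 * e_ (- alpha0).

End Spherical.

Section Level.
Context (t : V -> R) (c : nat).

Definition alcove (x : V) : Prop :=
  forall b, b \in hatpos -> 0 <= '[x, b] <= c%:R.

Definition alcove_weight (la : V) : Prop := weight la /\ alcove la.

Definition hat_alcove_weight (mu : V) : Prop :=
  hatweight mu /\ forall a, a \in posroots -> 0 <= '[mu, a] <= c%:R.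

Definition integral0 (f : R -> R) (x : R) : R :=
  if 0 <= x then \int[lebesgue_measure]_(y in `[0, x]) f y
  else - \int[lebesgue_measure]_(y in `[x, 0]) f y.

Definition vfun (a : V) (x : R) : R :=
  (1 - t a ^+ 2) * integral0 (fun y => (1 - 2 * t a * cos y + t a ^+ 2)^-1) x.

Definition potential (mu xi : V) : R :=
  c%:R / 2 * '[xi, xi] - 2 * pi * '[hatrho + mu, xi]
  + \sum_(a <- posroots)
      2 / '[a, vee (hat a)] * integral0 (vfun a) '[xi, a].

Definition spectrum (xi : V) : Prop :=
  exists2 mu, hat_alcove_weight mu &
    forall eta, potential mu xi <= potential mu eta.

(* The pair (a, r) stands for the affine root a^vee + m_a r c. *)
Definition affroot : set (V * int) := [set a | a.1 \in roots D].

Definition affpos : set (V * int) :=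
  [set a | (a.1 \in posroots /\ a.2 = 0) \/ (a.1 \in roots D /\ 1 <= a.2)].

Definition affeval (a : V * int) (x : V) : R :=
  '[x, vee a.1] + mult a.1 * a.2%:~R * c%:R.

Definition affrefl (a : V * int) (x : V) : V := x - affeval a x *: a.1.

(* Since mult alpha0 = 1, the pair (alpha0, 1) is a_0 = alpha0^vee + c. *)
Definition affsimple (j : 'I_n.+1) : V * int :=
  if unlift ord0 j is Some i then (tnth (base D) i, 0) else (alpha0, 1).

Definition affweyl : set (V -> V) :=
  generated [set affrefl a | a in affroot].

Definition affword (s : seq 'I_n.+1) : V -> V :=
  foldr (fun j w => affrefl (affsimple j) \o w) id s.

Definition afflength (w : V -> V) : nat :=
  xget 0%N [set k | (exists2 s, affword s = w & size s = k) /\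
                    (forall s, affword s = w -> (k <= size s)%N)].

Definition shortest (x : V) : V -> V :=
  xget (id : V -> V) [set w | [/\ affweyl w, alcove (w x)
    & forall w', affweyl w' -> alcove (w' x) ->
        (afflength w <= afflength w')%N]].

Definition to_alcove (x : V) : V := shortest x x.

Definition affneg (la : V) : set (V * int) :=
  [set a | affpos a /\ affeval a la < 0].

Definition tprod (la : V) : R := \big[*%R/1]_(a \in affneg la) t (vee a.1).

Definition theta (la : V) : nat :=
  #|` fset_set [set a | affpos a /\ affeval a la = -2] |.

Definition dcoef (la nu : V) : R :=
  if nu \in weyl_orbit (vartheta D) then
    (theta (la + nu))%:R * e_ t (- nu) * h_ t ^ sgz '[la, hat nu]
  else 0.

Definition Vcoef (la nu : V) : R :=
  (\prod_(b <- hatpos | ('[la, b] == 0) && (0 < '[nu, b]))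
     ((1 - t b * hat_e t b) / (1 - hat_e t b))) *
  (\prod_(b <- hatpos | ('[la, b] == c%:R) && ('[nu, b] < 0))
     ((1 - t b * hat_h t * hat_e t (- b)) / (1 - hat_h t * hat_e t (- b)))).

Definition Ucoef (la omega : V) : R :=
  \sum_(nu \in [set nu | weyl_orbit omega nu /\ to_alcove (la + nu) = la])
     tprod (la + nu)
  + (1 - (t (vartheta D))^-1) *
    \sum_(nu \in [set nu | weyl_orbit omega nu /\ shortest (la + nu) la = la])
       dcoef la nu.

End Level.
End Weights.

(* Main.v *)
Require Import Defs.
From mathcomp Require Import all_boot all_order all_algebra.
From mathcomp Require Import all_classical all_reals all_analysis.
From mathcomp Require Import complex.
From mathcomp Require Import finmap ring lra zify.
Set Implicit Arguments.
Unset Strict Implicit.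
Unset Printing Implicit Defensive.
Import Order.TTheory GRing.Theory Num.Theory numFieldNormedType.Exports.
Local Open Scope classical_set_scope.
Local Open Scope ring_scope.

(* Reindexing the Weyl group gives m_omega M_la = sum_nu M_(la + nu) over the
   orbit of omega, where M_mu is defined by the same formula for every weight mu.
   If la + nu lies outside the alcove, apply a simple affine reflection s_j with
   a_j(la + nu) < 0.  Since omega is (quasi-)minuscule this value is -1 or -2, and
   M_x = t_j M_(s_j x), resp. M_x = t_j M_(s_j x) - (1 - t_j) M_(x + a_j'); for
   j = 0 this uses the critical-point (Bethe) equations satisfied by xi.  Along the
   way either s_j fixes la and moves nu to s_j' nu, or a_j(la) = 1, a_j' = - nu and
   the next point is la itself.  So M_(la + nu) is t[la + nu] M_((la + nu)_+) plus
   a multiple of M_la, the latter coming from the steps with value -2.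

   The nu with (la + nu)_+ = la + nu_+ form the orbit of nu_+ under the stabilizer
   of la, a finite reflection group, and t[la + nu] is the product of the t_b over
   the local positive roots b with <nu, b> < 0.  Their sum is the quotient of two
   Poincare polynomials; Macdonald's formula
     sum_w prod_(b > 0, w b < 0) t_b = prod_(b > 0) (1 - t_b chi b) / (1 - chi b),
   for chi multiplicative with chi = t on simple roots, turns it into V_(la, nu_+). *)

(** Affine roots with the same direction differ at [la] by multiples of c, so for c > 1 they cannot
    take the values 0 and 1 there. Hence a path that ends at [la] never meets the value -2, and the
    two sums in U do not interfere. As 0 counts as minuscule, omega <> 0 has to be required:
    otherwise nu = 0 would be counted both in U and in the final sum.

    The shape of d_(la, nu) is dictated by the recursion it shares with t[la + nu], namely d(nu) =
    t_j d(s_j' nu). For j > 0 the factor e_t(-nu) provides it. For j = 0 the pairing of [la] with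
    hat nu drops from c to 0, so the sign in the exponent releases one factor h_t, and h_t
    e_t(alpha_0) = t_(alpha_0).

    Likewise the two products in V are values of a single character on the roots of the walls
    through [la]: hat e_t times hat h_t to the level of the affine root. It takes the value t on
    each local simple root, the one of a_0 included.

    Both admissible pairs are handled together through psi = - alpha_0, whose hat is the highest
    root of hat R_0 and equals the coroot of psi. *)

Lemma finite_argmax (R : realType) (T : choiceType) (A : set T) (F : T -> R) x0 :
  finite_set A -> A x0 -> exists2 u, A u & forall w, A w -> F w <= F u.
Proof.
move=> Af Ax0; have sA : x0 \in fset_set A by rewrite in_fset_set//; exact: mem_set.
have := @Order.TotalTheory.arg_maxP _ _ (fset_set A) [` sA]%fset xpredT (fun w => F (val w)) isT.
case=> u _ umax; exists (val u); first by have := valP u; rewrite in_fset_set// => /set_mem.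
move=> w Aw; have wA : w \in fset_set A by rewrite in_fset_set//; exact: mem_set.
exact: (umax [` wA]%fset).
Qed.

(** * Reflections and linear isometries of a Euclidean space *)

Section Euclidean.
Context (R : realType) (V : vectType R) (ip : {dot V for idfun}).
Implicit Types (x y a b : V) (k : R) (w : V -> V).
Local Notation vee := (vee ip).
Local Notation refl := (refl ip).

Lemma ipC x y : ip x y = ip y x.
Proof. by rewrite hermC expr0 mul1r. Qed.

Lemma ipDl x y a : ip (x + y) a = ip x a + ip y a.
Proof. exact: linearDl. Qed.
Lemma ipDr x y a : ip a (x + y) = ip a x + ip a y.
Proof. exact: linearDr. Qed.
Lemma ipNl x y : ip (- x) y = - ip x y.
Proof. exact: linearNl. Qed.
Lemma ipNr x y : ip x (- y) = - ip x y.
Proof. exact: linearNr. Qed.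
Lemma ipBl x y a : ip (x - y) a = ip x a - ip y a.
Proof. by rewrite ipDl ipNl. Qed.
Lemma ipBr x y a : ip a (x - y) = ip a x - ip a y.
Proof. by rewrite ipDr ipNr. Qed.
Lemma ipZl k x y : ip (k *: x) y = k * ip x y.
Proof. by rewrite linearZl_LR. Qed.
Lemma ipZr k x y : ip x (k *: y) = k * ip x y.
Proof. by rewrite ipC ipZl ipC. Qed.
Lemma ip0l x : ip 0 x = 0.
Proof. exact: linear0l. Qed.
Lemma ip0r x : ip x 0 = 0.
Proof. exact: linear0r. Qed.

Lemma ip_suml (I : Type) (r : seq I) (P : pred I) (F : I -> V) x :
  ip (\sum_(i <- r | P i) F i) x = \sum_(i <- r | P i) ip (F i) x.
Proof. by apply: (big_morph (ip^~ x)); [move=> *; exact: ipDl|exact: ip0l]. Qed.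

Lemma ip_sumr (I : Type) (r : seq I) (P : pred I) (F : I -> V) x :
  ip x (\sum_(i <- r | P i) F i) = \sum_(i <- r | P i) ip x (F i).
Proof. by apply: (big_morph (ip x)); [move=> *; exact: ipDr|exact: ip0r]. Qed.

Lemma ip_gt0 x : x != 0 -> 0 < ip x x.
Proof. exact: neq0_dnorm_gt0. Qed.

Lemma ip_eq0 x : (ip x x == 0) = (x == 0).
Proof.
apply/idP/idP => [|/eqP->]; last by rewrite ip0l.
by apply: contraTT => /ip_gt0; rewrite lt0r => /andP[].
Qed.

Lemma ip_ge0 x : 0 <= ip x x.
Proof. by have [->|/ip_gt0/ltW//] := eqVneq x 0; rewrite ip0l. Qed.

Lemma ip_ext x y : (forall z, ip x z = ip y z) -> x = y.
Proof.
move=> xy; apply/eqP; rewrite -subr_eq0 -ip_eq0.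
by rewrite ipBl xy subrr.
Qed.

Lemma ip_vee x a : ip x (vee a) = 2 / ip a a * ip x a.
Proof. by rewrite ipZr. Qed.

Lemma ip_veeK x a : a != 0 -> ip x (vee a) * (ip a a / 2) = ip x a.
Proof.
by move=> /ip_gt0 /gt_eqF a0; rewrite ip_vee; field; rewrite a0.
Qed.

Lemma ip_vee_self a : a != 0 -> ip a (vee a) = 2.
Proof. by move=> /ip_gt0 /gt_eqF a0; rewrite ip_vee divfK// a0. Qed.

Lemma ip_vee_gt0 x a : a != 0 -> (0 < ip x (vee a)) = (0 < ip x a).
Proof. by move=> a0; rewrite ip_vee pmulr_rgt0// divr_gt0// ip_gt0. Qed.
Lemma ip_vee_ge0 x a : a != 0 -> (0 <= ip x (vee a)) = (0 <= ip x a).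
Proof. by move=> a0; rewrite ip_vee pmulr_rge0// divr_gt0// ip_gt0. Qed.
Lemma ip_vee_lt0 x a : a != 0 -> (ip x (vee a) < 0) = (ip x a < 0).
Proof. by move=> a0; rewrite ip_vee pmulr_rlt0// divr_gt0// ip_gt0. Qed.
Lemma ip_vee_le0 x a : a != 0 -> (ip x (vee a) <= 0) = (ip x a <= 0).
Proof. by move=> a0; rewrite ip_vee pmulr_rle0// divr_gt0// ip_gt0. Qed.
Lemma ip_vee_eq0 x a : a != 0 -> (ip x (vee a) == 0) = (ip x a == 0).
Proof.
move=> a0; rewrite ip_vee mulf_eq0 (gt_eqF _ : 2 / ip a a == 0 = false)//.
by rewrite divr_gt0// ip_gt0.
Qed.

Lemma veeN a : vee (- a) = - vee a.
Proof. by rewrite /Defs.vee ipNl ipNr opprK scalerN. Qed.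

Lemma veeZ k a : k != 0 -> vee (k *: a) = k^-1 *: vee a.
Proof.
move=> k0; rewrite /Defs.vee ipZl ipZr !scalerA; congr (_ *: _).
by rewrite !invfM; move: (ip a a)^-1 => N; field.
Qed.

Lemma refl_linear a k x y : refl a (k *: x + y) = k *: refl a x + refl a y.
Proof.
by rewrite /Defs.refl ipDl ipZl scalerDl scalerBr scalerA opprD addrACA.
Qed.

Lemma ip_refl a x y : a != 0 -> ip (refl a x) (refl a y) = ip x y.
Proof.
move=> a0; rewrite /Defs.refl !ip_vee !(ipBl, ipBr, ipZl, ipZr) [ip a y]ipC.
have := ip_gt0 a0; move: (ip a a) (ip x a) (ip y a) => N X Y N0.
by field; rewrite gt_eqF.
Qed.

Lemma refl_self a : a != 0 -> refl a a = - a.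
Proof. by move=> a0; rewrite /Defs.refl ip_vee_self// scaler_nat mulr2n opprD addNKr. Qed.

Lemma reflK a : a != 0 -> involutive (refl a).
Proof.
move=> a0 x; rewrite {1}/Defs.refl.
have -> : ip (refl a x) (vee a) = - ip x (vee a).
  by rewrite /Defs.refl ipBl ipZl ip_vee_self//; ring.
by rewrite scaleNr opprK subrK.
Qed.

Lemma reflZ k a x : k != 0 -> refl (k *: a) x = refl a x.
Proof. by move=> k0; rewrite /Defs.refl veeZ// ipZr scalerA mulrAC mulVf// mul1r. Qed.

Lemma reflNv a x : refl (- a) x = refl a x.
Proof. by rewrite /Defs.refl veeN ipNr scalerN scaleNr opprK. Qed.

Lemma refl_fix a x : ip x a = 0 -> refl a x = x.
Proof. by move=> xa; rewrite /Defs.refl ip_vee xa mulr0 scale0r subr0. Qed.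

(** Group elements are bare functions, since [generated] yields sets of maps; linearity and isometry
    therefore travel as a predicate. *)
Definition lin_isom w :=
  (forall k x y, w (k *: x + y) = k *: w x + w y) /\
  (forall x y, ip (w x) (w y) = ip x y).

Lemma lin_isom_id : lin_isom id. Proof. by []. Qed.

Lemma lin_isom_comp u w : lin_isom u -> lin_isom w -> lin_isom (u \o w).
Proof.
by move=> [u1 u2] [w1 w2]; split=> [k x y|x y] /=; rewrite ?w1 ?u1 ?u2 ?w2.
Qed.

Lemma lin_isom_refl a : a != 0 -> lin_isom (refl a).
Proof. by move=> a0; split=> *; [exact: refl_linear|exact: ip_refl]. Qed.

Section LinIsom.
Context w (hw : lin_isom w).

Lemma isom_ip x y : ip (w x) (w y) = ip x y. Proof. exact: hw.2. Qed.
Lemma isom0 : w 0 = 0.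
Proof. by have := hw.1 (-1) 0 0; rewrite scaler0 addr0 scaleN1r addNr. Qed.
Lemma isomZ k x : w (k *: x) = k *: w x.
Proof. by rewrite -[k *: x]addr0 hw.1 isom0 addr0. Qed.
Lemma isomD x y : w (x + y) = w x + w y.
Proof. by rewrite -[x]scale1r hw.1 !scale1r. Qed.
Lemma isomN x : w (- x) = - w x.
Proof. by rewrite -scaleN1r isomZ scaleN1r. Qed.
Lemma isomB x y : w (x - y) = w x - w y.
Proof. by rewrite isomD isomN. Qed.
Lemma isom_sum (I : Type) (r : seq I) (P : pred I) (F : I -> V) :
  w (\sum_(i <- r | P i) F i) = \sum_(i <- r | P i) w (F i).
Proof. by apply: (big_morph w); [move=> *; exact: isomD|exact: isom0]. Qed.
Lemma isom_vee x : w (vee x) = vee (w x).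
Proof. by rewrite isomZ /Defs.vee isom_ip. Qed.
Lemma isom_refl a x : w (refl a x) = refl (w a) (w x).
Proof. by rewrite /Defs.refl isomB isomZ -isom_vee isom_ip. Qed.
Lemma isom_inj : injective w.
Proof.
move=> x y xy; apply/eqP; rewrite -subr_eq0 -ip_eq0 -isom_ip isomB xy subrr.
by rewrite ip0l.
Qed.
End LinIsom.

Lemma ip_reflC a x y : a != 0 -> ip (refl a x) y = ip x (refl a y).
Proof. by move=> a0; rewrite -(ip_refl _ _ a0) reflK. Qed.

Lemma refl_inj a : a != 0 -> injective (refl a).
Proof. by move=> a0; exact: can_inj (reflK a0). Qed.

End Euclidean.

(** * Poincare polynomials of finite reflection groups *)

(* [rg_le0] and [rg_gt0] say that [Pp] lies in the cone spanned by the simple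
   roots [Dl], without reference to an expansion; [Pp] need not span the space. *)
Record reflection_group (R : realType) (V : vectType R) (ip : {dot V for idfun})
    (Pp : {fset V}) (Dl : set V) (G : set (V -> V)) : Prop := ReflectionGroup {
  rg_simple : forall a, Dl a -> a \in Pp;
  rg_opp : forall b, b \in Pp -> - b \notin Pp;
  rg_permute : forall a b, Dl a -> b \in Pp -> b != a -> refl ip a b \in Pp;
  rg_int : forall a b, Dl a -> b \in Pp -> ip b (vee ip a) \is a Num.int;
  rg_le0 : forall x, (forall a, Dl a -> ip x a <= 0) ->
    forall b, b \in Pp -> ip x b <= 0;
  rg_gt0 : forall x, (forall a, Dl a -> 0 < ip x a) ->
    forall b, b \in Pp -> 0 < ip x b;
  rg_finite : finite_set G;
  rg_isom : forall w, G w -> lin_isom ip w;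
  rg_id : G id;
  rg_comp : forall u w, G u -> G w -> G (u \o w);
  rg_inv : forall w, G w -> exists2 w', G w' & cancel w w' /\ cancel w' w;
  rg_root : forall w b, G w -> b \in Pp -> w b \in Pp \/ - w b \in Pp;
  rg_refl : forall a, Dl a -> G (refl ip a);
  rg_free : forall w, G w -> (forall b, b \in Pp -> w b \in Pp) -> w = id }.

(** [chi] specialises the formal exponentials. It is multiplicative on [L] only, because the
    characters to be plugged in are powers with floored exponents, exact only on a lattice. The
    orbit condition on [t] allows for a sign, as [w b] may be a negative root. *)
Record root_character (R : realType) (V : vectType R) (Pp : {fset V})
    (Dl : set V) (G : set (V -> V)) (L : set V) (chi t : V -> R) : Prop := RootCharacter {
  rc_root : forall b, b \in Pp -> L b;
  rc_0 : L 0;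
  rc_sub : forall x y, L x -> L y -> L (x - y);
  rc_add : forall x y, L x -> L y -> chi (x + y) = chi x * chi y;
  rc_chi0 : chi 0 = 1;
  rc_simple : forall a, Dl a -> chi a = t a;
  rc_inv : forall w b c, G w -> b \in Pp -> c \in Pp ->
    w b = c \/ w b = - c -> t b = t c }.

Section Poincare.
Context (R : realType) (V : vectType R) (ip : {dot V for idfun}).
Context (Pp : {fset V}) (Dl : set V) (G : set (V -> V)).
Context (L : set V) (chi t : V -> R).
Hypothesis HG : reflection_group ip Pp Dl G.
Hypothesis HC : root_character Pp Dl G L chi t.
Local Notation vee := (vee ip).
Local Notation refl := (refl ip).
Local Notation K := (fset_sub_type Pp).

Let hD := rg_simple HG.
Let hN := rg_opp HG.
Let hS := rg_permute HG.
Let hI := rg_int HG.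
Let hle := rg_le0 HG.
Let hgt := rg_gt0 HG.
Let hGf := rg_finite HG.
Let hGi := rg_isom HG.
Let hG1 := rg_id HG.
Let hGM := rg_comp HG.
Let hGV := rg_inv HG.
Let hGP := rg_root HG.
Let hGD := rg_refl HG.
Let hGT := rg_free HG.
Let hLP := rc_root HC.
Let hL0 := rc_0 HC.
Let hLB := rc_sub HC.
Let chiD := rc_add HC.
Let chi0 := rc_chi0 HC.
Let chiD1 := rc_simple HC.
Let ht := rc_inv HC.

Let Pn0 b : b \in Pp -> b != 0.
Proof. by move=> bP; apply/eqP => b0; have := hN bP; move: bP; rewrite b0 oppr0 => ->. Qed.

Let LN x : L x -> L (- x).
Proof. by move=> Lx; rewrite -sub0r; apply: hLB. Qed.
Let LD x y : L x -> L y -> L (x + y).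
Proof. by move=> Lx Ly; rewrite -[y]opprK; apply: hLB => //; apply: LN. Qed.
Let Lsum (P : pred K) (F : K -> V) : (forall i, P i -> L (F i)) ->
  L (\sum_(i | P i) F i).
Proof. by move=> LF; elim/big_ind: _ => //; exact: LD. Qed.
Let chi_sum (P : pred K) (F : K -> V) : (forall i, P i -> L (F i)) ->
  chi (\sum_(i | P i) F i) = \prod_(i | P i) chi (F i).
Proof.
move=> LF; suff: L (\sum_(i | P i) F i) /\
  chi (\sum_(i | P i) F i) = \prod_(i | P i) chi (F i) by case.
elim/big_rec2: _ => [//|i y z Pi [Ly <-]].
by split; [apply: LD|rewrite chiD] => //; apply: LF.
Qed.
Let chiN x : L x -> chi x * chi (- x) = 1.
Proof. by move=> Lx; rewrite -chiD ?subrr//; apply: LN. Qed.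

(** [G] acts on [Pp] by signed permutations: [absroot w] is the permutation and [sgnroot w] gives
    the signs. For [w] in [G] the default of [insubd] is never reached. *)
Definition sgnroot (w : V -> V) (b : K) : R := if w (val b) \in Pp then 1 else -1.
Definition absroot (w : V -> V) (b : K) : K := insubd b (sgnroot w b *: w (val b)).

Let sgnroot_sq w b : sgnroot w b * sgnroot w b = 1.
Proof. by rewrite /sgnroot; case: ifP => _; ring. Qed.

Let absrootE w b : G w -> val (absroot w b) = sgnroot w b *: w (val b).
Proof.
move=> Gw; rewrite val_insubd /sgnroot.
have [wb|wb] := boolP (w (val b) \in Pp); first by rewrite scale1r wb.
rewrite scaleN1r ifT//; have [] // := hGP Gw (valP b).
by rewrite (negbTE wb).
Qed.

Let act_root w b : G w -> w (val b) = sgnroot w b *: val (absroot w b).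
Proof. by move=> Gw; rewrite absrootE// scalerA sgnroot_sq scale1r. Qed.

Let absroot_uniq w (b c : K) s : G w -> (s = 1 \/ s = -1) ->
  w (val b) = s *: val c -> absroot w b = c /\ sgnroot w b = s.
Proof.
move=> Gw s1 wbc; have sE : sgnroot w b = s.
  rewrite /sgnroot wbc; case: s1 => ->; first by rewrite scale1r (valP c).
  by rewrite scaleN1r (negbTE (hN (valP c))).
split=> //; apply: val_inj; rewrite absrootE// wbc sE scalerA.
by case: s1 => ->; rewrite ?mulrNN mul1r scale1r.
Qed.

Let sgnroot1 w b : sgnroot w b = 1 \/ sgnroot w b = -1.
Proof. by rewrite /sgnroot; case: ifP; [left|right]. Qed.

Let absroot_comp u w b : G u -> G w ->
  absroot (u \o w) b = absroot u (absroot w b) /\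
  sgnroot (u \o w) b = sgnroot w b * sgnroot u (absroot w b).
Proof.
move=> Gu Gw; apply: absroot_uniq; first exact: hGM.
  have [->|->] := sgnroot1 w b; have [->|->] := sgnroot1 u (absroot w b);
    rewrite ?mulN1r ?mul1r ?opprK; by [left|right].
by rewrite /= act_root// (isomZ (hGi Gu)) act_root// scalerA.
Qed.

Let absroot_inj w : G w -> injective (absroot w).
Proof.
move=> Gw b c bc; have := act_root b Gw; have := act_root c Gw.
rewrite -bc => wc wb.
have : val b = val c \/ val b = - val c.
  have [e1|e1] := sgnroot1 w b; have [e2|e2] := sgnroot1 w c;
   move: wb wc; rewrite e1 e2 ?scale1r ?scaleN1r => wb wc;
   [left|right|right|left]; apply: (isom_inj (hGi Gw));
   by rewrite ?(isomN (hGi Gw)) wb wc ?opprK.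
case=> [/val_inj//|bc']; have := hN (valP c).
by rewrite -bc' (valP b).
Qed.

Let absroot_bij w : G w -> bijective (absroot w).
Proof. by move=> Gw; apply: injF_bij; exact: absroot_inj. Qed.

Let reindexP w (F : K -> R) : G w -> \prod_b F b = \prod_b F (absroot w b).
Proof. by move=> Gw; rewrite (reindex (absroot w)) //; apply: onW_bij; exact: absroot_bij. Qed.
Let reindexS w (F : K -> V) : G w -> \sum_b F b = \sum_b F (absroot w b).
Proof. by move=> Gw; rewrite (reindex (absroot w)) //; apply: onW_bij; exact: absroot_bij. Qed.

(** The sign character (-1)^l(w), read off from the inversions so that multiplicativity is a
    reindexing along [absroot]. *)
Definition sgnelt w : R := \prod_b sgnroot w b.

Let sgnelt_comp u w : G u -> G w -> sgnelt (u \o w) = sgnelt u * sgnelt w.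
Proof.
move=> Gu Gw; rewrite /sgnelt (reindexP (sgnroot u) Gw) -big_split/=.
by apply: eq_bigr => b _; rewrite (absroot_comp b Gu Gw).2 mulrC.
Qed.

Let sgnelt_id : sgnelt id = 1.
Proof. by rewrite /sgnelt big1// => b _; rewrite /sgnroot (valP b). Qed.

Let sgnelt_sq w : sgnelt w * sgnelt w = 1.
Proof. by rewrite -big_split big1// => b _; exact: sgnroot_sq. Qed.

(** These are the weights rho - sum of S that occur when the Weyl denominator is expanded. Written
    with flipped signs they are visibly permuted by the group, through [actset]. *)
Definition halfsum (S : {set K}) : V :=
  2^-1 *: \sum_b (if b \in S then - val b else val b).
Local Notation S0 := (finset.set0 : {set K}).
Local Notation rho := (halfsum S0).

Definition actset w (S : {set K}) : {set K} :=
  [set absroot w b | b in [set b | (b \in S) (+) (sgnroot w b == -1)]]%SET.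

Let m1 : (1 == -1 :> R) = false.
Proof. by apply/eqP; lra. Qed.

Let actsetE w S b : G w ->
  (absroot w b \in actset w S) = (b \in S) (+) (sgnroot w b == -1).
Proof. by move=> Gw; rewrite finset.mem_imset ?inE//; exact: absroot_inj. Qed.

Let act_halfsum w S : G w -> w (halfsum S) = halfsum (actset w S).
Proof.
move=> Gw; rewrite (isomZ (hGi Gw)) (isom_sum (hGi Gw)) /halfsum.
congr (_ *: _); rewrite [RHS](reindexS _ Gw); apply: eq_bigr => b _.
rewrite actsetE//; have [e|e] := sgnroot1 w b; rewrite absrootE// e.
  by rewrite m1 addbF scale1r; case: ifP; rewrite ?(isomN (hGi Gw)).
rewrite eqxx addbT scaleN1r opprK.
by case: (b \in S); rewrite ?(isomN (hGi Gw)).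
Qed.

Let rhoB S : rho - halfsum S = \sum_(b in S) val b.
Proof.
rewrite /halfsum -scalerBr -sumrB [in RHS]big_mkcond/= scaler_sumr.
apply: eq_bigr => b _; rewrite inE; case: ifP => _.
  by rewrite opprK -{1 2}[val b]scale1r -scalerDl scalerA (_ : _ * _ = 1) ?scale1r//; field.
by rewrite subrr scaler0.
Qed.

Let LrhoB S : L (rho - halfsum S).
Proof. by rewrite rhoB; apply: Lsum => b _; apply: hLP; exact: valP. Qed.

Let chi_rhoB S : chi (rho - halfsum S) = \prod_(b in S) chi (val b).
Proof. by rewrite rhoB chi_sum// => b _; apply: hLP; exact: valP. Qed.

Let refl_rho a : Dl a -> refl a rho = rho - a.
Proof.
move=> Da; have Ga := hGD Da; rewrite act_halfsum//.
suff -> : actset (refl a) S0 = [set [` hD Da]%fset]%SET.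
  by apply/eqP; rewrite eq_sym subr_eq addrC -subr_eq rhoB big_set1.
apply/setP => b; have [c _ cK] := absroot_bij Ga.
rewrite -(cK b) actsetE// !inE/=.
have [/eqP e|e] := boolP (sgnroot (refl a) (c b) == -1).
  apply/esym/eqP/val_inj; rewrite absrootE// e/=.
  have -> : val (c b) = a.
    apply/eqP; apply: contra_eqT e => ca; rewrite /sgnroot hS//; last exact: valP.
    by rewrite m1.
  by rewrite (refl_self _ (Pn0 (hD Da))) ?scaleN1r ?opprK.
apply/esym/eqP => ab; move: e; have := act_root (c b) Ga; rewrite ab/=.
have [->|->] := sgnroot1 (refl a) (c b); last by rewrite eqxx.
rewrite scale1r => e _; have a0 := Pn0 (hD Da); have := hN (hD Da).
by rewrite -(refl_self ip a0) -[X in refl a X]e reflK// (valP (c b)).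
Qed.

Let sgnelt_refl a : Dl a -> sgnelt (refl a) = -1.
Proof.
move=> Da; rewrite /sgnelt (bigD1 [` hD Da]%fset)//= {1}/sgnroot /=.
rewrite (refl_self _ (Pn0 (hD Da))) (negbTE (hN (hD Da))) big1 ?mulr1// => b ba.
by rewrite /sgnroot hS ?(valP b).
Qed.

Let ip_rho a : Dl a -> ip rho (vee a) = 1.
Proof.
move=> Da; have := refl_rho Da; rewrite /Defs.refl => /addrI/oppr_inj/eqP.
rewrite -[X in _ == X]scale1r -subr_eq0 -scalerBl scaler_eq0.
by rewrite (negbTE (Pn0 (hD Da))) orbF subr_eq0 => /eqP.
Qed.

Let rho_gt0 b : b \in Pp -> 0 < ip rho b.
Proof.
apply: hgt => a Da; rewrite -(ip_vee_gt0 _ _ (Pn0 (hD Da))).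
by rewrite ip_rho.
Qed.

(** The Weyl numerator of the weight [halfsum S]. Exponents are taken relative to rho because half
    sums need not lie in [L], whereas these differences do. *)
Definition altsum S : R := \sum_(w \in G) sgnelt w * chi (rho - w (halfsum S)).

Let reindexG (F : (V -> V) -> R) v : G v ->
  \sum_(w \in G) F w = \sum_(w \in G) F (w \o v).
Proof.
move=> Gv; rewrite (reindex_fsbig (fun w : V -> V => w \o v) G G)//; split.
- by move=> w Gw; apply: hGM.
- move=> u w _ _ uw; have [v' _ [_ vK]] := hGV Gv.
  by apply/funext => x; rewrite -[x]vK; have := congr1 (fun f => f (v' x)) uw.
- move=> w Gw; have [v' Gv' [vK _]] := hGV Gv.
  by exists (w \o v'); [exact: hGM|apply/funext => x /=; rewrite vK].
Qed.

Let altsum_act v S : G v -> altsum (actset v S) = sgnelt v * altsum S.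
Proof.
move=> Gv; rewrite /altsum [in RHS](reindexG _ Gv) mulr_fsumr.
apply: eq_fsbigr => w /set_mem Gw.
rewrite /= (act_halfsum S Gv) (sgnelt_comp Gw Gv).
by rewrite -[LHS]mul1r -(sgnelt_sq v); ring.
Qed.

(** Antisymmetry: the reflection in [a] changes the sign of the alternating sum but fixes the
    weight. *)
Let altsum_sing a S : Dl a -> refl a (halfsum S) = halfsum S -> altsum S = 0.
Proof.
move=> Da hS0; have Ga := hGD Da; have := altsum_act S Ga.
rewrite sgnelt_refl// {1}/altsum -act_halfsum// hS0 -/(altsum S).
lra.
Qed.

Definition invset w : {set K} := [set b | sgnroot w b == -1]%SET.

Let actsetK_inv u S : G u -> actset u S = S0 -> S = invset u.
Proof.
move=> Gu S0; apply/setP => b; have := actsetE S b Gu; rewrite S0 !inE.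
by case: (b \in S); case: (_ == _).
Qed.

Let act_invset u : G u -> actset u (invset u) = S0.
Proof.
move=> Gu; apply/setP => b; have [c _ cK] := absroot_bij Gu.
by rewrite -(cK b) actsetE// !inE addbb.
Qed.

(* Macdonald's argument: move [halfsum S] into the dominant chamber; either it is
   fixed by a simple reflection, or it is regular and then dominance of
   [rho - sum S'] forces [S' = S0]. *)
Let altsum_dich S : altsum S = 0 \/ exists2 u, G u & S = invset u.
Proof.
have [u Gu umax] := finite_argmax (fun w => ip (w (halfsum S)) rho) hGf hG1.
set S' := actset u S.
have uS : u (halfsum S) = halfsum S' by exact: act_halfsum.
have dom a : Dl a -> 0 <= ip (halfsum S') a.
  move=> Da; have := umax (refl a \o u) (hGM (hGD Da) Gu).
  rewrite /= uS (ip_reflC _ _ _ (Pn0 (hD Da))) refl_rho// ipBr.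
  by rewrite lerBlDr lerDl.
have [[a Da a0]|hreg] := pselect (exists2 a, Dl a & ip (halfsum S') a = 0).
  left; have := altsum_act S Gu; rewrite -/S' (altsum_sing Da (refl_fix a0)).
  move=> /esym/eqP; rewrite mulf_eq0 => /orP[/eqP u0|/eqP//].
  by have := sgnelt_sq u; rewrite u0 mul0r => /eqP; rewrite eq_sym oner_eq0.
right; exists u => //; apply: actsetK_inv => //; rewrite -/S'.
(* The integer <sum of S', a^vee> is strictly below <rho, a^vee> = 1, hence at most 0. A sum of
   positive roots that is antidominant has squared norm at most 0. *)
have neg a : Dl a -> ip (\sum_(b in S') val b) a <= 0.
  move=> Da; have aP := hD Da; rewrite -ip_vee_le0 ?Pn0//.
  have pos : 0 < ip (halfsum S') (vee a).
    rewrite ip_vee_gt0 ?Pn0// lt_neqAle dom// andbT eq_sym.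
    by apply/eqP => a0; apply: hreg; exists a.
  have : ip rho (vee a) - ip (\sum_(b in S') val b) (vee a) = ip (halfsum S') (vee a).
    by rewrite -rhoB ipBl; ring.
  rewrite ip_rho// => E; rewrite -E in pos.
  have : ip (\sum_(b in S') val b) (vee a) \is a Num.int.
    by rewrite ip_suml; apply: rpred_sum => b _; apply: hI => //; exact: valP.
  move=> /intrP[m mE]; move: pos; rewrite mE subr_gt0 (ltrz1 R) lerz0.
  lia.
have sum0 : \sum_(b in S') val b = 0.
  apply/eqP; rewrite -(ip_eq0 ip); apply/eqP/le_anti; rewrite ip_ge0 andbT.
  rewrite ip_sumr.
  by apply: sumr_le0 => b _; apply: hle => //; exact: valP.
apply/eqP; rewrite -finset.subset0; apply/fintype.subsetP => b bS; exfalso.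
have : 0 < ip rho (\sum_(b in S') val b).
  rewrite ip_sumr (bigD1 b)//= ltr_wpDr ?rho_gt0 ?(valP b)//.
  by apply: sumr_ge0 => c _; apply/ltW/rho_gt0/valP.
by rewrite sum0 ip0r ltxx.
Qed.

Let altsum_inv u : G u ->
  (\prod_(b in invset u) -1) * altsum (invset u) = altsum S0.
Proof.
move=> Gu; have := altsum_act (invset u) Gu; rewrite act_invset// => ->.
congr (_ * _); rewrite /sgnelt [RHS](bigID (mem (invset u)))/=.
rewrite [X in _ = _ * X]big1 ?mulr1; last first.
  by move=> b; rewrite inE; case: (sgnroot1 u b) => -> //; rewrite eqxx.
by apply: eq_bigr => b; rewrite inE => /eqP ->.
Qed.

(** Equal inversion sets make u v^-1 preserve [Pp], and [rg_free] applies. *)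
Let invset_inj u v : G u -> G v -> invset u = invset v -> u = v.
Proof.
move=> Gu Gv uv; have sE b : sgnroot u b = sgnroot v b.
  move/setP/(_ b): uv; rewrite !inE.
  by case: (sgnroot1 u b) => ->; case: (sgnroot1 v b) => ->; rewrite ?eqxx ?m1.
have [v' Gv' [vK v'K]] := hGV Gv.
have uv' : u \o v' = id.
  apply: hGT; first exact: hGM.
  move=> b bP; pose c := absroot v' [` bP]%fset.
  have E := act_root [` bP]%fset Gv'; rewrite /= -/c in E.
  have : sgnroot v' [` bP]%fset * sgnroot v c = 1.
    rewrite -(absroot_comp _ Gv Gv').2 (_ : v \o v' = id); last exact/funext.
    by rewrite /sgnroot /= bP.
  rewrite -sE -(absroot_comp _ Gu Gv').2 /sgnroot /=.
  by case: ifP => // _ /eqP; rewrite eq_sym m1.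
by apply/funext => x; rewrite -[in LHS](vK x) -[RHS]/(id (v x)) -uv'.
Qed.

Definition poincare (tau : V -> R) : R :=
  \sum_(w \in G) \prod_(b in invset w) tau (val b).

(** Each product is expanded over the subsets S of positive roots and the sums are exchanged, so
    that S contributes its alternating sum. By [altsum_dich] only inversion sets survive, and there
    the sign (-1)^|S| cancels the one in [altsum_inv], leaving the product of [tau] over S. *)
Let altsum_expand (tau : V -> R) :
  \sum_(w \in G) sgnelt w * chi (rho - w rho)
    * \prod_(b : K) (1 - tau (val b) * chi (w (val b))) = poincare tau * altsum S0.
Proof.
have expand w : G w -> sgnelt w * chi (rho - w rho)
    * \prod_(b : K) (1 - tau (val b) * chi (w (val b))) =
  \sum_(S : {set K}) (\prod_(b in S) - tau (val b)) *
     (sgnelt w * chi (rho - w (halfsum S))).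
  move=> Gw; under eq_bigr do rewrite addrC.
  rewrite bigA_distr mulr_sumr; apply: eq_bigr => S _.
  have Lw (b : K) : L (w (val b)).
    rewrite act_root//; case: (sgnroot1 w b) => ->; rewrite ?scale1r ?scaleN1r.
      exact/hLP/valP.
    exact/LN/hLP/valP.
  have -> : rho - w (halfsum S) = rho - w rho + \sum_(b in S) w (val b).
    have := rhoB S => /(congr1 w); rewrite (isomB (hGi Gw)) (isom_sum (hGi Gw)).
    by move=> <-; rewrite addrA subrK.
  have -> : chi (rho - w rho + \sum_(b in S) w (val b)) =
      chi (rho - w rho) * \prod_(b in S) chi (w (val b)).
    by rewrite chiD ?chi_sum//; [rewrite act_halfsum//; exact: LrhoB|exact: Lsum].
  have -> : \prod_(b : K) (if b \in S then - (tau (val b) * chi (w (val b))) else 1) =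
      (\prod_(b in S) - tau (val b)) * \prod_(b in S) chi (w (val b)).
    rewrite -big_split/= [in RHS]big_mkcond/=; apply: eq_bigr => b _.
    by case: ifP => // _; rewrite mulNr.
  ring.
under eq_fsbigr => w /set_mem Gw do rewrite (expand w Gw).
rewrite fsbig_finite//= exchange_big/=.
under eq_bigr => S _ do rewrite -fsbig_finite// -mulr_fsumr -/(altsum S).
pose inv := [set invset w | w in G]%classic.
have Fin : finite_set inv by exact: finite_image.
rewrite (bigID (fun S => S \in inv))/= [X in _ + X]big1 ?addr0; last first.
  move=> S /negP Sinv; case: (altsum_dich S) => [->|[u Gu Su]]; first by rewrite mulr0.
  by case: Sinv; apply/mem_set; exists u.
transitivity (\sum_(S \in inv) (\prod_(b in S) tau (val b)) * altsum S0).
  rewrite -[inv in RHS]set_mem_set -(bigfs _ (r := index_enum {set K})) ?index_enum_uniq//; last first.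
    by move=> S _; rewrite mem_index_enum.
  apply: eq_bigr => S /set_mem[u Gu <-].
  rewrite -(altsum_inv Gu) mulrA; congr (_ * _); rewrite -big_split/=.
  by apply: eq_bigr => b _; ring.
rewrite -mulr_fsuml; congr (_ * _); apply: fsbig_image => u v /set_mem Gu /set_mem Gv.
exact: invset_inj.
Qed.

(** Weyl's denominator formula, obtained as the case tau = 1: every w then contributes the same
    product, and the order of the group cancels because it is nonzero in [R]. *)
Let altsum_denominator : altsum S0 = \prod_(b : K) (1 - chi (val b)).
Proof.
have := altsum_expand (fun=> 1).
have -> : poincare (fun=> 1) = \sum_(w \in G) (1 : R).
  by apply: eq_fsbigr => w _; rewrite big1.
have term w : G w -> sgnelt w * chi (rho - w rho) * \prod_(b : K) (1 - 1 * chi (w (val b)))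
    = \prod_(b : K) (1 - chi (val b)).
  move=> Gw; rewrite act_halfsum// chi_rhoB /sgnelt [X in _ * X * _]big_mkcond/=.
  rewrite [X in _ * X * _](reindexP _ Gw) [RHS](reindexP _ Gw) -!big_split/=.
  apply: eq_bigr => b _; rewrite actsetE// inE/= act_root//.
  have Lb := hLP (valP (absroot w b)).
  case: (sgnroot1 w b) => ->; first by rewrite m1 scale1r !mul1r.
  rewrite eqxx/= scaleN1r; have := chiN Lb; set x := chi _; set y := chi _ => xy.
  by rewrite mul1r mulrBr mulr1 mulN1r mulNr xy; ring.
under eq_fsbigr => w /set_mem Gw do rewrite (term w Gw).
have -> : \sum_(w \in G) \prod_(b : K) (1 - chi (val b)) =
   (\sum_(w \in G) (1 : R)) * \prod_(b : K) (1 - chi (val b)).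
  by rewrite mulr_fsuml; under [RHS]eq_fsbigr do rewrite mul1r.
move=> /mulfI -> //; apply/eqP => G0.
have /(_ id hG1)/eqP := @pfsumr_eq0 _ _ G (fun=> 1 : R) hGf (fun _ _ => ler01) G0.
by rewrite oner_eq0.
Qed.

Let poincareE tau :
  poincare tau = \sum_(w \in G) \prod_(b <- Pp | w b \notin Pp) tau b.
Proof.
apply: eq_fsbigr => w _; rewrite [RHS]big_mkcond/= big_seq_fsetE/= big_mkcond/=.
apply: eq_bigr => b _; rewrite inE /sgnroot.
by case: (w _ \in Pp); rewrite ?m1 ?eqxx.
Qed.

Lemma regular_vector : exists x, forall b, b \in Pp -> 0 < ip x b.
Proof. by exists rho; exact: rho_gt0. Qed.

(** [altsum_expand] is used with tau = t. If w is not the identity, w^-1 makes some simple [a]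
    negative; the factor of b = - w^-1 a is then 1 - t_a chi(-a), which vanishes since chi a = t a.
    Only w = id is left. *)
Lemma poincare_product :
  (\sum_(w \in G) \prod_(b <- Pp | w b \notin Pp) t b) * \prod_(b <- Pp) (1 - chi b) = \prod_(b <- Pp) (1 - t b * chi b).
Proof.
rewrite -poincareE !big_seq_fsetE/= -altsum_denominator -altsum_expand.
rewrite (fsbigD1 (@id V : V -> V))//= fsbig1 ?addr0; last first.
  move=> w [Gw /= w1]; have [w' Gw' [wK w'K]] := hGV Gw.
  have [[a Da aN]|hpos] := pselect (exists2 a, Dl a & w' a \notin Pp).
    have aP := hD Da; have : - w' a \in Pp by case: (hGP Gw' aP) => // ; rewrite (negbTE aN).
    move=> bP; rewrite (bigD1 [` bP]%fset)//= (isomN (hGi Gw)) w'K.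
    have -> : t (- w' a) = t a.
      by apply: (ht Gw bP aP); right; rewrite (isomN (hGi Gw)) w'K.
    by rewrite -chiD1// chiN ?subrr ?mul0r ?mulr0//; exact: hLP.
  (* Here w^-1 keeps every simple root positive, so w rho pairs positively with the simple roots,
     hence with all of [Pp]; thus w^-1 preserves [Pp]. *)
  exfalso; apply: w1; have w'1 : w' = id.
    apply: hGT => // b bP.
    have : 0 < ip (w rho) b.
      apply: hgt => // a Da; rewrite -[a]w'K (isom_ip (hGi Gw)).
      apply: rho_gt0; apply: contrapT => /negP aN; apply: hpos; by exists a.
    rewrite -{1}[b]w'K (isom_ip (hGi Gw)) => pos.
    case: (hGP Gw' bP) => // /rho_gt0; rewrite ipNr; lra.
  by apply/funext => x; rewrite -[RHS](w'K x) w'1.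
rewrite sgnelt_id subrr chi0 !mul1r; by [].
Qed.

End Poincare.

Lemma partition_fsbig (M : nmodType) (I J : choiceType) (A : set I) (B : set J)
    (Q : I -> J -> Prop) (F : I -> M) : finite_set A -> finite_set B ->
  (forall i, A i -> exists2 x, B x & forall x', B x' -> (Q i x' <-> x' = x)) ->
  \sum_(i \in A) F i = \sum_(x \in B) \sum_(i \in [set i | A i /\ Q i x]) F i.
Proof.
move=> finA finB hQ.
under [RHS]eq_fsbigr => x _ do rewrite (_ : [set i | _] = A `&` [set i | Q i x])// fsbig_mkcondr.
rewrite [RHS]exchange_fsbig//; apply: eq_fsbigr => i /set_mem Ai.
have [x Bx hx] := hQ i Ai; rewrite (fsbigD1 x)//= mem_set; last exact/hx.
rewrite fsbig1 ?addr0// => x' [Bx' xx']; rewrite memNset//= => /(hx _ Bx') E.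
exact: xx'.
Qed.

(** * Stabilizers and orbits of a point of the chamber *)

Section Parabolic.
Context (R : realType) (V : vectType R) (ip : {dot V for idfun}).
Context (Pp : {fset V}) (Dl : set V) (G : set (V -> V)).
Hypothesis HG : reflection_group ip Pp Dl G.
Implicit Types (x y b : V) (u w : V -> V).
Local Notation refl := (refl ip).

Let Pn0 b : b \in Pp -> b != 0.
Proof. by move=> bP; apply/eqP => b0; have := rg_opp HG bP; move: bP; rewrite b0 oppr0 => ->. Qed.

Definition chamber x : Prop := forall b, b \in Pp -> 0 <= ip x b.

Definition wall_roots y : {fset V} := [fset b in Pp | ip y b == 0]%fset.
Definition wall_simple y : set V := [set a | Dl a /\ ip y a = 0].

Lemma wall_rootsP y b : (b \in wall_roots y) = (b \in Pp) && (ip y b == 0).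
Proof. by rewrite !inE. Qed.

(** Moving far in the direction of [y] makes every root off the walls of [y] positive and leaves the
    values on the walls unchanged. This reduces the cone conditions for the wall roots to those for
    [Pp]. *)
Lemma chamber_shift y x : chamber y ->
  exists2 k, 0 <= k & forall b, b \in Pp -> ip y b != 0 -> 0 < ip (x + k *: y) b.
Proof.
(* The sum dominates each single bound that is needed; a root with <y, b> = 0 contributes 1,
   division by zero being 0. *)
move=> hy; exists (\sum_(b <- Pp) (1 + `|ip x b| / ip y b)).
  by rewrite big_seq_cond; apply: sumr_ge0 => b /andP[bP _]; rewrite addr_ge0// divr_ge0//; exact: hy.
move=> b bP yb0; have yb : 0 < ip y b by rewrite lt_neqAle eq_sym yb0 hy.
have h : 1 + `|ip x b| / ip y b <= \sum_(b <- Pp) (1 + `|ip x b| / ip y b).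
  rewrite (big_fsetD1 b bP)/= lerDl; rewrite big_seq_cond; apply: sumr_ge0 => d.
  by rewrite !inE => /andP[/andP[_ dP] _]; rewrite addr_ge0// divr_ge0//; exact: hy.
rewrite ipDl ipZl; move: h; rewrite -(ler_pM2r yb) mulrDl mul1r divfK// => h.
have := ler_norm (- ip x b); rewrite normrN; lra.
Qed.

Lemma chamber_wall y x : chamber y -> (forall a, wall_simple y a -> 0 <= ip x a) ->
  forall b, b \in wall_roots y -> 0 <= ip x b.
Proof.
move=> hy hx b; rewrite wall_rootsP => /andP[bP /eqP yb].
have [k k0 hk] := chamber_shift x hy.
have := @rg_le0 _ _ _ _ _ _ HG (- (x + k *: y)); rewrite /= => /(_ _ b bP).
rewrite ipNl ipDl ipZl yb mulr0 addr0 oppr_le0; apply=> a Da.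
rewrite ipNl oppr_le0; have [ya|ya] := eqVneq (ip y a) 0.
  by rewrite ipDl ipZl ya mulr0 addr0 hx.
exact/ltW/hk/ya/(rg_simple HG).
Qed.

(* [u] is the element of minimal length among those moving [x] to [y]. *)
Lemma chamber_move x y u0 : chamber y -> G u0 -> u0 x = y ->
  exists u, [/\ G u, u x = y & forall b, b \in Pp -> ip x b = 0 -> u b \in Pp].
Proof.
move=> hy Gu0 u0x; have [z hz] := regular_vector HG.
have fin : finite_set [set u | G u /\ u x = y] by apply: sub_finite_set (rg_finite HG) => u [].
(* Minimal length is expressed metrically: [u z] is as close as possible to the regular vector [z].
   A wall reflection composed with [u] still moves [x] to [y], so it cannot bring the image
   closer. *)
have [u [Gu ux] umax] := finite_argmax (fun u => ip (u z) z) fin (conj Gu0 u0x).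
have iu := rg_isom HG Gu; have [u' Gu' [uK u'K]] := rg_inv HG Gu.
have pos b : b \in wall_roots y -> 0 <= ip (u z) b.
  apply: chamber_wall => // a [Da ya]; have aP := rg_simple HG Da; have a0 := Pn0 aP.
  have Gr := rg_refl HG Da; have := umax (refl a \o u).
  move=> /(_ (conj (rg_comp HG Gr Gu) _)); rewrite /= ux refl_fix// => /(_ erefl).
  rewrite /Defs.refl ipBl ipZl gerBl pmulr_lge0 ?ip_vee_ge0//.
  by rewrite ipC hz.
exists u; split=> // b bP xb; case: (rg_root HG Gu bP) => // nP; exfalso.
have : - u b \in wall_roots y.
  by rewrite wall_rootsP nP ipNr -ux (isom_ip iu) xb oppr0 eqxx.
by move=> /pos; rewrite ipNr (isom_ip iu) oppr_ge0 leNgt hz.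
Qed.

(** With the [u] of [chamber_move], roots vanishing at [x] stay positive by minimality, the others
    because <y, u b> = <x, b> > 0; hence u = id. *)
Lemma chamber_unique x y u : chamber x -> chamber y -> G u -> u x = y -> x = y.
Proof.
move=> hx hy Gu0 u0x; have [{Gu0 u0x}u [Gu ux hu]] := chamber_move hy Gu0 u0x.
have iu := rg_isom HG Gu.
suff u1 : u = id by rewrite -ux u1.
apply: (rg_free HG Gu) => b bP; have [xb|xb] := eqVneq (ip x b) 0; first exact: hu.
case: (rg_root HG Gu bP) => // /hy; rewrite ipNr -ux (isom_ip iu) => h.
by exfalso; move/negP: xb; apply; rewrite eq_le hx// andbT -oppr_ge0.
Qed.

(** Freeness is inherited because an element fixing [y] keeps the roots off the walls of [y]
    positive. The cone conditions come from [chamber_shift]. *)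
Lemma wall_group y : chamber y ->
  reflection_group ip (wall_roots y) (wall_simple y) [set w | G w /\ w y = y].
Proof.
move=> hy; split.
- by move=> a [Da ya]; rewrite wall_rootsP (rg_simple HG Da) ya eqxx.
- by move=> b; rewrite !wall_rootsP => /andP[/(rg_opp HG)/negbTE ->].
- move=> a b [Da ya]; rewrite !wall_rootsP => /andP[bP /eqP yb] ba.
  by rewrite (rg_permute HG)//= /Defs.refl ipBr ipZr ya yb mulr0 subr0.
- by move=> a b [Da ya]; rewrite wall_rootsP => /andP[bP _]; exact: (rg_int HG).
- move=> x hx b bW; rewrite -oppr_ge0 -ipNl; apply: (chamber_wall hy) bW => a h.
  by rewrite ipNl oppr_ge0 hx.
- move=> x hx b; rewrite wall_rootsP => /andP[bP /eqP yb].
  have [k k0 hk] := chamber_shift x hy.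
  have := @rg_gt0 _ _ _ _ _ _ HG (x + k *: y); rewrite /= => /(_ _ b bP).
  rewrite ipDl ipZl yb mulr0 addr0; apply=> a Da.
  have [ya|ya] := eqVneq (ip y a) 0; first by rewrite ipDl ipZl ya mulr0 addr0 hx.
  exact/hk/ya/(rg_simple HG).
- by apply: sub_finite_set (rg_finite HG) => w [].
- by move=> w [/(rg_isom HG)].
- by split=> //; exact: (rg_id HG).
- by move=> u w [Gu uy] [Gw wy]; split; [exact: (rg_comp HG)|rewrite /= wy].
- move=> w [Gw wy]; have [w' Gw' [wK w'K]] := rg_inv HG Gw.
  by exists w'; split=> //; rewrite -{1}wy wK.
- move=> w b [Gw wy]; rewrite !wall_rootsP => /andP[bP yb].
  have e : ip y (w b) = 0 by rewrite -{1}wy (isom_ip (rg_isom HG Gw)) (eqP yb).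
  by case: (rg_root HG Gw bP) => ->; [left|right]; rewrite ?ipNr e ?oppr0 eqxx.
- by move=> a [Da ya]; split; [exact: (rg_refl HG)|exact: refl_fix].
- move=> w [Gw wy] hw; apply: (rg_free HG Gw) => b bP.
  have [yb|yb] := eqVneq (ip y b) 0.
    by have := hw b; rewrite !wall_rootsP bP yb eqxx => /(_ isT)/andP[].
  case: (rg_root HG Gw bP) => // /hy; rewrite ipNr -{1}wy (isom_ip (rg_isom HG Gw)) => h.
  by exfalso; move/negP: yb; apply; rewrite eq_le hy// andbT -oppr_ge0.
Qed.

Lemma wall_big (y : V) (P : pred V) (f : V -> R) :
  \prod_(b <- wall_roots y | P b) f b = \prod_(b <- Pp | (ip y b == 0) && P b) f b.
Proof.
rewrite -big_filter_cond; apply: perm_big; apply: uniq_perm.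
- exact: fset_uniq.
- by rewrite filter_uniq// fset_uniq.
- by move=> b; rewrite mem_filter wall_rootsP andbC.
Qed.

Section Sum.
Context (L : set V) (chi t : V -> R).
Hypothesis HC : root_character Pp Dl G L chi t.

Lemma wall_character y :
  root_character (wall_roots y) (wall_simple y) [set w | G w /\ w y = y] L chi t.
Proof.
split.
- by move=> b; rewrite wall_rootsP => /andP[/(rc_root HC)].
- exact: (rc_0 HC).
- exact: (rc_sub HC).
- exact: (rc_add HC).
- exact: (rc_chi0 HC).
- by move=> a [/(rc_simple HC)].
- move=> w b c [Gw _]; rewrite !wall_rootsP => /andP[bP _] /andP[cP _].
  exact: (rc_inv HC).
Qed.

Let len w : R := \prod_(b <- Pp | w b \notin Pp) t b.

(** The elements moving [x] to [y] are the products v u, with u from [chamber_move] and v in the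
    stabilizer of [y]. The inversions of v u are the b with <x, b> < 0 together with the pullbacks
    under u of the wall roots inverted by v. *)
Let fiber_sum y x : chamber y -> (exists2 u, G u & u x = y) ->
  \sum_(w \in [set w | G w /\ w x = y]) len w =
  (\prod_(b <- Pp | ip x b < 0) t b) *
  \sum_(w \in [set w | G w /\ w y = y]) \prod_(b <- wall_roots y | w b \notin wall_roots y) t b.
Proof.
move=> hy [u0 Gu0 u0x]; have [u [Gu ux hu]] := chamber_move hy Gu0 u0x.
have iu := rg_isom HG Gu; have [u' Gu' [uK u'K]] := rg_inv HG Gu.
have u'y : u' y = x by rewrite -ux uK.
rewrite mulr_fsumr (reindex_fsbig (fun w : V -> V => w \o u) [set w | G w /\ w y = y]); last first.
  split.
  - by move=> w [Gw wy]; split; [exact: (rg_comp HG)|rewrite /= ux].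
  - move=> v w _ _ vw; apply/funext => z; rewrite -[z]u'K.
    by have := congr1 (fun f => f (u' z)) vw.
  - move=> w [Gw wx]; exists (w \o u'); last by apply/funext => z /=; rewrite uK.
    by split; [exact: (rg_comp HG)|rewrite /= u'y].
apply: eq_fsbigr => w /set_mem[Gw wy]; have iw := rg_isom HG Gw.
have Gwu := rg_comp HG Gw Gu; have iwu := rg_isom HG Gwu.
have ipwu b : ip y (w (u b)) = ip x b by rewrite -{1}wy (isom_ip iw) -ux (isom_ip iu).
rewrite /len (bigID (fun b => ip x b < 0))/=; congr (_ * _).
  rewrite big_seq_cond [RHS]big_seq_cond; apply: eq_bigl => b.
  case: (boolP (b \in Pp)) => //= bP; case: ltP => //; rewrite ?andbT ?andbF// => xb.
  by apply/negP => /hy; rewrite ipwu leNgt xb.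
have E b : b \in Pp -> (w (u b) \notin Pp) && ~~ (ip x b < 0) =
    (ip x b == 0) && (w (u b) \notin Pp).
  move=> bP; rewrite andbC; case: (boolP (w (u b) \in Pp)) => [|wb]; first by rewrite !andbF.
  rewrite !andbT -leNgt le_eqVlt eq_sym orbC; case: ltP => //= xb; apply/esym/negP => x0.
  case: (rg_root HG Gwu bP) => [|/hy]; first by move: wb => /negP.
  by rewrite ipNr /= ipwu oppr_ge0 leNgt xb.
transitivity (\prod_(b <- Pp | (ip x b == 0) && (w (u b) \notin Pp)) t b).
  rewrite big_seq_cond [RHS]big_seq_cond; apply: eq_bigl => b.
  by case: (boolP (b \in Pp)) => //= bP; exact: E.
rewrite -wall_big.
have -> : \prod_(b <- wall_roots x | w (u b) \notin Pp) t b =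
   \prod_(b <- [seq u b | b <- wall_roots x] | w b \notin Pp) t b.
  rewrite big_map big_seq_cond [RHS]big_seq_cond; apply: eq_bigr => b.
  rewrite wall_rootsP => /andP[/andP[bP /eqP xb] _]; apply: (rc_inv HC Gu bP); last by left.
  exact: hu.
rewrite (perm_big (wall_roots y)) /=.
  rewrite big_seq_cond [RHS]big_seq_cond; apply: eq_bigl => b.
  case: (boolP (b \in _)) => //=; rewrite !wall_rootsP => /andP[bP /eqP yb].
  by rewrite (_ : ip y (w b) = 0) ?eqxx ?andbT// -{1}wy (isom_ip iw).
apply: uniq_perm; [|exact: fset_uniq|].
  by rewrite map_inj_uniq ?fset_uniq//; exact: isom_inj iu.
move=> b; rewrite wall_rootsP; apply/mapP/andP => [[d dW ->]|[bP /eqP yb]].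
  move: dW; rewrite wall_rootsP => /andP[dP /eqP xd]; split; first exact: hu.
  by rewrite -ux (isom_ip iu) xd.
exists (u' b); last by rewrite u'K.
have xb : ip x (u' b) = 0 by rewrite -u'y (isom_ip (rg_isom HG Gu')).
rewrite wall_rootsP xb eqxx andbT; case: (rg_root HG Gu' bP) => // nP.
have := hu _ nP; rewrite ipNr xb oppr0 (isomN iu) u'K => /(_ erefl) h.
by have := rg_opp HG bP; rewrite h.
Qed.

(** Macdonald's formula for [G] is divided by the one for the stabilizer of [y]. That t b chi b
    differs from 1 makes the right-hand side for the stabilizer cancellable; that chi b differs from
    1 makes the denominators meaningful. *)
Lemma orbit_product y : chamber y ->
  (forall b, b \in Pp -> chi b != 1) -> (forall b, b \in Pp -> t b * chi b != 1) ->
  \sum_(x \in [set w y | w in G]) \prod_(b <- Pp | ip x b < 0) t b =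
  \prod_(b <- Pp | 0 < ip y b) ((1 - t b * chi b) / (1 - chi b)).
Proof.
move=> hy n1 n2; pose O := [set w y | w in G].
have finO : finite_set O by apply: finite_image; exact: (rg_finite HG).
have full : \sum_(w \in G) len w =
  (\sum_(x \in O) \prod_(b <- Pp | ip x b < 0) t b) *
  \sum_(w \in [set w | G w /\ w y = y]) \prod_(b <- wall_roots y | w b \notin wall_roots y) t b.
  rewrite mulr_fsuml.
  have -> : \sum_(w \in G) len w = \sum_(x \in O) \sum_(w \in [set w | G w /\ w x = y]) len w.
    apply: (@partition_fsbig _ _ _ G O (fun w x => w x = y)) => //; first exact: (rg_finite HG).
    move=> w Gw; have [w' Gw' [wK w'K]] := rg_inv HG Gw; exists (w' y); first by exists w'.
    by move=> x _; split=> [<-|->]; rewrite ?wK ?w'K.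
  apply: eq_fsbigr => x /set_mem[w Gw <-]; apply: fiber_sum => //.
  by have [w' Gw' [wK _]] := rg_inv HG Gw; exists w'; rewrite // wK.
have P1 := poincare_product HG HC.
have P2 := poincare_product (wall_group hy) (wall_character y).
rewrite full in P1; set S := \sum_(x \in O) _ in P1 *; move: P1 P2.
set Pm := \sum_(w \in _) _ => P1 P2.
have split_wall (f : V -> R) : \prod_(b <- Pp) f b =
    (\prod_(b <- Pp | 0 < ip y b) f b) * \prod_(b <- wall_roots y) f b.
  rewrite (bigID (fun b => 0 < ip y b))/=; congr (_ * _).
  rewrite [RHS](wall_big y xpredT) big_seq_cond [RHS]big_seq_cond.
  apply: eq_bigl => b; case: (boolP (b \in Pp)) => //= bP.
  by rewrite -leNgt eq_le hy// !andbT.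
rewrite !split_wall mulrACA P2 in P1.
have nz (f : V -> R) (P : pred V) : (forall b, b \in Pp -> f b != 1) ->
    \prod_(b <- Pp | P b) (1 - f b) != 0.
  move=> hf; rewrite prodf_seq_neq0; apply/allP => b bP; apply/implyP => _.
  by rewrite subr_eq0 eq_sym hf.
rewrite prodf_div; apply: (mulIf (nz chi (fun b => 0 < ip y b) n1)); rewrite divfK; last exact: nz.
apply: mulIf P1.
by rewrite (wall_big y xpredT); exact: nz.
Qed.

End Sum.
End Parabolic.

Lemma generated_comp_closed (T : Type) (S : set (T -> T)) u w :
  generated S u -> generated S w -> generated S (u \o w).
Proof.
by move=> Su Sw; elim: Su => [//|s u' Ss _ IH]; exact: (generated_comp Ss IH).
Qed.

Lemma generated_sub (T : Type) (S : set (T -> T)) s : S s -> generated S s.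
Proof. by move=> Ss; have := generated_comp Ss (generated_id S). Qed.

Lemma generated_inv (T : Type) (S : set (T -> T)) w :
  (forall s, S s -> involutive s) -> generated S w ->
  exists2 w', generated S w' & cancel w w' /\ cancel w' w.
Proof.
move=> Sinv; elim=> [|s u Ss _ [u' Su' [uK u'K]]]; first by exists id => //; exact: generated_id.
exists (u' \o s); first exact/generated_comp_closed/generated_sub.
by split=> x /=; rewrite ?(Sinv _ Ss) ?uK// u'K (Sinv _ Ss).
Qed.

(** * Root systems and Weyl groups *)

Section FiniteRoots.
Context (R : realType) (V : vectType R) (n : nat) (D : root_datum V n).
Implicit Types (a b x : V) (i : 'I_n) (w : V -> V).
Local Notation ip := (ip D).
Local Notation vee := (vee ip).
Local Notation refl := (refl ip).
Local Notation al := (tnth (base D)).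
Local Notation coord := (coord (base D)).
Local Notation Phi := (Defs.roots D).
Local Notation pos := (posroots D).
Local Notation weyl := (weyl D).

Lemma root_neq0 a : a \in Phi -> a != 0.
Proof.
have [_ n0 _ _ _] := root_systemP D.
by move=> aP; apply/eqP => a0; move: n0; rewrite -a0 aP.
Qed.

Lemma root_refl a b : a \in Phi -> b \in Phi -> refl a b \in Phi.
Proof. by have [_ _ + _ _] := root_systemP D; apply. Qed.

Lemma root_int a b : a \in Phi -> b \in Phi -> ip b (vee a) \is a Num.int.
Proof. by have [_ _ _ + _] := root_systemP D; apply. Qed.

Lemma root_scale a k : a \in Phi -> k *: a \in Phi -> k = 1 \/ k = -1.
Proof. by have [_ _ _ _ +] := root_systemP D; apply. Qed.

Lemma root_opp a : a \in Phi -> - a \in Phi.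
Proof. by move=> aP; rewrite -(refl_self ip (root_neq0 aP)) root_refl. Qed.

Lemma base_basis : basis_of fullv (base D).
Proof. by have [] := baseP D. Qed.

Lemma simple_root i : al i \in Phi.
Proof. by have [] := baseP D. Qed.

Lemma simple_neq0 i : al i != 0.
Proof. exact/root_neq0/simple_root. Qed.

Lemma coord_simple i j : coord i (al j) = (i == j)%:R.
Proof. by rewrite (tnth_nth 0) coord_free ?(basis_free base_basis)// eq_sym. Qed.

Lemma simple_expand x : x = \sum_i coord i x *: al i.
Proof.
rewrite {1}(coord_basis base_basis (memvf x)); apply: eq_bigr => i _.
by rewrite (tnth_nth 0).
Qed.

Lemma posE a : (a \in pos) = (a \in Phi) && [forall i, 0 <= coord i a].
Proof. by rewrite !inE. Qed.

Lemma pos_root a : a \in pos -> a \in Phi.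
Proof. by rewrite posE => /andP[]. Qed.

Lemma pos_coord a i : a \in pos -> 0 <= coord i a.
Proof. by rewrite posE => /andP[_ /forallP]. Qed.

Lemma pos_neq0 a : a \in pos -> a != 0.
Proof. by move/pos_root/root_neq0. Qed.

Lemma root_pos a : a \in Phi -> a \in pos \/ - a \in pos.
Proof.
move=> aP; have [_ _ /(_ a aP)[h|h]] := baseP D; [left|right]; rewrite posE ?root_opp ?aP//=;
  by apply/forallP => i; apply: natr_ge0.
Qed.

Lemma posN a : a \in pos -> - a \notin pos.
Proof.
move=> aP; apply/negP => aN; have /eqP := pos_neq0 aP; apply.
rewrite [LHS]simple_expand big1// => i _.
have := pos_coord i aP; have := pos_coord i aN; rewrite linearN/= => c1 c2.
by rewrite (_ : coord i a = 0) ?scale0r//; lra.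
Qed.

Lemma root_negP a : a \in Phi -> (- a \in pos) = (a \notin pos).
Proof.
move=> aP; have [h|h] := root_pos aP; first by rewrite h (negbTE (posN h)).
by rewrite h; have := posN h; rewrite opprK => ->.
Qed.

Lemma simple_pos i : al i \in pos.
Proof.
rewrite posE simple_root; apply/forallP => j.
by rewrite coord_simple ler0n.
Qed.

Lemma simple_refl_pos i a : a \in pos -> a != al i -> refl (al i) a \in pos.
Proof.
move=> aP ai; have rP := root_refl (simple_root i) (pos_root aP).
case: (root_pos rP) => // nP; exfalso.
have a0 j : j != i -> coord j a = 0.
  move=> ji; have := pos_coord j nP; have := pos_coord j aP.
  rewrite linearN linearB linearZ/= coord_simple (negbTE ji) mulr0 subr0 => c1 c2.
  by apply/eqP; rewrite eq_le c1 -oppr_ge0 c2.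
have aE : a = coord i a *: al i.
  rewrite [LHS]simple_expand (bigD1 i)//= big1 ?addr0// => j /a0 ->.
  by rewrite scale0r.
have := pos_root aP; rewrite aE => /(root_scale (simple_root i)) [c1|c1].
  by move: ai; rewrite aE c1 scale1r eqxx.
by have := pos_coord i aP; rewrite c1; lra.
Qed.

Lemma dominant_pos x a : (forall i, 0 <= ip x (al i)) -> a \in pos -> 0 <= ip x a.
Proof.
move=> dom aP; rewrite (simple_expand a) ip_sumr; apply: sumr_ge0 => i _.
by rewrite ipZr mulr_ge0// pos_coord.
Qed.

Lemma pos_simple_gt0 a : a \in pos -> exists i, 0 < ip a (al i).
Proof.
move=> aP; apply: contrapT => h; have := ip_gt0 ip (pos_neq0 aP).
rewrite {2}(simple_expand a) ip_sumr ltNge => /negP; apply.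
apply: sumr_le0 => i _; rewrite ipZr mulr_ge0_le0 ?pos_coord// leNgt.
by apply/negP => p; apply: h; exists i.
Qed.

Definition height x : R := \sum_i coord i x.

Lemma heightB x y : height (x - y) = height x - height y.
Proof. by rewrite -sumrB; apply: eq_bigr => i _; rewrite linearB. Qed.

Lemma heightZ k x : height (k *: x) = k * height x.
Proof. by rewrite mulr_sumr; apply: eq_bigr => i _; rewrite linearZ. Qed.

Lemma height_simple i : height (al i) = 1.
Proof.
rewrite /height (bigD1 i)//= coord_simple eqxx big1 ?addr0// => j ji.
by rewrite coord_simple (negbTE ji).
Qed.

Lemma height_ge0 a : a \in pos -> 0 <= height a.
Proof. by move=> aP; apply: sumr_ge0 => i _; exact: pos_coord. Qed.

Lemma int_gt0_ge1 (x : R) : x \is a Num.int -> 0 < x -> 1 <= x.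
Proof. by move=> /intrP[m ->]; rewrite ltr0z ler1z; lia. Qed.

(** Every positive root pairs positively with some simple root; unless the two coincide, the
    reflection keeps it positive and lowers its height by at least 1. *)
Lemma pos_ind (Q : V -> Prop) :
  (forall i, Q (al i)) ->
  (forall a i, a \in pos -> refl (al i) a \in pos -> 0 < ip a (vee (al i)) ->
     Q (refl (al i) a) -> Q a) ->
  forall a, a \in pos -> Q a.
Proof.
move=> Q0 Q1; suff H (N : nat) a : a \in pos -> height a < N%:R -> Q a.
  move=> a aP; apply: (H (Num.truncn (height a)).+1) => //.
  exact: truncnS_gt.
elim: N a => [|N IH] a aP hN; first by have := height_ge0 aP; lra.
have [i ai] := pos_simple_gt0 aP.
have [->|ani] := eqVneq a (al i); first exact: Q0.
have rP := simple_refl_pos aP ani.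
rewrite -(ip_vee_gt0 _ _ (simple_neq0 i)) in ai.
apply: (Q1 a i) => //; apply: IH => //.
rewrite /Defs.refl heightB heightZ height_simple mulr1.
have := int_gt0_ge1 (root_int (simple_root i) (pos_root aP)) ai.
by rewrite -(natr1 N) in hN; move=> h1; lra.
Qed.

Lemma weyl1 : weyl id. Proof. exact: generated_id. Qed.

Lemma weylM u w : weyl u -> weyl w -> weyl (u \o w).
Proof. exact: generated_comp_closed. Qed.

Lemma weyl_refl a : a \in Phi -> weyl (refl a).
Proof. by move=> aP; apply: generated_sub; exists a. Qed.

Lemma weyl_isom w : weyl w -> lin_isom ip w.
Proof.
elim=> [|s u [a /= aP <-] _ IH]; first exact: lin_isom_id.
by apply: lin_isom_comp => //; apply: lin_isom_refl; exact: root_neq0.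
Qed.

Lemma weylV w : weyl w -> exists2 w', weyl w' & cancel w w' /\ cancel w' w.
Proof.
by apply: generated_inv => s [a /= aP <-]; apply: reflK; exact: root_neq0.
Qed.

Lemma weyl_root w a : weyl w -> a \in Phi -> w a \in Phi.
Proof.
move=> Ww aP; elim: Ww => [//|s u [b /= bP <-] _ IH] /=.
exact: root_refl.
Qed.

(** A Weyl group element is linear, hence determined by the roots to which it sends the simple
    ones. *)
Lemma finite_weyl : finite_set weyl.
Proof.
pose T := {ffun 'I_n -> fset_sub_type Phi}.
pose g (f : T) x := \sum_i coord i x *: val (f i).
apply: (@sub_finite_set _ _ (g @` [set: T])); last exact/finite_image/finite_finset.
move=> w Ww; exists [ffun i => [` weyl_root Ww (simple_root i)]%fset] => //.
apply/funext => x; rewrite [in RHS](simple_expand x) (isom_sum (weyl_isom Ww)).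
by apply: eq_bigr => i _; rewrite ffunE (isomZ (weyl_isom Ww)).
Qed.

Lemma weyl_orbit_act w x y : weyl w -> weyl_orbit D x y -> weyl_orbit D x (w y).
Proof. by move=> Ww [u Wu <-]; exists (w \o u) => //; exact: weylM. Qed.

Lemma finite_weyl_orbit x : finite_set (weyl_orbit D x).
Proof. exact/finite_image/finite_weyl. Qed.

Lemma weyl_orbit_sym x y : weyl_orbit D x y -> weyl_orbit D y x.
Proof. by move=> [w Ww <-]; have [w' Ww' [wK _]] := weylV Ww; exists w'. Qed.

Lemma root_fullv (x : V) : (forall a, a \in Phi -> ip x a = 0) -> x = 0.
Proof.
move=> x0; apply/eqP; rewrite -(ip_eq0 ip) {2}(simple_expand x) ip_sumr big1// => i _.
by rewrite ipZr x0 ?mulr0// simple_root.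
Qed.

(** The vector b - (k / 2) a is the part of [b] orthogonal to [a], and it is nonzero because the
    system is reduced. So k^2 |a|^2 < 4 |b|^2 <= 4 |a|^2, and the integer k is at most 1 in absolute
    value. *)
Lemma root_pairing a b : a \in Phi -> b \in Phi -> ip b b <= ip a a ->
  b != a -> b != - a -> -1 <= ip b (vee a) <= 1.
Proof.
move=> aP bP ba bna bnN; have a0 := root_neq0 aP; have pa := ip_gt0 ip a0.
set k := ip b (vee a).
have kE : k = 2 / ip a a * ip b a by rewrite /k ip_vee.
have kI : k \is a Num.int by exact: root_int.
have npr : b - (k / 2) *: a != 0.
  rewrite subr_eq0; apply/eqP => bE; have := bP; rewrite bE => /(root_scale aP)[e|e].
    by move: bna; rewrite bE e scale1r eqxx.
  by move: bnN; rewrite bE e scaleN1r eqxx.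
have := ip_gt0 ip npr.
rewrite ipBl !ipBr !ipZl !ipZr (ipC ip a b).
have -> : ip b a = k * ip a a / 2 by rewrite kE; field; rewrite gt_eqF.
move=> h; have k4 : k ^+ 2 < 4.
  rewrite -subr_gt0 -(pmulr_lgt0 _ pa).
  move: ba h; move: (ip a a) (ip b b) (k) => A B l; nra.
move: kI k4 => /intrP[m ->]; rewrite -[4]/(4%:~R) -rmorphXn/= ltr_int => m4.
rewrite -[-1]/((-1)%:~R) ler_int lerz1; rewrite expr2 in m4; apply/andP; split; nia.
Qed.
End FiniteRoots.

(** * Groups generated by simple reflections: exchange and freeness *)

Section Generation.
Context (R : realType) (V : vectType R) (ip : {dot V for idfun}).
Context (Pp : {fset V}) (Dl : set V).
Hypothesis hD : forall a, Dl a -> a \in Pp.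
Hypothesis hN : forall b, b \in Pp -> - b \notin Pp.
Hypothesis hS : forall a b, Dl a -> b \in Pp -> b != a -> refl ip a b \in Pp.
Local Notation refl := (refl ip).
Local Notation G := (generated [set refl a | a in Dl]).

Let Pn0 b : b \in Pp -> b != 0.
Proof. by move=> bP; apply/eqP => b0; have := hN bP; move: bP; rewrite b0 oppr0 => ->. Qed.

Let word (s : seq V) : V -> V := foldr (fun a w => refl a \o w) id s.
Let simples (s : seq V) : Prop := forall a, a \in s -> Dl a.

Let simples_cons a s : simples (a :: s) <-> Dl a /\ simples s.
Proof.
split=> [h|[Da h] b]; last by rewrite inE => /orP[/eqP->//|/h].
by split=> [|b bs]; apply: h; rewrite inE ?eqxx// bs orbT.
Qed.

Let word_rcons s a : word (rcons s a) = word s \o refl a.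
Proof. by elim: s => //= b s ->. Qed.

Let simples_rcons s a : simples (rcons s a) -> Dl a /\ simples s.
Proof.
by move=> h; split=> [|b bs]; apply: h; rewrite mem_rcons inE ?eqxx// bs orbT.
Qed.

Let word_isom s : simples s -> lin_isom ip (word s).
Proof.
elim: s => [_|a s IH /simples_cons[Da hs]]; first exact: lin_isom_id.
by apply: lin_isom_comp; [exact/lin_isom_refl/Pn0/hD|exact: IH].
Qed.

Lemma generated_isom w : G w -> lin_isom ip w.
Proof.
elim=> [|u v [a Da <-] _ IH]; first exact: lin_isom_id.
by apply: lin_isom_comp => //; exact/lin_isom_refl/Pn0/hD.
Qed.

Lemma generated_root w b : G w -> b \in Pp -> w b \in Pp \/ - w b \in Pp.
Proof.
move=> Gw bP; elim: Gw => [|u v [a Da <-] _ IH]; first by left.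
have a0 := Pn0 (hD Da); have step d : d \in Pp -> refl a d \in Pp \/ - refl a d \in Pp.
  move=> dP; have [->|da] := eqVneq d a; last by left; exact: hS.
  by right; rewrite refl_self// opprK; exact: hD.
case: IH => /step //=.
by rewrite (isomN (lin_isom_refl ip a0)) opprK => -[]; [right|left].
Qed.

Let generated_word w : G w -> exists2 s, simples s & word s = w.
Proof.
elim=> [|u v [a Da <-] _ [s hs <-]]; first by exists [::].
by exists (a :: s) => //; apply/simples_cons.
Qed.

(** The letter at which the image of [a] turns negative has that image as its root, so the
    reflection in [a] cancels this letter. *)
Let exchange s a : simples s -> Dl a -> word s a \notin Pp ->
  exists s', [/\ simples s', (size s' < size s)%N & word s \o refl a = word s'].
Proof.
move=> hs Da; elim: s hs => [_ /negP[]|b s IH /simples_cons[Db hs] /= nP]; first exact: hD.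
have [sP|sN] := boolP (word s a \in Pp).
  have E : word s a = b.
    by apply/eqP; apply: contraNT nP => ne; exact: hS.
  exists s; split=> //; apply/funext => x /=.
  rewrite (isom_refl (word_isom hs)) E reflK//; exact/Pn0/hD.
have [s' [hs' ss' E]] := IH hs sN; exists (b :: s'); split=> //=.
  exact/simples_cons.
by rewrite -E.
Qed.

(** If w = v s_a keeps [a] positive, then v makes it negative, and the exchange condition rewrites w
    as a word shorter than that of v. The induction ends at the empty word. *)
Lemma generated_free w : G w -> (forall b, b \in Pp -> w b \in Pp) -> w = id.
Proof.
move=> /generated_word[s hs <-].
move: {2}(size s) (leqnn (size s)) hs => k; elim: k s => [|k IH] s.
  by rewrite leqn0 size_eq0 => /eqP ->.
case/lastP: s => [//|s a]; rewrite size_rcons ltnS => sk /simples_rcons[Da hs].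
rewrite word_rcons => hP; have aP := hD Da; have a0 := Pn0 aP.
have sN : word s a \notin Pp.
  have := hP _ aP; rewrite /= refl_self// (isomN (word_isom hs)) => /hN.
  by rewrite opprK.
have [s' [hs' ss' E]] := exchange hs Da sN; rewrite E in hP *.
by apply: IH => //; exact: leq_trans (ltnW ss') sk.
Qed.

End Generation.

(** * Dominant roots, the two root lengths and the map [hat] *)

Section DominantRoots.
Context (R : realType) (V : vectType R) (n : nat) (D : root_datum V n).
Implicit Types (a b x : V) (i : 'I_n) (w : V -> V).
Local Notation ip := (ip D).
Local Notation vee := (vee ip).
Local Notation refl := (refl ip).
Local Notation al := (tnth (base D)).
Local Notation coord := (coord (base D)).
Local Notation Phi := (Defs.roots D).
Local Notation pos := (posroots D).
Local Notation weyl := (weyl D).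
Local Notation phi := (phi D).
Local Notation theta := (vartheta D).

Definition dominant x := forall i, 0 <= ip x (al i).

Lemma phi_root : phi \in Phi. Proof. by have [] := phiP D. Qed.
Lemma theta_root : theta \in Phi. Proof. by have [[]] := varthetaP D. Qed.
Lemma theta_short a : a \in Phi -> ip theta theta <= ip a a.
Proof. by have [[_ +] _] := varthetaP D; apply. Qed.

Lemma coord_refl i a j : coord j (refl (al i) a) = coord j a - ip a (vee (al i)) * (j == i)%:R.
Proof. by rewrite linearB linearZ/= coord_simple. Qed.

Lemma highest_dominant (S : set V) a : (forall b i, S b -> S (refl (al i) b)) ->
  highest (base D) S a -> dominant a.
Proof.
move=> Srefl [Sa high] i; rewrite -(ip_vee_ge0 _ _ (simple_neq0 D i)).
have := natr_ge0 (high _ (Srefl _ i Sa) i).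
by rewrite linearB/= coord_refl eqxx mulr1 opprB addrC subrK.
Qed.

Lemma phi_dominant : dominant phi.
Proof.
apply: highest_dominant (phiP D) => b i /= bP.
by rewrite root_refl ?simple_root.
Qed.

Lemma theta_dominant : dominant theta.
Proof.
apply: highest_dominant (varthetaP D) => b i [bP bs].
split; first by rewrite root_refl ?simple_root.
by move=> a aP; rewrite ip_refl ?simple_neq0// bs.
Qed.

Lemma dominant_ip x y : dominant x -> (forall i, 0 <= coord i y) -> 0 <= ip x y.
Proof.
move=> dx y0; rewrite (simple_expand D y) ip_sumr; apply: sumr_ge0 => i _.
by rewrite ipZr mulr_ge0.
Qed.

Lemma dominant_phi_ip x a : dominant x -> a \in Phi -> ip x a <= ip x phi.
Proof.
move=> dx aP; have [_ high] := phiP D; rewrite -subr_ge0 -ipBr.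
by apply: dominant_ip => // i; apply: natr_ge0; apply: high.
Qed.

Lemma dominant_theta_ip x a : dominant x -> a \in Phi -> ip a a = ip theta theta ->
  ip x a <= ip x theta.
Proof.
move=> dx aP e; have [_ high] := varthetaP D; rewrite -subr_ge0 -ipBr.
apply: dominant_ip => // i; apply: natr_ge0; apply: high.
by split=> // b bP; rewrite e theta_short.
Qed.

Lemma dominant_root_pos a : a \in Phi -> dominant a -> a \in pos.
Proof.
move=> aP da; case: (root_pos aP) => // nP.
have := dominant_pos da nP; rewrite ipNr => h.
by have := ip_gt0 ip (root_neq0 aP); lra.
Qed.

Lemma pairing1 a b : a \in Phi -> b \in Phi -> ip b b <= ip a a ->
  b != a -> 0 < ip b a -> ip b (vee a) = 1.
Proof.
move=> aP bP ba bna bpos; have bnN : b != - a.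
  apply/eqP => bE; move: bpos; rewrite bE ipNl.
  by have := ip_gt0 ip (root_neq0 aP); lra.
have /andP[_ h1] := root_pairing aP bP ba bna bnN.
have := int_gt0_ge1 (root_int aP bP); rewrite ip_vee_gt0; last exact: root_neq0 aP.
by move=> /(_ bpos) h2; apply/eqP; rewrite eq_le h1.
Qed.

(** Otherwise <a, b^vee> = 1, so a - b is a root; whichever of a - b and b - a is positive pairs
    negatively with the dominant root that it subtracts. *)
Lemma dominant_root_eq a b : a \in Phi -> b \in Phi -> dominant a -> dominant b ->
  ip a a = ip b b -> 0 < ip a b -> a = b.
Proof.
move=> aP bP da db ab pab; apply/eqP; apply: contrapT => /negP nab.
have pa := ip_gt0 ip (root_neq0 aP).
have e1 : ip a (vee b) = 1 by apply: pairing1; rewrite ?ab.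
have h : ip a b = ip b b / 2 by rewrite -(ip_veeK ip a (root_neq0 bP)) e1 mul1r.
have abP : a - b \in Phi.
  by have := root_refl bP aP; rewrite /Defs.refl e1 scale1r.
case: (root_pos abP) => [/(dominant_pos db)|]; first by rewrite ipBr ipC; lra.
by rewrite opprB => /(dominant_pos da); rewrite ipBr; lra.
Qed.

Lemma dominant_root_le_phi a : a \in Phi -> dominant a -> ip a a <= ip phi phi.
Proof.
move=> aP da; apply: (le_trans (dominant_phi_ip da aP)); rewrite ipC.
by apply: dominant_phi_ip aP; exact: phi_dominant.
Qed.

Lemma dominant_root_phi_gt0 a : a \in Phi -> dominant a -> 0 < ip a phi.
Proof.
move=> aP da; apply: (lt_le_trans (ip_gt0 ip (root_neq0 aP))).
exact: dominant_phi_ip.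
Qed.

(* A dominant root of intermediate length would give squared lengths 6 : 3 : 2. *)
Lemma dominant_rootP a : a \in Phi -> dominant a -> a = phi \/ a = theta.
Proof.
move=> aP da; have pa := ip_gt0 ip (root_neq0 aP).
have [e|ne] := eqVneq (ip a a) (ip phi phi).
  by left; apply: dominant_root_eq => //; [exact: phi_root|exact: phi_dominant|exact: dominant_root_phi_gt0].
have [e|ne2] := eqVneq (ip a a) (ip theta theta).
  right; apply: dominant_root_eq => //; [exact: theta_root|exact: theta_dominant|].
  exact/(lt_le_trans pa)/dominant_theta_ip.
exfalso; have lt1 : ip a a < ip phi phi by rewrite lt_neqAle ne dominant_root_le_phi.
have lt2 : ip theta theta < ip a a by rewrite lt_neqAle eq_sym ne2 theta_short.
(* A dominant root shorter than phi satisfies <b, phi^vee> = 1, so |phi|^2 = p |b|^2 with p = <phi,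
   b^vee>, an integer that must be 2 or 3. *)
have lenratio b : b \in Phi -> dominant b -> ip b b < ip phi phi ->
    ip b phi = ip phi phi / 2 /\ (ip phi phi = 2 * ip b b \/ ip phi phi = 3 * ip b b).
  move=> bP db blt; have pb := ip_gt0 ip (root_neq0 bP).
  have bphi : b != phi by apply: contraTneq blt => ->; rewrite ltxx.
  have q1 : ip b (vee phi) = 1.
    by apply: (pairing1 phi_root bP (ltW blt) bphi); exact: dominant_root_phi_gt0.
  have E : ip b phi = ip phi phi / 2.
    by rewrite -(ip_veeK ip b (root_neq0 phi_root)) q1 mul1r.
  split=> //; have := root_int bP phi_root; set p := ip phi (vee b) => pI.
  have pE : ip phi phi = p * ip b b.
    have := ip_veeK ip phi (root_neq0 bP); rewrite -/p (ipC ip phi) E => h.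
    lra.
  have npr : phi - (p / 2) *: b != 0.
    rewrite subr_eq0; apply/eqP => phE; have := phi_root; rewrite phE.
    by move=> /(root_scale bP) [e|e]; move: blt; rewrite phE e ?scale1r ?scaleN1r ?ipNl ?ipNr ?opprK ltxx.
  have := ip_gt0 ip npr; rewrite ipBl !ipBr !ipZl !ipZr (ipC ip phi b) E pE => h.
  have p4 : p < 4.
    rewrite -subr_gt0 -(pmulr_lgt0 _ pb) -(pmulr_lgt0 _ (_ : 0 < p)); first by nra.
    by rewrite -(pmulr_lgt0 _ pb) -pE; lra.
  have p1 : 1 < p by rewrite -subr_gt0 -(pmulr_lgt0 _ pb); lra.
  move: pI p4 p1 pE => /intrP[m ->]; rewrite -[4]/(4%:~R) ltr_int ltr1z => m4 m1 pE.
  have : m = 2 \/ m = 3 by clear -m4 m1; lia.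
  by case=> ->; rewrite rmorph_nat; [left|right].
have [E1 Ea] := lenratio a aP da lt1.
have [E2 Et] := lenratio theta theta_root theta_dominant (lt_trans lt2 lt1).
have NA : ip phi phi = 2 * ip a a by case: Ea => //; case: Et; lra.
have NT : ip phi phi = 3 * ip theta theta by case: Et => //; lra.
have := dominant_pos theta_dominant (dominant_root_pos aP da); rewrite le_eqVlt => /orP[/eqP a0|apos].
  (* The coefficients 1 and 3/2 are those of the orthogonal projection of phi on the span of [a] and
     theta. In the scale 6 : 3 : 2 the remainder would have squared norm -3/2. *)
  have := ip_ge0 ip (phi - a - (3 / 2) *: theta).
  rewrite !(ipBl, ipBr, ipZl, ipZr) (ipC ip phi a) (ipC ip phi theta) (ipC ip a theta).
  rewrite E1 E2 -a0 => h; have pt := ip_gt0 ip (root_neq0 theta_root).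
  lra.
(* In the same scale this gives <a, theta> = 3/2 and hence <a, theta^vee> = 3/2, which is not an
   integer. *)
have e1 : ip theta (vee a) = 1.
  apply: (pairing1 aP theta_root (ltW lt2) _ apos).
  by apply: contraTneq lt2 => ->; rewrite ltxx.
have := ip_veeK ip theta (root_neq0 aP); rewrite e1 => E3.
have := root_int theta_root aP => /intrP[m mE].
have := ip_veeK ip a (root_neq0 theta_root); rewrite mE ipC -E3 => E4.
have pt := ip_gt0 ip (root_neq0 theta_root).
have m2 : m%:~R * 2 = 3 :> R.
  apply: (mulIf (_ : ip theta theta != 0)); first by rewrite gt_eqF.
  lra.
have : (m * 2)%:~R = 3%:~R :> R by rewrite rmorphM.
by move=> /intr_inj; lia.
Qed.

(** A member of the orbit of largest height is dominant. So there are at most two orbits of roots,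
    and the parameters are determined by t_phi and t_theta. *)
Lemma root_conj a : a \in Phi -> exists2 w, weyl w & w a = phi \/ w a = theta.
Proof.
move=> aP; have [w Ww wmax] := finite_argmax (fun w => height D (w a)) (finite_weyl D) (weyl1 D).
exists w => //; apply: dominant_rootP; first exact: weyl_root.
move=> i; rewrite -(ip_vee_ge0 _ _ (simple_neq0 D i)).
have := wmax (refl (al i) \o w) (weylM (weyl_refl (simple_root D i)) Ww).
by rewrite /= /Defs.refl heightB heightZ height_simple mulr1 lerBlDr lerDl.
Qed.

Lemma root_le_phi a : a \in Phi -> ip a a <= ip phi phi.
Proof.
move=> aP; have [w Ww wa] := root_conj aP.
rewrite -(isom_ip (weyl_isom Ww)); case: wa => -> //.
exact: theta_short phi_root.
Qed.

(** In both admissible cases [hat psi] is the highest root of hat R_0 and coincides with the coroot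
    of [psi]; the affine wall of the alcove is <x, psi^vee> = c. Most arguments can thus treat the
    two cases together. *)
Definition psi : V := - alpha0 D.

Lemma psi_cases : psi = phi \/ psi = theta.
Proof. by rewrite /psi /alpha0; case: (kind D); rewrite opprK; [right|left]. Qed.

Lemma psi_root : psi \in Phi.
Proof. by case: psi_cases => ->; [exact: phi_root|exact: theta_root]. Qed.

Lemma psi_dominant : dominant psi.
Proof. by case: psi_cases => ->; [exact: phi_dominant|exact: theta_dominant]. Qed.

Lemma psi_pos : psi \in pos.
Proof. exact/dominant_root_pos/psi_dominant/psi_root. Qed.

Lemma alpha0E : alpha0 D = - psi. Proof. by rewrite /psi opprK. Qed.

Lemma alpha0_root : alpha0 D \in Phi.
Proof. by rewrite alpha0E root_opp ?psi_root. Qed.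

Lemma dominant_root_psi_gt0 a : a \in Phi -> dominant a -> 0 < ip a psi.
Proof.
move=> aP da; case: psi_cases => ->; first exact: dominant_root_phi_gt0.
case: (dominant_rootP aP da) => ->.
  by rewrite ipC; apply: dominant_root_phi_gt0; [exact: theta_root|exact: theta_dominant].
exact/ip_gt0/root_neq0/theta_root.
Qed.

Definition hatscale a : R :=
  if kind D is HatDual then 2 / ip a a else 2 / ip phi phi.

Lemma hatE a : hat D a = hatscale a *: a.
Proof. by rewrite /hat /hatscale; case: (kind D). Qed.

Lemma hatscale_gt0 a : a != 0 -> 0 < hatscale a.
Proof.
move=> a0; rewrite /hatscale; case: (kind D); rewrite divr_gt0 ?ip_gt0//.
exact/root_neq0/phi_root.
Qed.

Lemma hat_eq0 a : (hat D a == 0) = (a == 0).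
Proof.
rewrite hatE scaler_eq0; have [->|a0] := eqVneq a 0; first by rewrite orbT.
by rewrite orbF gt_eqF// hatscale_gt0.
Qed.

Lemma hatN a : hat D (- a) = - hat D a.
Proof. by rewrite !hatE /hatscale; case: (kind D); rewrite ?ipNl ?ipNr ?opprK scalerN. Qed.

Lemma isom_hat w a : lin_isom ip w -> w (hat D a) = hat D (w a).
Proof. by move=> hw; rewrite !hatE (isomZ hw) /hatscale (isom_ip hw). Qed.

Lemma refl_hat a x : a != 0 -> refl (hat D a) x = refl a x.
Proof. by move=> a0; rewrite hatE reflZ// gt_eqF// hatscale_gt0. Qed.

Lemma vee_mult a : a != 0 -> vee a = mult D a *: hat D a.
Proof.
move=> a0; rewrite /mult hatE ipZr scalerA; congr (_ *: _).
by field; rewrite !gt_eqF ?hatscale_gt0 ?ip_gt0.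
Qed.

Lemma mult_gt0 a : a != 0 -> 0 < mult D a.
Proof. by move=> a0; rewrite /mult hatE ipZr divr_gt0// mulr_gt0 ?hatscale_gt0 ?ip_gt0. Qed.

Lemma mult_ge1 a : a \in Phi -> 1 <= mult D a.
Proof.
move=> aP; have pa := ip_gt0 ip (root_neq0 aP).
have pp := ip_gt0 ip (root_neq0 phi_root).
rewrite /mult hatE ipZr /hatscale; case: (kind D).
  by rewrite divfK ?gt_eqF// divff.
rewrite ler_pdivlMr ?mul1r; last by rewrite mulr_gt0 ?divr_gt0.
by rewrite mulrAC ler_pdivrMr// ler_pM2l// root_le_phi.
Qed.

Lemma mult_isom w a : lin_isom ip w -> mult D (w a) = mult D a.
Proof. by move=> hw; rewrite /mult -isom_hat// (isom_ip hw). Qed.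

Lemma multN a : mult D (- a) = mult D a.
Proof. by rewrite /mult hatN ipNl ipNr opprK. Qed.

Lemma vee_hat a : a != 0 -> vee (hat D a) = (hatscale a)^-1 *: vee a.
Proof. by move=> a0; rewrite hatE veeZ// gt_eqF// hatscale_gt0. Qed.

Lemma hat_int a b : a \in Phi -> b \in Phi -> ip (hat D a) (vee (hat D b)) \is a Num.int.
Proof.
move=> aP bP; have a0 := root_neq0 aP; have b0 := root_neq0 bP.
rewrite vee_hat// hatE ipZl ipZr /hatscale; case: (kind D).
  suff -> : 2 / ip a a * ((2 / ip b b)^-1 * ip a (vee b)) = ip b (vee a) by exact: root_int.
  by rewrite !ip_vee (ipC ip b a); field; rewrite !gt_eqF ?ip_gt0.
rewrite mulrA mulfV ?mul1r ?root_int// gt_eqF// divr_gt0// ip_gt0//.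
exact/root_neq0/phi_root.
Qed.

Lemma hat_psi : hat D psi = vee psi.
Proof. by rewrite /psi /alpha0 /hat; case: (kind D); rewrite !opprK. Qed.

Lemma vee_hat_psi : vee (hat D psi) = psi.
Proof.
have p0 := root_neq0 psi_root; rewrite hat_psi /Defs.vee ipZl ipZr scalerA.
by rewrite (_ : _ * _ = 1) ?scale1r//; field; rewrite gt_eqF ?ip_gt0.
Qed.

Lemma mult_psi : mult D psi = 1.
Proof. by rewrite /mult hat_psi (ip_vee_self _ (root_neq0 psi_root)) divff// pnatr_eq0. Qed.

Lemma hat_psi_int a : a \in Phi -> ip (hat D a) psi \is a Num.int.
Proof. by move=> aP; rewrite -vee_hat_psi; apply: hat_int => //; exact: psi_root. Qed.

Lemma hat_psi_self : ip (hat D psi) psi = 2.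
Proof. by rewrite hat_psi ipC (ip_vee_self _ (root_neq0 psi_root)). Qed.

(** Either way the shorter root is paired with the coroot of the longer one: theta with a^vee, or
    [a] with phi^vee. *)
Lemma hat_psi_bound a : a \in Phi -> a != psi -> a != - psi -> -1 <= ip (hat D a) psi <= 1.
Proof.
rewrite /psi /alpha0 /hat; case: (kind D) => aP; rewrite !opprK => n1 n2.
  rewrite ipC; apply: root_pairing => //; [exact: theta_root|exact: theta_short| |];
    by rewrite eq_sym// eqr_oppLR.
rewrite ipZl; have := root_pairing phi_root aP (root_le_phi aP) n1 n2.
by rewrite ip_vee.
Qed.

Lemma psi_refl_neg a : a \in pos -> 0 < ip a psi -> - refl psi a \in pos.
Proof.
move=> aP h; have rP := root_refl psi_root (pos_root aP).
case: (root_pos rP) => // /(dominant_pos psi_dominant).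
rewrite ipC (ip_reflC _ _ _ (root_neq0 psi_root)) (refl_self _ (root_neq0 psi_root)).
by rewrite ipNr; lra.
Qed.

End DominantRoots.

(** * Parameters on the two orbits of roots *)

Section RootParameters.
Context (R : realType) (V : vectType R) (n : nat) (D : root_datum V n).
Context (t : V -> R) (ht : parameters D t).
Implicit Types (a b : V) (w : V -> V).
Local Notation Phi := (Defs.roots D).

Lemma t_neq0 a : a \in Phi -> t a != 0.
Proof. by have [h _ _] := ht => /h[]. Qed.

Lemma t_bound a : a \in Phi -> -1 < t a < 1.
Proof. by have [h _ _] := ht => /h[]. Qed.

Lemma t_weyl w a : weyl D w -> a \in Phi -> t (w a) = t a.
Proof. by have [_ + _] := ht; apply. Qed.

Lemma t_opp a : a \in Phi -> t (- a) = t a.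
Proof.
move=> aP; rewrite -(refl_self (ip D) (root_neq0 aP)).
by apply: t_weyl => //; exact: weyl_refl.
Qed.

Lemma t_hat a : a \in Phi -> t (hat D a) = t a.
Proof. by have [_ _ h] := ht => /h[]. Qed.

Lemma t_vee a : a \in Phi -> t (vee (ip D) a) = t a.
Proof. by have [_ _ h] := ht => /h[]. Qed.

Lemma t_short a : weyl_orbit D (vartheta D) a -> t a = t (vartheta D).
Proof. by case=> w Ww <-; apply: t_weyl => //; exact: theta_root. Qed.

Lemma t_long a : a \in Phi -> ~ weyl_orbit D (vartheta D) a -> t a = t (phi D).
Proof.
move=> aP na; have [w Ww [wa|wa]] := root_conj aP; first by rewrite -wa t_weyl.
by case: na; apply: weyl_orbit_sym; rewrite -wa; exists w.
Qed.

End RootParameters.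

(** * Affine roots *)

Section Affine.
Context (R : realType) (V : vectType R) (n : nat) (D : root_datum V n).
Context (c : nat) (c_gt0 : (0 < c)%N).
Implicit Types (x y : V) (a b : V * int) (j : 'I_n.+1) (i : 'I_n) (s : seq 'I_n.+1).
Local Notation ip := (ip D).
Local Notation vee := (vee ip).
Local Notation refl := (refl ip).
Local Notation al := (tnth (base D)).
Local Notation Phi := (Defs.roots D).
Local Notation pos := (posroots D).
Local Notation aeval := (affeval D c).
Local Notation arefl := (affrefl D c).
Local Notation sim := (affsimple D).
Local Notation hat := (hat D).
Local Notation apos := (affpos D).

Let cR : 0 < c%:R :> R. Proof. by rewrite ltr0n. Qed.

Lemma vee_hat_mult (a : V) : a != 0 -> vee (hat a) = mult D a *: a.
Proof.
move=> a0; rewrite vee_hat// /Defs.vee scalerA /mult hatE ipZr; congr (_ *: _).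
by field; rewrite !gt_eqF ?hatscale_gt0 ?ip_gt0.
Qed.

Lemma affevalE a x : affroot D a -> aeval a x = mult D a.1 * (ip x (hat a.1) + a.2%:~R * c%:R).
Proof.
by move=> aP; rewrite /affeval (vee_mult D (root_neq0 aP)) ipZr mulrDr mulrA.
Qed.

Definition affopp a : V * int := (- a.1, - a.2).

(** The affine root a^vee + m_a r c equals m_a (hat a + r c), so composition with s_b is best
    followed on hat R_0: the level changes by a multiple of a Cartan integer of hat R_0, on which
    the floor is exact. *)
Definition affact b a : V * int :=
  (refl b.1 a.1, a.2 - Num.floor (ip (hat a.1) (vee (hat b.1))) * b.2).

Lemma affroot_opp a : affroot D a -> affroot D (affopp a).
Proof. exact: root_opp. Qed.

Lemma affeval_opp a x : aeval (affopp a) x = - aeval a x.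
Proof. by rewrite /affeval veeN ipNr multN mulrNz mulrN mulNr opprD. Qed.

Lemma affroot_act a b : affroot D a -> affroot D b -> affroot D (affact b a).
Proof. by move=> aP bP; apply: root_refl. Qed.

Lemma affeval_act a b x : affroot D a -> affroot D b ->
  aeval (affact b a) x = aeval a (arefl b x).
Proof.
case: a b => [a r] [b q] /= aP bP; have a0 := root_neq0 aP; have b0 := root_neq0 bP.
rewrite /affeval /affrefl /affact /=; have hr := lin_isom_refl ip b0.
rewrite -(isom_vee hr) (mult_isom a hr) rmorphB rmorphM/= floorK ?hat_int//.
rewrite (vee_hat_mult b0) ipZr.
have E : mult D a * ip (hat a) b = ip (vee a) b by rewrite vee_mult// ipZl.
rewrite {1}/Defs.refl /affeval/= !(ipBr, ipBl) [in LHS](ipZr ip _ x b) [in RHS](ipZl ip _ b).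
have E1 : ip x (vee b) * ip b (vee a) = ip (vee a) (vee b) * ip x b.
  by rewrite !ip_vee ipZl (ipC ip a b); ring.
rewrite mulrDl E1 (ipC ip b (vee a)) -E; ring.
Qed.

(** As a pair is determined by its affine function, identities between pairs can be checked on
    values. *)
Lemma affroot_inj a b : affroot D a -> affroot D b ->
  (forall x, aeval a x = aeval b x) -> a = b.
Proof.
case: a b => [a r] [b q] /= aP bP ab; have a0 := root_neq0 aP; have b0 := root_neq0 bP.
have := ab 0; rewrite /affeval/= !ip0l !add0r => rq.
have vab : vee a = vee b.
  by apply: (ip_ext (ip := ip)) => x; have := ab x; rewrite /affeval/= rq => /addIr; rewrite !(ipC ip x).
have veeK (u : V) : u != 0 -> u = 2 / ip (vee u) (vee u) *: vee u.
  move=> u0; have pu := ip_gt0 ip u0; rewrite /Defs.vee !ipZl !ipZr scalerA.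
  by rewrite (_ : _ * _ = 1) ?scale1r//; field; rewrite gt_eqF.
have e : a = b by rewrite (veeK a a0) vab -veeK.
rewrite e in rq *; congr (_, _); move: rq => /(mulIf (lt0r_neq0 cR)).
by move=> /(mulfI (lt0r_neq0 (mult_gt0 D b0)))/intr_inj.
Qed.

Lemma affrefl_self a x : affroot D a -> aeval a (arefl a x) = - aeval a x.
Proof.
move=> aP; rewrite -affeval_act// -affeval_opp; congr (aeval _ x).
apply: affroot_inj; [exact: affroot_act|exact: affroot_opp|] => y.
rewrite affeval_act// affeval_opp /affrefl; set k := aeval a y.
have -> : aeval a (y - k *: a.1) = k - k * 2.
  by rewrite /k /affeval ipBl ipZl (ip_vee_self _ (root_neq0 aP)); ring.
ring.
Qed.

Lemma affreflK a : affroot D a -> involutive (arefl a).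
Proof.
move=> aP x; rewrite {1}/affrefl affrefl_self// scaleNr opprK.
by rewrite /affrefl subrK.
Qed.

Lemma affactK b a : affroot D a -> affroot D b -> affact b (affact b a) = a.
Proof.
move=> aP bP; have h := affroot_act aP bP.
by apply: affroot_inj => // [|x]; rewrite ?affeval_act ?affreflK//; exact: affroot_act.
Qed.

Lemma affact_self a : affroot D a -> affact a a = affopp a.
Proof.
move=> aP; apply: affroot_inj; [exact: affroot_act|exact: affroot_opp|] => x.
by rewrite affeval_act// affrefl_self// affeval_opp.
Qed.

Lemma affrefl_fix a x : aeval a x = 0 -> arefl a x = x.
Proof. by move=> a0; rewrite /affrefl a0 scale0r subr0. Qed.

Lemma affrefl_add a x y : arefl a (x + y) = arefl a x + refl a.1 y.
Proof.
rewrite /affrefl /Defs.refl.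
have -> : aeval a (x + y) = aeval a x + ip y (vee a.1) by rewrite /affeval ipDl; ring.
by rewrite scalerDl opprD addrACA.
Qed.

Lemma affact_refl a b : affroot D a -> affroot D b ->
  arefl (affact b a) = arefl b \o arefl a \o arefl b.
Proof.
move=> aP bP; apply/funext => x; rewrite {1}/affrefl affeval_act//=.
rewrite [arefl a (arefl b x)]/affrefl affrefl_add affreflK//; congr (_ + _).
have hr := lin_isom_refl ip (root_neq0 bP).
by rewrite (isomN hr) (isomZ hr).
Qed.

Lemma affpos_root a : apos a -> affroot D a.
Proof. by case=> [[/pos_root]|[]]. Qed.

Lemma affpos_opp a : apos a -> ~ apos (affopp a).
Proof.
clear cR c_gt0.
case: a => [a r] [[/= aP ->]|[/= aP r1]] [[/= nP r0]|[/= nP r0]]; last 3 first.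
- by move: r0; rewrite oppr0.
- by move: r1; rewrite -[r]opprK r0 oppr0.
- by lia.
by have := posN aP; rewrite nP.
Qed.

Lemma affroot_pos a : affroot D a -> apos a \/ apos (affopp a).
Proof.
clear cR c_gt0.
case: a => [a r] aP; have [r0|r0|->] := ltgtP r 0.
- by right; right; split; [exact: root_opp|rewrite /=; lia].
- by left; right; split=> //=; lia.
by case: (root_pos aP) => h; [left|right]; left; rewrite /= ?oppr0.
Qed.

Lemma affsimple_cases j : (j = ord0 /\ sim j = (alpha0 D, 1)) \/
  (exists2 i, j = lift ord0 i & sim j = (al i, 0)).
Proof.
rewrite /affsimple; case: unliftP => [i ->|->]; first by right; exists i.
by left.
Qed.

Lemma affsimple0 : sim ord0 = (alpha0 D, 1).
Proof. by rewrite /affsimple unlift_none. Qed.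

Lemma affsimpleS i : sim (lift ord0 i) = (al i, 0).
Proof. by rewrite /affsimple liftK. Qed.

Lemma affsimple_pos j : apos (sim j).
Proof.
case: (affsimple_cases j) => [[_ ->]|[i _ ->]].
  by right; split=> //=; exact: alpha0_root.
by left; split=> //=; exact: simple_pos.
Qed.

Lemma affsimple_root j : affroot D (sim j).
Proof. exact/affpos_root/affsimple_pos. Qed.

Lemma affroot_neq0 a : affroot D a -> a.1 != 0.
Proof. exact: root_neq0. Qed.

Lemma hat_vee_alpha0 (a : V) : ip (hat a) (vee (hat (alpha0 D))) = - ip (hat a) (psi D).
Proof.
rewrite alpha0E hatN veeN vee_hat_psi ipNr//.
Qed.

Lemma affact0 a : affact (sim ord0) a =
  (refl (psi D) a.1, a.2 + Num.floor (ip (hat a.1) (psi D))) \/ ~ a.1 \in Phi.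
Proof.
case: (boolP (a.1 \in Phi)) => [aP|/negP]; [left|by right].
rewrite affsimple0 /affact/= hat_vee_alpha0 {1}alpha0E reflNv mulr1.
congr (_, _); apply: (@intr_inj R); rewrite rmorphB rmorphD/= !floorK ?rpredN ?hat_psi_int//.
by rewrite opprK.
Qed.

(** For j = 0 the level changes by k = <hat a, psi>. This is nonnegative on positive [a], since psi
    is dominant, and at least -1 on the negative roots other than - psi; when k = -1 the root s_psi
    a is positive, so level 0 is still allowed. *)
Lemma affact_simple_pos j a : apos a -> a <> sim j -> apos (affact (sim j) a).
Proof.
clear cR c_gt0.
case: a => [a r] aP aj; have aR : a \in Phi := affpos_root aP.
case: (affsimple_cases j) => [[j0 _]|[i ji jE]]; last first.
  rewrite jE /affact mulr0 subr0/=; case: aP => [[/= aP a0]|[/= aP a1]].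
    left; split=> //=; apply: simple_refl_pos => //.
    by apply/eqP => ai; apply: aj; rewrite jE -ai -a0.
  by right; split=> //=; rewrite root_refl// simple_root.
case: (affact0 (a, r)) => [E|/(_ aR)//]; rewrite j0 E /=.
have p0 := root_neq0 (psi_root D).
have sgn (b : V) : b != 0 -> (0 < ip (hat b) (psi D)) = (0 < ip b (psi D)).
  by move=> b0; rewrite hatE ipZl pmulr_rgt0// hatscale_gt0.
have a0 : a != 0 := root_neq0 aR; have /intrP[k kE] := hat_psi_int aR.
rewrite kE intrKfloor.
have k_ge0 : a \in pos -> 0 <= k.
  move=> /(dominant_pos (@psi_dominant _ _ _ D)) h; rewrite leNgt -(ltrz0 R) -kE.
  apply/negP; rewrite hatE ipZl pmulr_rlt0 ?hatscale_gt0// ltNge => /negP; apply.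
  by rewrite ipC.
case: aP => [[/= aP r0]|[_ /= r1]].
  have := k_ge0 aP; rewrite le_eqVlt => /orP[/eqP k0|kpos].
    left; rewrite /= r0 -k0; split=> //; rewrite refl_fix//.
    by apply/eqP; rewrite -(mulrI_eq0 _ (mulfI (lt0r_neq0 (hatscale_gt0 D a0)))) -ipZl -hatE kE -k0.
  right; rewrite /= root_refl ?psi_root//; split=> //.
  by lia.
have [k0|k0] := leP 0 k; first by right; split; [rewrite /= root_refl ?psi_root|rewrite /=; lia].
have nP : - a \in pos.
  by case: (root_pos aR) => // /k_ge0; lia.
(* For a = - psi the level drops by 2. Level 1 is a_0 itself, which is excluded, and level 2 lands
   on the positive affine root [(psi, 0)]. *)
have [aE|ane] := eqVneq a (- psi D).
  have k2 : k = -2.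
    apply: (@intr_inj R); rewrite -kE aE hatN ipNl hat_psi_self.
    by rewrite rmorphN rmorph_nat.
  have r2 : r != 1.
    by apply/eqP => r2; apply: aj; rewrite j0 affsimple0 alpha0E -aE -r2.
  have rE : refl (psi D) a = psi D by rewrite aE (isomN (lin_isom_refl ip p0)) refl_self// opprK.
  rewrite rE k2; have [r2'|r2'] := eqVneq r 2.
    by left; rewrite /= r2' ; split; [exact: psi_pos|].
  right; split; first exact: psi_root.
  by rewrite /=; lia.
have ane' : a != psi D.
  by apply: contraTneq nP => ->; rewrite posN// psi_pos.
have /andP[] := hat_psi_bound aR ane' ane; rewrite kE -(rmorphN1 (intmul (1 : R))) ler_int => k1 _.
have kE1 : k = -1 by lia.
have rP : refl (psi D) a \in pos.
  rewrite -[a]opprK (isomN (lin_isom_refl ip p0)).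
  apply: psi_refl_neg => //; rewrite -sgn ?oppr_eq0//.
  by rewrite hatN ipNl kE kE1 rmorphN1 opprK.
rewrite kE1; have [r2|r2] := eqVneq r 1; first by left; rewrite r2.
by right; split; [exact: pos_root|rewrite /=; lia].
Qed.

End Affine.

(** * Descents, depth and shortest elements *)

Section AffineWords.
Context (R : realType) (V : vectType R) (n : nat) (D : root_datum V n).
Context (c : nat) (c_gt0 : (0 < c)%N).
Implicit Types (x y : V) (a b : V * int) (j : 'I_n.+1) (i : 'I_n) (s : seq 'I_n.+1).
Local Notation ip := (ip D).
Local Notation vee := (vee ip).
Local Notation refl := (refl ip).
Local Notation al := (tnth (base D)).
Local Notation Phi := (Defs.roots D).
Local Notation aeval := (affeval D c).
Local Notation arefl := (affrefl D c).
Local Notation sim := (affsimple D).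
Local Notation hat := (hat D).
Local Notation apos := (affpos D).
Local Notation act j := (affact D (sim j)).

Let cR : 0 < c%:R :> R. Proof. by rewrite ltr0n. Qed.

Lemma affpos_ge0 a : apos a -> 0 <= a.2.
Proof. by case: a => a r [[_ /= ->//]|[_ /=]]; lia. Qed.

Lemma hat_vee_gt0 (a b : V) : a != 0 -> b != 0 -> (0 < ip (hat a) (vee (hat b))) = (0 < ip a b).
Proof.
move=> a0 b0; rewrite ip_vee_gt0 ?hat_eq0// !hatE ipZl ipZr.
by rewrite !pmulr_rgt0 ?hatscale_gt0.
Qed.

(** If [a.1] pairs positively with no simple root, then its opposite is dominant and pairs
    positively with psi, so [a.1] pairs positively with alpha_0. *)
Lemma affpos_simple_gt0 a : apos a -> exists j, 0 < ip (hat a.1) (vee (hat (sim j).1)).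
Proof.
move=> aP; have aR := affpos_root aP.
suff [j h] : exists j, 0 < ip a.1 (sim j).1.
  by exists j; rewrite hat_vee_gt0 ?(affroot_neq0 aR) ?(affroot_neq0 (affsimple_root D j)).
case: aP => [[/pos_simple_gt0[i h] _]|[_ _]]; first by exists (lift ord0 i); rewrite affsimpleS.
have [[i h]|nh] := pselect (exists i, 0 < ip a.1 (al i)).
  by exists (lift ord0 i); rewrite affsimpleS.
exists ord0; rewrite affsimple0 /= alpha0E ipNr -ipNl.
apply: dominant_root_psi_gt0; first exact: root_opp.
by move=> i; rewrite ipNl oppr_ge0 leNgt; apply/negP => h; apply: nh; exists i.
Qed.

Lemma height_bound : exists M : R, forall v : V, v \in Phi -> `|height D v| <= M.
Proof.
have [u _ umax] := finite_argmax (fun v : V => `|height D v|) (finite_fset Phi) (phi_root D).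
by exists `|height D u|.
Qed.

Lemma affact_height j a : apos a ->
  0 < ip (hat a.1) (vee (hat (sim j).1)) ->
  (exists i, j = lift ord0 i /\ act j a = (refl (al i) a.1, a.2) /\ 1 <= ip a.1 (vee (al i))) \/
  (act j a).2 + 1 <= a.2.
Proof.
move=> aP h; have aR := affpos_root aP.
case: (affsimple_cases D j) => [[j0 E]|[i ji E]].
  right; rewrite /affact E/= mulr1.
  have := hat_int aR (alpha0_root D); move: h; rewrite E/= => h /intrP[k kE].
  by move: h; rewrite kE ltr0z intrKfloor; lia.
left; exists i; split=> //; rewrite /affact E/= mulr0 subr0; split=> //.
have s0 := simple_neq0 D i.
apply: int_gt0_ge1; first by apply: root_int => //; exact: simple_root.
rewrite ip_vee_gt0// -hat_vee_gt0// ?(affroot_neq0 aR)//.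
by move: h; rewrite E.
Qed.

Lemma affpos_ind (Q : V * int -> Prop) :
  (forall j, Q (sim j)) ->
  (forall a j, apos a -> apos (act j a) ->
     0 < ip (hat a.1) (vee (hat (sim j).1)) -> Q (act j a) -> Q a) ->
  forall a, apos a -> Q a.
Proof.
move=> Q0 Q1; have [M hM] := height_bound.
(* A lexicographic measure: heights lie in [-M, M], so the loss of one level, worth 2 M + 1,
   outweighs any gain of height by at least 1. The summand M makes it nonnegative. *)
pose g a : R := a.2%:~R * (2 * M + 1) + height D a.1 + M.
have hM2 (v : V) : v \in Phi -> 0 <= height D v + M /\ height D v <= M.
  by move=> /hM; rewrite ler_norml => /andP[]; lra.
have M0 : 0 <= M by have := hM _ (phi_root D); apply: le_trans.
suff H (N : nat) a : apos a -> g a < N%:R -> Q a.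
  move=> a aP; apply: (H (Num.truncn (g a)).+1) => //; exact: truncnS_gt.
elim: N a => [|N IH] a aP gN.
  have [h _] := hM2 _ (affpos_root aP); have := affpos_ge0 aP; rewrite -(ler0z R) => h2.
  have M1 : 0 <= 2 * M + 1 by lra.
  by have := mulr_ge0 h2 M1; move: gN; rewrite /g mulr0n; lra.
have [j h] := affpos_simple_gt0 aP.
have [->|/eqP aj] := eqVneq a (sim j); first exact: Q0.
have bP := affact_simple_pos aP aj; apply: (Q1 a j) => //; apply: IH => //.
rewrite -(natr1 N) in gN.
suff : g (act j a) + 1 <= g a by move: gN; set u := g _; set v := g _; lra.
case: (affact_height aP h) => [[i [_ [E h1]]]|h1].
  by rewrite E /g/= heightB heightZ height_simple; lra.
have [h2 _] := hM2 _ (affpos_root aP); have [_ h3] := hM2 _ (affpos_root bP).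
rewrite -(ler_int R) rmorphD/= in h1.
rewrite /g; move: h1 h2 h3 M0; set p := _%:~R; set q := _%:~R.
move: (height D _) (height D _) => u v h1 h2 h3 M0; nra.
Qed.

(* [a = s_j a + k a_j]. *)
Lemma affeval_act_simple a j x : apos a ->
  0 < ip (hat a.1) (vee (hat (sim j).1)) ->
  exists2 k, 0 < k & aeval a x = aeval (act j a) x + k * aeval (sim j) x.
Proof.
move=> aP h; have aR := affpos_root aP; have sR := affsimple_root D j.
exists (ip (vee a.1) (sim j).1).
  rewrite ipC ip_vee_gt0 ?(affroot_neq0 aR)// ipC.
  by rewrite -hat_vee_gt0 ?(affroot_neq0 aR) ?(affroot_neq0 sR).
rewrite affeval_act// /affrefl {2}/affeval ipBl ipZl (ipC ip (vee _)).
by rewrite {1}/affeval; ring.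
Qed.

Lemma affeval_ge0 x : (forall j, 0 <= aeval (sim j) x) ->
  forall a, apos a -> 0 <= aeval a x.
Proof.
move=> h; apply: affpos_ind => // a j aP bP pab IH.
have [k k0 ->] := affeval_act_simple x aP pab.
by rewrite addr_ge0// mulr_ge0// ltW.
Qed.

Lemma alcoveP x : alcove D c x <-> forall a, apos a -> 0 <= aeval a x.
Proof.
split=> [hx a aP|hx b].
  have aR := affpos_root aP; rewrite affevalE// pmulr_rge0 ?mult_gt0 ?(affroot_neq0 aR)//.
  case: aP => [[aP ->]|[_ r1]].
    have /hx/andP[] : hat a.1 \in hatpos D by apply/imfsetP; exists a.1.
    by rewrite mul0r addr0.
  have h : - c%:R <= ip x (hat a.1).
    case: (root_pos aR) => aP.
      have /hx/andP[h1 _] : hat a.1 \in hatpos D by apply/imfsetP; exists a.1.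
      by apply: le_trans h1; rewrite oppr_le0.
    have /hx/andP[_ h1] : hat (- a.1) \in hatpos D by apply/imfsetP; exists (- a.1).
    by move: h1; rewrite hatN ipNr; lra.
  have : 1 <= a.2%:~R :> R by rewrite ler1z.
  move=> h1; have : 0 <= (a.2%:~R - 1) * c%:R :> R by rewrite mulr_ge0 ?subr_ge0// ltW.
  by rewrite mulrBl mul1r; lra.
move=> /imfsetP[a /= aP ->]; have a0 := pos_neq0 aP.
have := hx (a, 0) (or_introl (conj aP erefl)).
have := hx (- a, 1) (or_intror (conj (root_opp (pos_root aP)) (lexx 1))).
rewrite !affevalE ?pmulr_rge0 ?mult_gt0 ?oppr_eq0//=; try exact/root_opp/pos_root; try exact: pos_root.
by rewrite mul0r addr0 mul1r hatN ipNr; lra.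
Qed.

Lemma alcove_simple x : alcove D c x <-> forall j, 0 <= aeval (sim j) x.
Proof.
split=> [/alcoveP h j|h]; first exact/h/affsimple_pos.
by apply/alcoveP; exact: affeval_ge0.
Qed.

Lemma notin_alcove x : ~ alcove D c x -> exists j, aeval (sim j) x < 0.
Proof.
move=> h; apply: contrapT => nh; apply: h; apply/alcove_simple => j.
by rewrite leNgt; apply/negP => h; apply: nh; exists j.
Qed.

Lemma finite_affroot_bound (N : nat) :
  finite_set [set a : V * int | a.1 \in Phi /\ (0 <= a.2 < N%:Z)].
Proof.
apply: (@sub_finite_set _ _ ((fun p : V * nat => (p.1, p.2%:Z)) @` ([set` Phi] `*` `I_N))).
  case=> [a r] /= [aP /andP[r0 rN]]; exists (a, `|r|%N) => /=; last by rewrite gez0_abs.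
  by split=> //=; lia.
by apply/finite_image/finite_setX => //; exact: finite_fset.
Qed.

Lemma finite_affpos_le x (k : R) : finite_set [set a | apos a /\ aeval a x <= k].
Proof.
have [u _ umax] := finite_argmax (fun v : V => - ip x (vee v)) (finite_fset Phi) (phi_root D).
set N := (Num.truncn (k - ip x (vee u))).+1.
apply: sub_finite_set (finite_affroot_bound N) => a [aP ak] /=.
have aR := affpos_root aP; split=> //; have r0 := affpos_ge0 aP; rewrite r0/=.
rewrite -(ltr_int R); apply: (@le_lt_trans _ _ (k - ip x (vee u))); last exact: truncnS_gt.
have h1 := umax a.1 aR; move: ak; rewrite /affeval => ak.
have h2 : 1 <= mult D a.1 by exact: mult_ge1.
have h3 : 1 <= c%:R :> R by rewrite ler1n.
have h4 : 0 <= a.2%:~R :> R by rewrite ler0z.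
have : a.2%:~R <= mult D a.1 * a.2%:~R * c%:R.
  rewrite -[X in X <= _]mulr1 ler_pM//.
  by rewrite -[X in X <= _]mul1r ler_pM.
move: h1 ak => /=; lra.
Qed.

Lemma finite_affneg x : finite_set (affneg D c x).
Proof. by apply: sub_finite_set (finite_affpos_le x 0) => a [aP /ltW]. Qed.

Lemma affnegP x : alcove D c x <-> affneg D c x = set0.
Proof.
rewrite alcoveP; split=> [h|h a aP].
  by apply/seteqP; split=> // a [/h]; rewrite leNgt => /negP.
by rewrite leNgt; apply/negP => an; have : affneg D c x a by []; rewrite h.
Qed.

Lemma affsimple_refl j x : aeval (sim j) (arefl (sim j) x) = - aeval (sim j) x.
Proof. exact/(affrefl_self c_gt0)/affsimple_root. Qed.

Lemma affsimple_reflK j : involutive (arefl (sim j)).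
Proof. exact/(affreflK c_gt0)/affsimple_root. Qed.

Lemma affeval_actS a j x : affroot D a -> aeval (act j a) x = aeval a (arefl (sim j) x).
Proof. by move=> aR; apply: affeval_act => //; exact: affsimple_root. Qed.

Lemma affact_simpleK a j : affroot D a -> act j (act j a) = a.
Proof. by move=> aR; apply: (affactK c_gt0 aR); exact: affsimple_root. Qed.

Lemma affact_simple_neq a j : apos a -> act j a <> sim j.
Proof.
move=> aP E; have := affact_simpleK j (affpos_root aP).
rewrite E (affact_self c_gt0 (affsimple_root D j)) => aE.
by have := affpos_opp (affsimple_pos D j); rewrite aE.
Qed.

(* [s_j] permutes the positive affine roots other than [a_j]. *)
Lemma fsbig_affact (T : Type) (idx : T) (op : Monoid.com_law idx) (P : R -> Prop)
    (F : V * int -> T) j x : ~ P (aeval (sim j) (arefl (sim j) x)) ->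
  finite_set [set a | apos a /\ P (aeval a x)] ->
  \big[op/idx]_(a \in [set a | apos a /\ P (aeval a x)]) F a =
  op (if `[< P (aeval (sim j) x) >] then F (sim j) else idx)
    (\big[op/idx]_(a \in [set a | apos a /\ P (aeval a (arefl (sim j) x))]) F (act j a)).
Proof.
move=> nP fin; set A := [set a | _ /\ _]; set B := [set a | apos a /\ P (aeval a (arefl _ _))].
have bij : set_bij B (A `\ sim j) (fun a => act j a).
  split.
  - move=> a [aP Pa]; have aR := affpos_root aP; split; last exact: affact_simple_neq.
    split; last by rewrite affeval_actS.
    by apply: affact_simple_pos => // E; apply: nP; move: Pa; rewrite E.
  - move=> a b /set_mem[aP _] /set_mem[bP _] E.
    by rewrite -(affact_simpleK j (affpos_root aP)) E (affact_simpleK j (affpos_root bP)).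
  - move=> a [[aP Pa] aj]; exists (act j a); last exact/affact_simpleK/affpos_root.
    split; first exact: affact_simple_pos.
    by rewrite (affeval_actS _ _ (affpos_root aP)) affsimple_reflK.
rewrite -(reindex_fsbig _ _ _ _ bij); case: asboolP => Pj.
  by rewrite (fsbigD1 (sim j))//; split=> //; exact: affsimple_pos.
rewrite Monoid.mul1m; apply: eq_fsbigl.
by apply/seteqP; split=> [a Aa|a [//]]; split=> // E; case: Aa; rewrite E.
Qed.

(** The number of affine hyperplanes separating [x] from the alcove, which is also the length of the
    shortest elements that bring [x] there. *)
Definition affdepth x : nat := \sum_(a \in affneg D c x) 1%N.

Lemma affdepth_desc j x : aeval (sim j) x < 0 ->
  affdepth x = (affdepth (arefl (sim j) x)).+1.
Proof.
move=> h; have := @fsbig_affact _ _ addn (fun z => z < 0) (fun=> 1%N) j x.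
rewrite -/(affneg D c x) -/(affneg D c (arefl (sim j) x)) /affdepth => ->.
- by rewrite asboolT.
- by rewrite affsimple_refl; lra.
- exact: finite_affneg.
Qed.

Lemma affdepth_eq0 x : affdepth x = 0%N <-> alcove D c x.
Proof.
rewrite affnegP; split=> [h|h]; last by rewrite /affdepth h fsbig_set0.
apply/seteqP; split=> // a Aa.
by move: h; rewrite /affdepth (fsbigD1 a)//; exact: finite_affneg.
Qed.

Lemma tprod_desc t j x : parameters D t -> aeval (sim j) x < 0 ->
  tprod D t c x = t (sim j).1 * tprod D t c (arefl (sim j) x).
Proof.
move=> ht h; have := @fsbig_affact _ _ *%R (fun z => z < 0) (fun a => t (vee a.1)) j x.
rewrite -/(affneg D c x) -/(affneg D c (arefl (sim j) x)) /tprod => ->.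
- rewrite asboolT// (t_vee ht); last exact: affsimple_root; congr (_ * _).
  apply: eq_fsbigr => a /set_mem[/affpos_root aR _].
  have sR := affsimple_root D j; rewrite !(t_vee ht)//; last exact: root_refl.
  by apply: (t_weyl ht) => //; exact: weyl_refl.
- by rewrite affsimple_refl; lra.
- exact: finite_affneg.
Qed.

Lemma thetaE x : theta D c x = \sum_(a \in [set a | apos a /\ aeval a x = -2]) 1%N.
Proof.
rewrite /theta fsbig_finite/=; last first.
  by apply: sub_finite_set (finite_affneg x) => a [aP E]; split=> //; rewrite E; lra.
by rewrite -card_fset_sum1.
Qed.

Lemma theta_desc j x : aeval (sim j) x < 0 ->
  theta D c x = (`[< (aeval (sim j) x = -2)%R >] + theta D c (arefl (sim j) x))%N.
Proof.
move=> h; rewrite !thetaE.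
rewrite (@fsbig_affact _ _ addn (fun z => z = -2) (fun=> 1%N) j x).
- by case: asboolP.
- by rewrite affsimple_refl; lra.
- by apply: sub_finite_set (finite_affneg x) => a [aP E]; split=> //; rewrite E; lra.
Qed.

(** Paths into the alcove on which every simple reflection is applied where its affine root is
    negative. By [shortest_desc] the element w_x arises in this way, so its properties are proved by
    induction on the path. *)
Inductive desc : V -> (V -> V) -> Prop :=
| desc_nil x : alcove D c x -> desc x id
| desc_step j x w : aeval (sim j) x < 0 -> desc (arefl (sim j) x) w ->
    desc x (w \o arefl (sim j)).

Local Notation word := (affword D c).

Lemma affword_rcons s j : word (rcons s j) = word s \o arefl (sim j).
Proof. by elim: s => //= k s ->. Qed.

Lemma affword_cat s1 s2 : word (s1 ++ s2) = word s1 \o word s2.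
Proof. by elim: s1 => //= k s ->. Qed.

(** A simple reflection changes the depth by at most 1, and points of the alcove have depth 0. *)
Lemma affdepth_le_word s x : alcove D c (word s x) -> (affdepth x <= size s)%N.
Proof.
elim/last_ind: s x => [|s j IH] x /=; first by move=> /affdepth_eq0 ->.
rewrite affword_rcons size_rcons /= => /IH h.
have [h1|h1|h1] := ltgtP (aeval (sim j) x) 0.
- by rewrite (affdepth_desc h1).
- move: h; rewrite (@affdepth_desc j (arefl (sim j) x)) ?affsimple_reflK; first by lia.
  by rewrite affsimple_refl; lra.
- by move: h; rewrite affrefl_fix// => h; exact: ltnW.
Qed.

(** In a word that attains the bound of [affdepth_le_word] no letter is wasted: each one lowers the
    depth. *)
Lemma word_desc s x : alcove D c (word s x) -> (size s <= affdepth x)%N -> desc x (word s).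
Proof.
elim/last_ind: s x => [|s j IH] x /=; first by move=> h _; exact: desc_nil.
rewrite affword_rcons size_rcons /= => hA hs; have hd := affdepth_le_word hA.
suff h1 : aeval (sim j) x < 0.
  apply: desc_step => //; apply: IH => //; by move: hs; rewrite (affdepth_desc h1).
rewrite ltNge le_eqVlt; apply/negP => /orP[/eqP h1|h1].
  by move: hd; rewrite affrefl_fix//; lia.
move: hd; rewrite (@affdepth_desc j (arefl (sim j) x)) ?affsimple_reflK; first by lia.
by rewrite affsimple_refl; lra.
Qed.

Lemma word_alcove x : exists2 s, alcove D c (word s x) & size s = affdepth x.
Proof.
move: {2}(affdepth x) (erefl (affdepth x)) => N; elim: N x => [|N IH] x dN.
  by exists [::] => //=; exact/affdepth_eq0.
have [j h] : exists j, aeval (sim j) x < 0.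
  by apply: notin_alcove => /affdepth_eq0; rewrite dN.
move: dN; rewrite (affdepth_desc h) => -[dN]; have [s sA ss] := IH _ dN.
exists (rcons s j); first by rewrite affword_rcons.
by rewrite size_rcons ss.
Qed.

Lemma affword_weyl s : affweyl D c (word s).
Proof.
elim: s => [|j s IH] /=; first exact: generated_id.
by apply: generated_comp => //; exists (sim j) => //; exact: affsimple_root.
Qed.

Lemma affrefl_word a : affroot D a -> exists s, word s = arefl a.
Proof.
have pos_word : forall a, apos a -> exists s, word s = arefl a.
  apply: affpos_ind => [j|b j bP _ _ [s sE]]; first by exists [:: j].
  exists (j :: rcons s j); rewrite /= affword_rcons sE.
  have bR := affpos_root bP; have sR := affsimple_root D j.
  by rewrite -[in RHS](affact_simpleK j bR) (affact_refl c_gt0 (affroot_act bR sR) sR).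
move=> aR; case: (affroot_pos aR) => [|/pos_word[s sE]]; first exact: pos_word.
exists s; rewrite sE; apply/funext => x; rewrite /affrefl affeval_opp scaleNr /=.
by rewrite scalerN opprK.
Qed.

Lemma affweyl_word w : affweyl D c w -> exists s, word s = w.
Proof.
elim=> [|u v [a aR <-] _ [s <-]]; first by exists [::].
by have [s1 <-] := affrefl_word aR; exists (s1 ++ s); rewrite affword_cat.
Qed.

Lemma afflengthP s0 : exists2 s, word s = word s0 & size s = afflength D c (word s0).
Proof.
pose P k := `[< exists2 s, word s = word s0 & size s = k >].
have exP : exists k, P k by exists (size s0); apply/asboolP; exists s0.
rewrite /afflength; case: xgetP => [k _ [[s sE ss] _]|nP]; first by exists s.
exfalso; case: (ex_minnP exP) => k /asboolP[s sE ss] kmin.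
apply: (nP k); split; first by exists s.
by move=> s' s'E; apply: kmin; apply/asboolP; exists s'.
Qed.

Lemma afflength_le s : (afflength D c (word s) <= size s)%N.
Proof.
rewrite /afflength; case: xgetP => // k _ [_ kmin]; exact: kmin.
Qed.

(** A reduced word of the chosen element has at most [affdepth x] letters, by comparison with the
    word from [word_alcove], so [word_desc] applies. The existence part guarantees that [xget] does
    not return its default. *)
Lemma shortest_desc x : desc x (shortest D c x).
Proof.
have [s sA ss] := word_alcove x.
pose P k := `[< exists2 w, affweyl D c w /\ alcove D c (w x) & afflength D c w = k >].
have exP : exists k, P k.
  by exists (afflength D c (word s)); apply/asboolP; exists (word s) => //; split=> //; exact: affword_weyl.
have := @xgetPex _ (id : V -> V) [set w | [/\ affweyl D c w, alcove D c (w x)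
    & forall w', affweyl D c w' -> alcove D c (w' x) ->
        (afflength D c w <= afflength D c w')%N]].
rewrite -/(shortest D c x); case.
  case: (ex_minnP exP) => k /asboolP[w [Ww wA] wk] kmin.
  exists w; split=> // w' Ww' w'A; rewrite wk; apply: kmin.
  by apply/asboolP; exists w'.
move=> /affweyl_word[s1 <-] s1A s1min; have [s2 s2E s2s] := afflengthP s1.
rewrite -s2E; apply: word_desc; first by rewrite s2E.
rewrite s2s -ss; apply: leq_trans (afflength_le s).
by apply: s1min => //; exact: affword_weyl.
Qed.

End AffineWords.

(** * Critical points of the potential *)

Section Calculus.
Context (R : realType).
Implicit Types (f g : R -> R) (x y : R).
Local Notation I0 := (@Defs.integral0 R).
Local Notation mu := (@lebesgue_measure R).

Lemma continuous_integrable_itv f x y : continuous f -> mu.-integrable `[x, y] (EFin \o f).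
Proof.
move=> cf; apply: continuous_compact_integrable; first exact: segment_compact.
exact: continuous_subspaceT.
Qed.

Lemma integral0_split f (a x : R) : continuous f -> a <= 0 -> a <= x ->
  I0 f x = (\int[mu]_(y in `[a, x]) f y)%R - (\int[mu]_(y in `[a, 0%R]) f y)%R.
Proof.
move=> cf a0 ax; have int (b d : R) := continuous_integrable_itv b d cf.
have sub (b d : R) : b <= d -> mu.-integrable `]b, d] (EFin \o f).
  move=> bd; apply: integrableS (int b d) => //.
  exact: subset_itv_oc_cc.
rewrite /Defs.integral0; case: ifP => [x0|/negbT]; last rewrite -ltNge => /ltW x0.
  by rewrite Rintegral_itvB ?Rintegral_itv_obnd_cbnd ?sub ?int// ?bnd_simp.
rewrite -[RHS]opprB; congr (- _).
by rewrite Rintegral_itvB ?Rintegral_itv_obnd_cbnd ?sub ?int// ?bnd_simp.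
Qed.

Lemma is_derive_integral0 f x : continuous f -> is_derive x (1 : R) (I0 f) (f x).
Proof.
(* A base point to the left of both 0 and [x] turns the two branches of [integral0] into one
   primitive minus a constant. *)
move=> cf; pose a := Num.min x 0 - 1.
have a0 : a < 0 by rewrite /a; case: (leP x 0); lra.
have ax : a < x by rewrite /a; case: (leP x 0); lra.
pose F y := (\int[mu]_(z in `[a, y]) f z)%R.
pose k := (\int[mu]_(z in `[a, 0%R]) f z)%R.
have [dF dFE] : derivable F x 1 /\ derive1 F x = f x.
  apply: (@continuous_FTC1_closed _ f a x (x + 1)) => //; first by lra.
    exact: continuous_integrable_itv.
  exact: cf.
apply: (@near_eq_is_derive _ _ _ (fun y => F y - k)).
  near=> y; rewrite (@integral0_split f a)//; first exact: ltW.
  by apply: ltW; near: y; exact: lt_nbhsr.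
rewrite -dFE derive1E -[X in is_derive _ _ _ X]subr0.
by apply: is_deriveB; apply: derivableP.
Unshelve. all: by end_near. Qed.

Lemma is_derive_affine (p q x : R) : is_derive x (1 : R) (fun s => p + s * q) q.
Proof.
have -> : (fun s => p + s * q) = cst p + q *: id.
  by apply/funext => s; rewrite !fctE /= /GRing.scale/= mulrC.
have hc : is_derive x (1 : R) (cst p : R -> R) 0 by exact: is_derive_cst.
have hi : is_derive x (1 : R) (id : R -> R) 1 by exact: is_derive_id.
apply: (is_derive_eq (is_deriveD hc (is_deriveZ q hi))).
by rewrite /GRing.scale/= add0r mulr1.
Qed.

Lemma is_derive_quadratic (p q r x : R) :
  is_derive x (1 : R) (fun s => p + q * s + r * s ^+ 2) (q + 2 * r * x).
Proof.
have -> : (fun s => p + q * s + r * s ^+ 2) = cst p + q *: id + r *: (id * id).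
  by apply/funext => s; rewrite !fctE /= /GRing.scale/= expr2.
have hc : is_derive x (1 : R) (cst p : R -> R) 0 by exact: is_derive_cst.
have hi : is_derive x (1 : R) (id : R -> R) 1 by exact: is_derive_id.
have h1 := is_deriveD hc (is_deriveZ q hi).
apply: (is_derive_eq (is_deriveD h1 (is_deriveZ r (is_deriveM hi hi)))).
by rewrite /GRing.scale/=; ring.
Qed.

Lemma is_derive_bigsum (T : eqType) (r : seq T) (F : T -> R -> R) (dF : T -> R) x :
  (forall a, a \in r -> is_derive x (1 : R) (F a) (dF a)) ->
  is_derive x (1 : R) (fun s => \sum_(a <- r) F a s) (\sum_(a <- r) dF a).
Proof.
elim: r => [|a r IH] h.
  rewrite big_nil (_ : (fun s => _) = cst 0); first exact: is_derive_cst.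
  by apply/funext => s; rewrite big_nil.
rewrite big_cons (_ : (fun s => _) = F a \+ (fun s => \sum_(b <- r) F b s)).
  apply: is_deriveD; first by apply: h; rewrite mem_head.
  by apply: IH => b br; apply: h; rewrite inE br orbT.
by apply/funext => s; rewrite big_cons.
Qed.

Lemma derive_at_min f x df : is_derive x (1 : R) f df ->
  (forall y, derivable f y (1 : R)) -> (forall y, f x <= f y) -> df = 0.
Proof.
move=> hf df0 fmin.
have : is_derive x (1 : R) f 0.
  apply: (@derive1_at_min _ f (x - 1) (x + 1)) => //; first by lra.
  by rewrite in_itv/=; lra.
by move=> [_ <-]; have [_ <-] := hf.
Qed.

Section Kernel.
Context (t : R) (ht : -1 < t < 1).
Let d x : R := 1 - 2 * t * cos x + t ^+ 2.

Lemma kernel_den_gt0 x : 0 < d x.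
Proof.
have /andP[t1 t2] := ht; have := cos_le1 x; have := cos_geN1 x; rewrite /d => c1 c2.
move: (cos x) c1 c2 => c c1 c2; have [t0|t0] := leP 0 t; nra.
Qed.

Lemma kernel_continuous : continuous (fun x => (d x)^-1).
Proof.
move=> x; apply: continuousV; first by rewrite gt_eqF// kernel_den_gt0.
rewrite /d; apply: continuousD; last exact: cvg_cst.
apply: continuousB; first exact: cvg_cst.
by apply: continuousM; [exact: cvg_cst|exact: continuous_cos].
Qed.

Definition phase x : R := (1 - t ^+ 2) * I0 (fun y => (d y)^-1) x.

Lemma is_derive_phase x : is_derive x (1 : R) phase ((1 - t ^+ 2) / d x).
Proof.
have h := is_derive_integral0 x kernel_continuous.
have := @is_deriveZ _ _ _ (I0 (fun y => (d y)^-1)) (1 - t ^+ 2) _ _ _ h.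
by [].
Qed.

Lemma phase0 : phase 0 = 0.
Proof. by rewrite /phase /Defs.integral0 lexx set_itv1 Rintegral_set1 mulr0. Qed.

(** A + i B is (e^(ix) - t) / (1 - t e^(ix)), a number of modulus 1; the aim is to show that [phase]
    is its argument. *)
Let A x : R := ((1 + t ^+ 2) * cos x - 2 * t) / d x.
Let B x : R := (1 - t ^+ 2) * sin x / d x.

Let dn0 x : d x != 0. Proof. by rewrite gt_eqF// kernel_den_gt0. Qed.

Let is_derive_d x : is_derive x (1 : R) d (2 * t * sin x).
Proof.
have -> : d = (cst 1 - (2 * t) *: @cos R) + cst (t ^+ 2) by [].
apply: is_derive_eq; rewrite /GRing.scale/=; ring.
Qed.

Let is_derive_dV x : is_derive x (1 : R) (fun y => (d y)^-1) (- (2 * t * sin x) / d x ^+ 2).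
Proof.
apply: (is_derive_eq (is_deriveV (dn0 x) (is_derive_d x))).
by rewrite /GRing.scale/=; field.
Qed.

Let is_derive_A x : is_derive x (1 : R) A (- B x * ((1 - t ^+ 2) / d x)).
Proof.
have -> : A = ((1 + t ^+ 2) *: @cos R - cst (2 * t)) * (fun y => (d y)^-1) by [].
have h := is_derive_dV x.
apply: is_derive_eq; rewrite /GRing.scale/= /B !fctE /= /GRing.scale /=.
have := dn0 x; rewrite /d; move: (cos x) (sin x) => c s dn.
by field.
Qed.

Let is_derive_B x : is_derive x (1 : R) B (A x * ((1 - t ^+ 2) / d x)).
Proof.
have -> : B = ((1 - t ^+ 2) *: @sin R) * (fun y => (d y)^-1) by [].
have h := is_derive_dV x.
apply: is_derive_eq; rewrite /GRing.scale/= /A.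
have := dn0 x; have := cos2Dsin2 x; rewrite /d; move: (cos x) (sin x) => c s cs dn.
set rhs := (X in _ = X).
transitivity (rhs + 2 * t * (1 - t ^+ 2) * (1 - (c ^+ 2 + s ^+ 2)) / (1 - 2 * t * c + t ^+ 2) ^+ 2).
  by rewrite /rhs /GRing.scale/=; field.
by rewrite cs subrr mulr0 mul0r addr0.
Qed.

(** The vectors (cos phase, sin phase) and (A, B) rotate at the same speed (1 - t^2) / d, so their
    scalar product keeps its value 1 at 0. Being unit vectors, they then coincide. *)
Let cos_phase_aux x : cos (phase x) * A x + sin (phase x) * B x = 1.
Proof.
pose S y := cos (phase y) * A y + sin (phase y) * B y.
rewrite -/(S x); transitivity (S 0); last first.
  have := dn0 0; rewrite /S phase0 cos0 sin0 /A /d cos0 => h.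
  by field; rewrite mulr1 in h.
apply: (@is_derive_0_is_cst _ S) => y.
have hp := is_derive_phase y; have hA := is_derive_A y; have hB := is_derive_B y.
have hc : is_derive y (1 : R) (cos \o phase) (- sin (phase y) * ((1 - t ^+ 2) / d y)).
  exact: is_derive1_comp.
have hs : is_derive y (1 : R) (sin \o phase) (cos (phase y) * ((1 - t ^+ 2) / d y)).
  exact: is_derive1_comp.
have -> : S = (cos \o phase) * A + (sin \o phase) * B by [].
apply: (is_derive_eq (is_deriveD (is_deriveM hc hA) (is_deriveM hs hB))).
by rewrite /GRing.scale/=; ring.
Qed.

Let AB1 x : A x ^+ 2 + B x ^+ 2 = 1.
Proof.
rewrite /A /B; have := dn0 x; have := cos2Dsin2 x; rewrite /d; move: (cos x) (sin x) => c s cs dn.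
transitivity (1 + (1 - t ^+ 2) ^+ 2 * (c ^+ 2 + s ^+ 2 - 1) / (1 - 2 * t * c + t ^+ 2) ^+ 2).
  by field.
by rewrite cs subrr mulr0 mul0r addr0.
Qed.

Let cos_sin_phase x : cos (phase x) = A x /\ sin (phase x) = B x.
Proof.
have h : (cos (phase x) - A x) ^+ 2 + (sin (phase x) - B x) ^+ 2 = 0.
  have h1 := cos_phase_aux x; have h2 := AB1 x; have h3 := cos2Dsin2 (phase x).
  transitivity ((cos (phase x) ^+ 2 + sin (phase x) ^+ 2) + (A x ^+ 2 + B x ^+ 2)
    - 2 * (cos (phase x) * A x + sin (phase x) * B x)); first by ring.
  by rewrite h1 h2 h3; ring.
move: h => /eqP; rewrite paddr_eq0 ?sqr_ge0// !sqrf_eq0 !subr_eq0.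
by move=> /andP[/eqP -> /eqP ->].
Qed.

Lemma expi_phase x : expi (phase x) * (1 - real_complex R t * expi x) = expi x - real_complex R t.
Proof.
have [cE sE] := cos_sin_phase x; rewrite /expi cE sE /A /B.
have := dn0 x; have := cos2Dsin2 x; rewrite /d; move: (cos x) (sin x) => c s cs dn.
apply/eqP; rewrite eq_complex /=; apply/andP; split; apply/eqP.
  transitivity (c - t + t * (1 - t ^+ 2) * (c ^+ 2 + s ^+ 2 - 1) / (1 - 2 * t * c + t ^+ 2)).
    by field.
  by rewrite cs subrr mulr0 mul0r addr0.
by field.
Qed.

End Kernel.
End Calculus.

(** * The exponential e^(ix) *)

Section Expi.
Context (R : realType).
Implicit Types (x y : R).
Local Notation C := (complex R).

Lemma expi0 : expi 0 = 1 :> C.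
Proof. by rewrite /expi cos0 sin0. Qed.

Lemma expiD x y : expi (x + y) = expi x * expi y.
Proof.
by apply/eqP; rewrite eq_complex /= cosD sinD eqxx /= addrC [cos x * sin y]mulrC mulrC.
Qed.

Lemma expi_neq0 x : expi x != 0.
Proof.
apply/eqP => x0; have := expiD x (- x); rewrite x0 mul0r subrr expi0 => /eqP.
by rewrite oner_eq0.
Qed.

Lemma expiN x : expi (- x) = (expi x)^-1.
Proof.
by apply: (mulfI (expi_neq0 x)); rewrite -expiD subrr expi0 divff ?expi_neq0.
Qed.

Lemma expi_sum (T : Type) (r : seq T) (F : T -> R) :
  expi (\sum_(a <- r) F a) = \prod_(a <- r) expi (F a).
Proof. by apply: (big_morph (@expi R) (op2 := +%R)); [exact: expiD|exact: expi0]. Qed.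

Lemma expi_intmul x (k : int) : expi (x * k%:~R) = expi x ^ k.
Proof.
have nat_case (m : nat) : expi (x * m%:R) = expi x ^+ m.
  elim: m => [|m IH]; first by rewrite mulr0 expi0.
  by rewrite -natr1 mulrDr mulr1 expiD IH exprSr.
case: k => m; first exact: nat_case.
by rewrite NegzE mulrNz mulrN expiN nat_case -exprnN.
Qed.

Lemma expi_pi : expi pi = -1 :> C.
Proof. by rewrite /expi cospi sinpi; apply/eqP; rewrite eq_complex /= oppr0 !eqxx. Qed.

Lemma expi_2pi (k : int) : expi (2 * pi * k%:~R) = 1 :> C.
Proof. by rewrite expi_intmul mulr_natl mulr2n expiD expi_pi mulrNN mulr1 exp1rz. Qed.

End Expi.

(** * Reindexing over the positive roots by a Weyl group element *)

Section PosBig.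
Context (R : realType) (V : vectType R) (n : nat) (D : root_datum V n).
Implicit Types (a b : V) (w : V -> V).
Local Notation pos := (posroots D).

Definition absweyl w a := if w a \in pos then w a else - w a.

Lemma absweyl_pos w a : weyl D w -> a \in pos -> absweyl w a \in pos.
Proof.
move=> Ww aP; rewrite /absweyl; case: ifP => // /negbT.
by rewrite -root_negP// weyl_root// pos_root.
Qed.

Lemma absweyl_inj w : weyl D w -> {in pos &, injective (absweyl w)}.
Proof.
move=> Ww a b aP bP; have hw := weyl_isom Ww; rewrite /absweyl.
case: ifP => _; case: ifP => _; [by move/(isom_inj hw)|move=> E|move=> E|by move/oppr_inj/(isom_inj hw)].
  by move: E; rewrite -(isomN hw) => /(isom_inj hw) E; have := posN bP; rewrite -E aP.
by move: E; rewrite -(isomN hw) => /(isom_inj hw) E; have := posN aP; rewrite E bP.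
Qed.

Lemma absweyl_image w : weyl D w -> [fset absweyl w a | a in pos]%fset = pos.
Proof.
move=> Ww; apply/eqP; rewrite eqEfcard; apply/andP; split.
  by apply/fsubsetP => b /imfsetP[a /= aP ->]; exact: absweyl_pos.
by rewrite [X in (_ <= X)%N]card_in_imfset//; exact: absweyl_inj.
Qed.

Lemma big_absweyl (T : Type) (idx : T) (op : Monoid.com_law idx) (F : V -> T) w :
  weyl D w -> \big[op/idx]_(a <- pos) F a = \big[op/idx]_(a <- pos) F (absweyl w a).
Proof. by move=> Ww; rewrite -{1}(absweyl_image Ww) big_imfset//; exact: absweyl_inj. Qed.

Lemma big_pos_even (T : Type) (idx : T) (op : Monoid.com_law idx) (F : V -> T) w :
  weyl D w -> (forall a, a \in Defs.roots D -> F (- a) = F a) ->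
  \big[op/idx]_(a <- pos) F (w a) = \big[op/idx]_(a <- pos) F a.
Proof.
move=> Ww Feven; rewrite [RHS](big_absweyl _ _ Ww); apply: eq_big_seq => a aP.
by rewrite /absweyl; case: ifP => // _; rewrite Feven// weyl_root// pos_root.
Qed.

Lemma big_hatpos (T : Type) (idx : T) (op : Monoid.com_law idx) (P : pred V) (F : V -> T) :
  \big[op/idx]_(b <- hatpos D | P b) F b = \big[op/idx]_(a <- pos | P (hat D a)) F (hat D a).
Proof.
rewrite big_mkcond [RHS]big_mkcond big_imfset//= => a b aP bP E.
have a0 := pos_neq0 aP; have b0 := pos_neq0 bP.
have h u v : u \in pos -> v \in pos -> hat D u = hat D v -> v = (hatscale D u / hatscale D v) *: u.
  move=> uP vP; rewrite !hatE => /(congr1 (fun x => (hatscale D v)^-1 *: x)).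
  by rewrite !scalerA mulVf ?scale1r ?gt_eqF ?hatscale_gt0 ?(pos_neq0 vP)// mulrC.
have := h a b aP bP E; set k := _ / _ => bE.
have kpos : 0 < k by rewrite divr_gt0// hatscale_gt0.
have := pos_root bP; rewrite bE => /(root_scale (pos_root aP))[->|k1].
  by rewrite scale1r.
by move: kpos; rewrite k1 oppr_gt0 ltr10.
Qed.

End PosBig.

(** * Bethe equations and reflections of the function C *)

Section Spectrum.
Context (R : realType) (V : vectType R) (n : nat) (D : root_datum V n).
Context (t : V -> R) (ht : parameters D t) (c : nat).
Implicit Types (a b xi eta mu : V) (w : V -> V).
Local Notation ip := (ip D).
Local Notation vee := (vee ip).
Local Notation refl := (refl ip).
Local Notation Phi := (Defs.roots D).
Local Notation pos := (posroots D).
Local Notation hat := (hat D).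
Local Notation psi := (psi D).

Lemma vfunE a : vfun t a = phase (t a). Proof. by []. Qed.

Lemma is_derive_vfun a x : a \in Phi ->
  is_derive x (1 : R) (vfun t a) ((1 - t a ^+ 2) / (1 - 2 * t a * cos x + t a ^+ 2)).
Proof. by move=> aP; apply: is_derive_phase; exact: t_bound ht _ aP. Qed.

Lemma continuous_vfun a : a \in Phi -> continuous (vfun t a).
Proof.
move=> aP x; apply/differentiable_continuous/derivable1_diffP.
by have [] := is_derive_vfun x aP.
Qed.

Lemma hatscale_dual a : a != 0 -> 2 / ip a (vee (hat a)) = hatscale D a.
Proof.
move=> a0; rewrite vee_hat// ipZr ip_vee_self//.
by field; rewrite gt_eqF// hatscale_gt0.
Qed.

(** The first-order condition for the restriction of the potential to the line xi + s eta. The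
    weight 2 / <a, hat a^vee> turns <a, eta> into <hat a, eta>. *)
Lemma potential_critical mu xi eta :
  (forall eta, potential D t c mu xi <= potential D t c mu eta) ->
  c%:R * ip xi eta + \sum_(a <- pos) vfun t a (ip xi a) * ip (hat a) eta
    = 2 * pi * ip (hatrho D + mu) eta.
Proof.
move=> ximin; set rm := hatrho D + mu.
pose f s := potential D t c mu (xi + s *: eta).
pose df s := c%:R * (ip xi eta + s * ip eta eta) - 2 * pi * ip rm eta +
  \sum_(a <- pos) vfun t a (ip xi a + s * ip eta a) * ip (hat a) eta.
have hf s : is_derive s (1 : R) f (df s).
  have fE : f = (fun s => c%:R / 2 * ip xi xi - 2 * pi * ip rm xi
     + (c%:R * ip xi eta - 2 * pi * ip rm eta) * s + c%:R / 2 * ip eta eta * s ^+ 2)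
     \+ (fun s => \sum_(a <- pos) hatscale D a *
        Defs.integral0 (vfun t a) (ip xi a + s * ip eta a)).
    apply/funext => r; rewrite /f /potential /=; congr (_ + _).
      rewrite !(ipDr, ipDl, ipZr, ipZl) (ipC ip eta xi) -/rm; by field.
    apply: eq_big_seq => a aP; rewrite hatscale_dual ?(pos_neq0 aP)//.
    by rewrite ipDl ipZl.
  pose g1 (s : R) := c%:R / 2 * ip xi xi - 2 * pi * ip rm xi
     + (c%:R * ip xi eta - 2 * pi * ip rm eta) * s + c%:R / 2 * ip eta eta * s ^+ 2.
  have hg1 : is_derive s (1 : R) g1 ((c%:R * ip xi eta - 2 * pi * ip rm eta) + c%:R * ip eta eta * s).
    by apply: (is_derive_eq (is_derive_quadratic _ _ _ _)); field.
  have hg2 : is_derive s (1 : R) (fun s => \sum_(a <- pos) hatscale D a *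
        Defs.integral0 (vfun t a) (ip xi a + s * ip eta a))
      (\sum_(a <- pos) hatscale D a * (vfun t a (ip xi a + s * ip eta a) * ip eta a)).
    apply: is_derive_bigsum => a aP.
    have hI : is_derive (ip xi a + s * ip eta a) (1 : R) (Defs.integral0 (vfun t a))
        (vfun t a (ip xi a + s * ip eta a)).
      exact/is_derive_integral0/continuous_vfun/pos_root.
    have hL : is_derive s (1 : R) (fun s => ip xi a + s * ip eta a) (ip eta a).
      exact: is_derive_affine.
    have hc := @is_derive1_comp R (Defs.integral0 (vfun t a))
      (fun s => ip xi a + s * ip eta a) s _ _ hI hL.
    exact: (@is_deriveZ _ _ _ _ (hatscale D a) _ _ _ hc).
  rewrite fE; apply: (is_derive_eq (is_deriveD hg1 hg2)).
  rewrite /df; congr (_ + _); first by ring.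
  by apply: eq_bigr => a _; rewrite hatE ipZl (ipC ip a); ring.
have dfb y : derivable f y (1 : R) by have [] := hf y.
have := derive_at_min (hf 0) dfb.
rewrite /df mul0r addr0 /f scale0r addr0.
under eq_bigr do rewrite mul0r addr0.
by move=> /(_ (fun y => ximin _)); lra.
Qed.

Local Notation rC := (real_complex R).

(** By [uphase_rel] this is (t_a - z) / (1 - t_a z) with z = e^(ix). At x = <eta, a> it is the
    quotient of the factors of C belonging to a and - a, see [cfactorN]. *)
Definition uphase a x : complex R := - expi (vfun t a x).
Local Notation u := uphase.

Lemma uphase_neq0 a x : u a x != 0.
Proof. by rewrite oppr_eq0 expi_neq0. Qed.

Lemma uphase_rel a x : a \in Phi ->
  u a x * (1 - rC (t a) * expi x) = rC (t a) - expi x.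
Proof. by move=> aP; rewrite mulNr vfunE expi_phase ?opprB//; exact: t_bound ht _ aP. Qed.

Lemma expi_t_neq a x : a \in Phi -> 1 - rC (t a) * expi x != 0 /\ rC (t a) - expi x != 0.
Proof.
move=> aP; have /andP[t1 t2] := t_bound ht aP.
have h : 1 - rC (t a) * expi x != 0.
  apply/eqP => e; have := uphase_rel x aP; rewrite e mulr0 => /eqP.
  rewrite eq_sym subr_eq0 => /eqP E; move: e; rewrite -E => e.
  have : rC (1 - t a * t a) = 0 by rewrite rmorphB rmorphM rmorph1.
  by move=> /eqP; rewrite fmorph_eq0 => /eqP; nra.
by split=> //; rewrite -uphase_rel// mulf_neq0// uphase_neq0.
Qed.

Lemma uphaseN a x : a \in Phi -> u a (- x) = (u a x)^-1.
Proof.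
move=> aP; have [h1 h2] := expi_t_neq x aP; have z0 := expi_neq0 x.
have E : u a x = (rC (t a) - expi x) / (1 - rC (t a) * expi x).
  by rewrite -uphase_rel// mulfK.
have := uphase_rel (- x) aP; rewrite E invf_div expiN.
have h3 : 1 - rC (t a) * (expi x)^-1 != 0.
  have -> : 1 - rC (t a) * (expi x)^-1 = - ((rC (t a) - expi x) / expi x) by field.
  by rewrite oppr_eq0 mulf_neq0// invr_eq0.
move=> E2; apply: (mulIf h3); rewrite E2; field.
by rewrite z0 h2.
Qed.

Lemma uphase_opp a x : a \in Phi -> u (- a) x = u a x.
Proof. by move=> aP; rewrite /u !vfunE (t_opp ht). Qed.

Lemma uphase_weyl w a x : weyl D w -> a \in Phi -> u (w a) x = u a x.
Proof. by move=> Ww aP; rewrite /u !vfunE (t_weyl ht). Qed.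

(** The critical equation in the direction v^-1 alpha_0, exponentiated. The term of mu is a multiple
    of 2 pi because v^-1 psi is a coroot of hat R_0. The term of hatrho contributes pi times the
    pairing with hat a for each positive a, which supplies the sign in [uphase]. *)
Lemma bethe xi v : spectrum D t c xi -> weyl D v ->
  expi (c%:R * ip (v xi) (alpha0 D)) =
  \prod_(a <- pos) u a (ip (v xi) a) ^ Num.floor (ip (hat a) psi).
Proof.
move=> [mu [hmu _] ximin] Wv; have [w Ww [vK wK]] := weylV Wv.
have hv := weyl_isom Wv; have hw := weyl_isom Ww.
pose ka := w (alpha0 D).
have kaE : v ka = alpha0 D by rewrite /ka wK.
have ipka x : ip x ka = ip (v x) (alpha0 D) by rewrite -kaE (isom_ip hv).
have kint a : a \in Phi -> ip (hat a) ka \is a Num.int.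
  move=> aP; rewrite ipka (isom_hat _ hv) alpha0E ipNr rpredN.
  by apply: hat_psi_int; exact: weyl_root.
have [m mE] : exists m : int, ip mu ka = m%:~R.
  apply/intrP; rewrite /ka alpha0E (isomN hw) ipNr rpredN -[psi]vee_hat_psi (isom_vee hw) (isom_hat _ hw).
  by apply: hmu; apply/imfsetP; exists (w psi) => //=; apply: weyl_root => //; exact: psi_root.
have := potential_critical ka ximin; rewrite ipDl mE /hatrho ipZl ip_suml big_hatpos => crit.
pose F a := u a (ip xi a) ^ (- Num.floor (ip (hat a) ka)).
have E : c%:R * ip xi ka = 2 * pi * m%:~R +
    \sum_(a <- pos) (vfun t a (ip xi a) - pi) * (- Num.floor (ip (hat a) ka))%:~R.
  have -> : \sum_(a <- pos) (vfun t a (ip xi a) - pi) * (- Num.floor (ip (hat a) ka))%:~R =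
     - (\sum_(a <- pos) vfun t a (ip xi a) * ip (hat a) ka) + pi * \sum_(a <- pos) ip (hat a) ka.
    rewrite mulr_sumr -sumrN -big_split/=; apply: eq_big_seq => a aP.
    rewrite rmorphN/= floorK ?kint ?pos_root//; ring.
  by move: crit; lra.
rewrite -ipka E expiD expi_2pi mul1r expi_sum.
transitivity (\prod_(a <- pos) F a).
  apply: eq_bigr => a _; by rewrite expi_intmul expiD expiN expi_pi invrN1 mulrN1.
rewrite -(big_pos_even _ Ww); last first.
  move=> a aP; rewrite /F (uphase_opp _ aP) hatN ipNl ipNr (uphaseN _ aP).
  have /intrP[k ->] := kint a aP; rewrite -rmorphN !intrKfloor opprK.
  by rewrite exprz_inv.
apply: eq_big_seq => a aP; rewrite /F (uphase_weyl _ Ww (pos_root aP)).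
rewrite -(isom_ip hv xi) wK (ipka (hat _)) (isom_hat _ hv) wK alpha0E ipNr.
have /intrP[k ->] := hat_psi_int (pos_root aP); by rewrite -rmorphN !intrKfloor opprK.
Qed.

Definition cfactor a eta : complex R :=
  (1 - rC (t a) * expi (- ip eta a)) / (1 - expi (- ip eta a)).

Lemma cfunE eta : cfun D t eta = \prod_(a <- pos) cfactor a eta.
Proof. by []. Qed.

Lemma cfactorN a eta : a \in Phi -> expi (ip eta a) != 1 ->
  cfactor (- a) eta = cfactor a eta * (u a (ip eta a))^-1.
Proof.
move=> aP z1; have [h1 h2] := expi_t_neq (ip eta a) aP; have z0 := expi_neq0 (ip eta a).
have E : u a (ip eta a) = (rC (t a) - expi (ip eta a)) / (1 - rC (t a) * expi (ip eta a)).
  by rewrite -uphase_rel// mulfK.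
rewrite E invf_div /cfactor (t_opp ht)// ipNr opprK expiN.
move: z1 h1 h2 z0; move: (expi _) (rC _) => z s z1 h1 h2 z0.
have z2 : z - 1 != 0 by rewrite subr_eq0.
have z3 : 1 - z != 0 by rewrite subr_eq0 eq_sym.
by field; rewrite z0 h2 z3 z2.
Qed.

Definition regular eta := forall a, a \in Phi -> expi (ip eta a) != 1.

(** Reflecting the argument permutes the factors of C up to the sign of the root; each root made
    negative costs one factor, by [cfactorN]. *)
Lemma cfun_refl a eta : a \in Phi -> regular eta ->
  cfun D t (refl a eta) =
  cfun D t eta * \prod_(b <- pos | refl a b \notin pos) (u b (ip eta b))^-1.
Proof.
move=> aP reg; have a0 := root_neq0 aP; have Wa := weyl_refl aP.
rewrite !cfunE [X in _ * X]big_mkcond -big_split/= [RHS](big_absweyl _ _ Wa).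
apply: eq_big_seq => b bP; have bR := pos_root bP; have sR := weyl_root Wa bR.
have -> : cfactor b (refl a eta) = cfactor (refl a b) eta.
  by rewrite /cfactor ip_reflC// (t_weyl ht Wa bR).
rewrite /absweyl; case: ifP => sP; first by rewrite reflK// bP mulr1.
rewrite (isomN (weyl_isom Wa)) reflK// posN// -cfactorN ?opprK ?root_opp//.
by apply: reg; exact: root_opp.
Qed.

Lemma spectrum_regular xi v : regular xi -> weyl D v -> regular (v xi).
Proof.
move=> reg Wv a aP; have [w Ww [vK wK]] := weylV Wv.
by rewrite -[a]wK (isom_ip (weyl_isom Wv)); apply: reg; exact: weyl_root.
Qed.

(* At a singular point the junk value [x / 0 = 0] annihilates [cfun]. *)
Lemma cfun_singular xi v : ~ regular xi -> weyl D v -> cfun D t (v xi) = 0.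
Proof.
move=> sing Wv; have [a aP a1] : exists2 a, a \in Phi & expi (ip xi a) = 1.
  apply: contrapT => h; apply: sing => a aP; apply/eqP => a1; apply: h.
  by exists a.
have [b bP b1] : exists2 b, b \in pos & expi (- ip (v xi) b) = 1.
  case: (root_pos (weyl_root Wv aP)) => h; [exists (v a) => //|exists (- v a) => //].
    by rewrite (isom_ip (weyl_isom Wv)) expiN a1 invr1.
  by rewrite ipNr opprK (isom_ip (weyl_isom Wv)).
rewrite cfunE (big_rem b)//=.
by rewrite {1}/cfactor b1 subrr invr0 mulr0 mul0r.
Qed.

End Spectrum.

(** * Macdonald functions under simple affine reflections *)

Section MacdonaldSteps.
Context (R : realType) (V : vectType R) (n : nat) (D : root_datum V n).
Context (t : V -> R) (ht : parameters D t) (c : nat).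
Implicit Types (a b x xi eta mu : V) (w v : V -> V) (j : 'I_n.+1).
Local Notation ip := (ip D).
Local Notation vee := (vee ip).
Local Notation refl := (refl ip).
Local Notation Phi := (Defs.roots D).
Local Notation psi := (psi D).
Local Notation rC := (real_complex R).
Local Notation sim := (affsimple D).
Local Notation u := (uphase t).
Local Notation aeval := (affeval D c).
Local Notation M := (macdonald D t).

Lemma affeval_simple j x : aeval (sim j) x = ip x (vee (sim j).1) + aeval (sim j) 0.
Proof. by rewrite /affeval ip0l add0r. Qed.

(** Let A be [(sim j).1]; then q = u_A^-1. For j > 0 only A changes sign. For j = 0, A = - psi, and
    the Bethe equation brings u_b to the power <hat b, psi>. For positive b other than psi this
    power is 0 or 1 and cancels what [cfun_refl] contributes; for psi it is 2 against -1, which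
    leaves u_psi = u_A^-1. *)
Lemma cfun_step xi v j : spectrum D t c xi -> weyl D v ->
  exists2 q : complex R,
    q * (expi (ip (v xi) (sim j).1) - rC (t (sim j).1)) =
      rC (t (sim j).1) * expi (ip (v xi) (sim j).1) - 1 &
    cfun D t (refl (sim j).1 (v xi)) * expi (aeval (sim j) 0 * ip (v xi) (sim j).1) =
      cfun D t (v xi) * q.
Proof.
move=> xiS Wv; set A := (sim j).1; set x := ip (v xi) A.
have AP : A \in Phi := affsimple_root D j; have A0 := root_neq0 AP.
have WA := weyl_refl AP.
exists (u A x)^-1.
  apply: (mulfI (uphase_neq0 t A x)); rewrite mulrA mulfV ?uphase_neq0// mul1r.
  have := uphase_rel ht x AP; set z := expi x; set s := rC _ => E.
  by rewrite -[LHS]opprB -E; ring.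
have [reg|sing] := pselect (regular D xi); last first.
  by rewrite (cfun_singular t sing Wv) (cfun_singular t sing (weylM WA Wv)) !mul0r.
have regv := spectrum_regular reg Wv.
rewrite (cfun_refl ht AP regv) -mulrA; congr (_ * _).
rewrite big_mkcond/=.
case: (affsimple_cases D j) => [[j0 E]|[i ji E]].
  have AE : A = - psi by rewrite /A E /= alpha0E.
  have -> : aeval (sim j) 0 = c%:R.
    by rewrite /affeval ip0l add0r E/= alpha0E multN mult_psi mulr1 mul1r.
  rewrite /x AE -alpha0E (bethe ht xiS Wv) -big_split/=.
  rewrite alpha0E (uphase_opp ht _ (psi_root D)) ipNr (uphaseN ht _ (psi_root D)) invrK.
  have psiP := psi_pos D.
  rewrite (big_rem psi psiP)/=.
  rewrite -[refl (- psi) psi]reflNv opprK refl_self ?(root_neq0 (psi_root D))// posN//=.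
  rewrite hat_psi_self (_ : Num.floor (2 : R) = Posz 2); last first.
    by rewrite -[RHS](@intrKfloor R).
  rewrite [\prod_(b <- rem _ _) _]big1_seq ?mulr1; last first.
    move=> b /=; rewrite mem_rem_uniq ?fset_uniq// inE => /andP[bpsi bP].
    have bR := pos_root bP.
    have bN : b != - psi by apply: contraTneq bP => ->; rewrite posN.
    have /intrP[k kE] := hat_psi_int bR; rewrite kE intrKfloor.
    have := hat_psi_bound bR bpsi bN; rewrite kE -(rmorphN1 (intmul (1 : R))) ler_int lerz1.
    have b0 := root_neq0 bR; have hs := hatscale_gt0 D b0.
    have := dominant_pos (@psi_dominant _ _ _ D) bP; rewrite ipC.
    rewrite -(pmulr_rge0 _ hs) -ipZl -hatE kE ler0z => k0 k1.
    have [kE0|kn0] := eqVneq k 0.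
      have bpsi0 : ip b psi = 0.
        apply/eqP; rewrite -(mulrI_eq0 _ (mulfI (lt0r_neq0 hs))) -ipZl -hatE kE kE0.
        by [].
      by rewrite kE0 expr0z mulr1 reflNv refl_fix// bP.
    have kE1 : k = 1 by lia.
    have bpos : 0 < ip b psi.
      by rewrite -(pmulr_rgt0 _ hs) -ipZl -hatE kE kE1.
    have := psi_refl_neg bP bpos; rewrite root_negP ?root_refl ?psi_root// reflNv => nP.
    by rewrite nP kE1 expr1z mulVf// uphase_neq0.
  by rewrite -exprnP expr2 mulKf// uphase_neq0.
have AE : A = tnth (base D) i by rewrite /A E.
have -> : aeval (sim j) 0 = 0 by rewrite /affeval ip0l add0r E/= mulr0 mul0r.
rewrite mul0r expi0 mulr1 (big_rem A)/=; last by rewrite AE simple_pos.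
rewrite refl_self// posN ?AE ?simple_pos//= -AE.
rewrite [\prod_(b <- rem _ _) _]big1_seq ?mulr1// => b /=.
rewrite mem_rem_uniq ?fset_uniq// inE => /andP[bA bP].
by rewrite AE simple_refl_pos// -AE.
Qed.

Lemma macdonald_refl a x xi : a \in Phi ->
  M x xi = \sum_(v \in weyl D) cfun D t (refl a (v xi)) * expi (ip (refl a (v xi)) x).
Proof.
move=> aP; rewrite /macdonald (reindex_fsbig (fun v => refl a \o v) (weyl D) (weyl D))//.
have a0 := root_neq0 aP; split.
- by move=> v Wv; apply: weylM => //; exact: weyl_refl.
- move=> v w _ _ E; apply/funext => y.
  by have := congr1 (fun f => f y) E => /(refl_inj a0).
- move=> v Wv; exists (refl a \o v); first by apply: weylM => //; exact: weyl_refl.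
  by apply/funext => y /=; rewrite reflK.
Qed.

(** Pairing v with s_a v reduces the reflection formulas to identities between two terms. *)
Lemma macdonald_double a x xi : a \in Phi ->
  2 * M x xi = \sum_(v \in weyl D) (cfun D t (v xi) * expi (ip (v xi) x) +
     cfun D t (refl a (v xi)) * expi (ip (refl a (v xi)) x)).
Proof.
move=> aP; rewrite fsbig_split/=; last exact: finite_weyl.
by rewrite -(macdonald_refl x xi aP) mulr_natl mulr2n.
Qed.

Lemma macdonald_pair xi v j x q : weyl D v ->
  cfun D t (refl (sim j).1 (v xi)) * expi (aeval (sim j) 0 * ip (v xi) (sim j).1) =
      cfun D t (v xi) * q ->
  cfun D t (v xi) * expi (ip (v xi) x) +
     cfun D t (refl (sim j).1 (v xi)) * expi (ip (refl (sim j).1 (v xi)) x) =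
  cfun D t (v xi) * expi (ip (v xi) x) *
    (1 + q * expi (- (aeval (sim j) x * ip (v xi) (sim j).1))).
Proof.
move=> Wv E; set A := (sim j).1 in E *.
have AP : A \in Phi := affsimple_root D j; have A0 := root_neq0 AP.
have -> : ip (refl A (v xi)) x = ip (v xi) x + (aeval (sim j) 0 * ip (v xi) A
    + - (aeval (sim j) x * ip (v xi) A)).
  rewrite ip_reflC// {1}/Defs.refl ipBr ipZr (affeval_simple j x) -/A; ring.
rewrite !expiD mulrDr mulr1; congr (_ + _).
transitivity (cfun D t (refl A (v xi)) * expi (aeval (sim j) 0 * ip (v xi) A) *
  expi (ip (v xi) x) * expi (- (aeval (sim j) x * ip (v xi) A))); first by ring.
by rewrite E; ring.
Qed.

Lemma affeval_addA j x k : aeval (sim j) (x + k *: (sim j).1) = aeval (sim j) x + k * 2.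
Proof.
have A0 := root_neq0 (affsimple_root D j).
by rewrite /affeval ipDl ipZl (ip_vee_self _ A0) addrAC.
Qed.

(** For each pair of terms this reads 1 + q z = t (z + q) with z = e^(i<v xi, A>), which is the
    relation for q in [cfun_step]. *)
Lemma macdonald_step1 xi j x : spectrum D t c xi -> aeval (sim j) x = -1 ->
  M x xi = rC (t (sim j).1) * M (affrefl D c (sim j) x) xi.
Proof.
move=> xiS ax; set A := (sim j).1; have AP : A \in Phi := affsimple_root D j.
have sx : affrefl D c (sim j) x = x + 1 *: A.
  by rewrite /affrefl ax scaleN1r opprK scale1r.
apply: (mulfI (_ : 2 != 0 :> complex R)); first by rewrite pnatr_eq0.
rewrite mulrCA !(macdonald_double _ _ AP) mulr_fsumr.
apply: eq_fsbigr => v /set_mem Wv; have [q q1 q2] := cfun_step j xiS Wv.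
rewrite !(macdonald_pair _ Wv q2) sx affeval_addA ax -/A ipDr ipZr.
rewrite (_ : - (-1 * ip (v xi) A) = ip (v xi) A); last by ring.
rewrite (_ : - ((-1 + 1 * 2) * ip (v xi) A) = - ip (v xi) A); last by ring.
rewrite mul1r expiD expiN; rewrite -/A in q1; have := expi_neq0 (ip (v xi) A).
move: q1; move: (expi (ip (v xi) A)) (expi (ip (v xi) x)) (rC _) (cfun _ _ _) => z e s C q1 z0.
have -> : s * (C * (e * z) * (1 + q / z)) = C * e * (s * (z + q)) by field.
congr (_ * _); transitivity (1 + q * (z - s) + q * s); first by ring.
by rewrite q1; ring.
Qed.

(** For each pair of terms this reads 1 + q z^2 = t (z^2 + q) - (1 - t) z (1 + q), which follows
    from the same relation used twice. *)
Lemma macdonald_step2 xi j x : spectrum D t c xi -> aeval (sim j) x = -2 ->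
  M x xi = rC (t (sim j).1) * M (affrefl D c (sim j) x) xi
    - (1 - rC (t (sim j).1)) * M (x + (sim j).1) xi.
Proof.
move=> xiS ax; set A := (sim j).1; have AP : A \in Phi := affsimple_root D j.
have sx : affrefl D c (sim j) x = x + 2 *: A.
  by rewrite /affrefl ax scaleNr opprK.
have xA : x + A = x + 1 *: A by rewrite scale1r.
apply: (mulfI (_ : 2 != 0 :> complex R)); first by rewrite pnatr_eq0.
rewrite mulrBr mulrCA [2 * ((1 - _) * _)]mulrCA !(macdonald_double _ _ AP) !mulr_fsumr.
have fW := finite_weyl D.
rewrite !(fsbig_finite _ _ fW)/= -sumrB; apply: eq_big_seq => v.
rewrite in_fset_set// => /set_mem Wv; have [q q1 q2] := cfun_step j xiS Wv.
rewrite !(macdonald_pair _ Wv q2) sx xA !affeval_addA ax -/A !ipDr !ipZr.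
rewrite (_ : - (-2 * ip (v xi) A) = ip (v xi) A + ip (v xi) A); last by ring.
rewrite (_ : - ((-2 + 2 * 2) * ip (v xi) A) = - (ip (v xi) A + ip (v xi) A)); last by ring.
rewrite (_ : - ((-2 + 1 * 2) * ip (v xi) A) = 0); last by ring.
rewrite mul1r mulr_natl mulr2n expi0 expiN !expiD; rewrite -/A in q1; have := expi_neq0 (ip (v xi) A).
move: q1; move: (expi (ip (v xi) A)) (expi (ip (v xi) x)) (rC _) (cfun _ _ _) => z e s C q1 z0.
transitivity (C * e * (s * (z * z + q) - (1 - s) * (z * (1 + q)))); last by field.
congr (_ * _).
have qz : q * z = q * s + (s * z - 1) by rewrite -q1; ring.
transitivity (1 + (q * z) * z); first by ring.
transitivity (1 + s * (q * z) + s * z * z - z); first by rewrite {1}qz; ring.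
transitivity (s * (z * z + q) - z + s * z + s * (q * z) - q * z); last by ring.
by rewrite qz; ring.
Qed.

Lemma orbit_sum_macdonald x omega xi :
  orbit_sum D omega xi * M x xi = \sum_(nu \in weyl_orbit D omega) M (x + nu) xi.
Proof.
have fW := finite_weyl D; have fO := finite_weyl_orbit D omega.
rewrite /macdonald !(fsbig_finite _ _ fO)/=.
under [RHS]eq_bigr do rewrite (fsbig_finite _ _ fW)/=.
rewrite exchange_big/= (fsbig_finite _ _ fW)/= mulr_sumr.
apply: eq_big_seq => v; rewrite in_fset_set// => /set_mem Wv.
have -> : orbit_sum D omega xi = \sum_(nu \in weyl_orbit D omega) expi (ip (v xi) nu).
  have [w Ww [vK wK]] := weylV Wv; have hv := weyl_isom Wv.
  rewrite [RHS](reindex_fsbig v (weyl_orbit D omega) (weyl_orbit D omega)).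
    by apply: eq_fsbigr => nu _; rewrite (isom_ip hv) ipC.
  split; first by move=> y; apply: weyl_orbit_act.
    by move=> y z _ _ /(isom_inj hv).
  by move=> y yO; exists (w y); [exact: weyl_orbit_act|rewrite wK].
rewrite (fsbig_finite _ _ fO)/= mulr_suml; apply: eq_bigr => nu _.
by rewrite ipDr expiD; ring.
Qed.

End MacdonaldSteps.

(** * Orbits of minuscule and quasi-minuscule weights *)

Section Orbits.
Context (R : realType) (V : vectType R) (n : nat) (D : root_datum V n).
Implicit Types (a b x y omega nu : V) (w : V -> V) (i : 'I_n).
Local Notation ip := (ip D).
Local Notation vee := (vee ip).
Local Notation refl := (refl ip).
Local Notation Phi := (Defs.roots D).
Local Notation pos := (posroots D).
Local Notation theta := (vartheta D).

(* The roots in the double orthogonal complement of [S] split off as an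
   orthogonal factor. *)
Lemma irreducible_orth (a x : V) : a \in Phi ->
  (forall b, b \in Phi -> ip a b != 0 -> ip x b = 0) -> x = 0.
Proof.
move=> aP hx; pose orth y := forall b, b \in Phi -> ip a b != 0 -> ip y b = 0.
pose inA b := `[< forall y, orth y -> ip y b = 0 >].
have [_ irr] := Defs.irreducibleP D.
have E : Phi = ([fset b in Phi | inA b] `|` [fset b in Phi | ~~ inA b])%fset.
  by apply/fsetP => b; rewrite !inE -andb_orr orbN andbT.
have aA : a \in [fset b in Phi | inA b]%fset.
  rewrite !inE aP/=; apply/asboolP => y; apply=> //.
  by rewrite gt_eqF// ip_gt0// (root_neq0 aP).
case: (irr _ _ E) => [b d|A0|B0].
- rewrite !inE => /andP[bP /asboolP bA] /andP[dP /asboolP dA].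
  have [y yo yd] : exists2 y, orth y & ip y d != 0.
    apply: contrapT => h; apply: dA => y yo; apply/eqP; apply: contrapT => /negP yd.
    by apply: h; exists y.
  have d0 := root_neq0 dP.
  have ad : ip a d = 0.
    by apply/eqP; apply: contraTT yd => ad; rewrite negbK; apply/eqP/yo.
  rewrite ipC; apply: bA => e eP ae.
  (* s_d fixes [a], so s_d e is not orthogonal to [a] either; [y] kills both e and s_d e but not d,
     which forces <e, d> = 0. *)
  have : ip y (refl d e) = 0.
    apply: yo; first exact: root_refl.
    by rewrite -(ip_reflC _ _ _ d0) (refl_fix ad).
  rewrite /Defs.refl ipBr ipZr (yo e eP ae) sub0r => /eqP.
  rewrite oppr_eq0 mulf_eq0 (negbTE yd) orbF ip_vee_eq0// => /eqP.
  by rewrite ipC.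
- by move: aA; rewrite A0 inE.
apply: (@root_fullv _ _ _ D) => b bP.
have : b \in [fset b in Phi | inA b]%fset by rewrite E B0 fsetU0 in bP.
by rewrite !inE => /andP[_ /asboolP]; apply.
Qed.

Lemma weyl_orbit_root b : weyl_orbit D theta b -> b \in Phi.
Proof. by move=> [w Ww <-]; apply: weyl_root => //; exact: theta_root. Qed.

Lemma weight_weyl w x : weyl D w -> weight D x -> weight D (w x).
Proof.
move=> Ww hx a aP; have [u Wu [wK uK]] := weylV Ww.
rewrite -[a]uK -(isom_vee (weyl_isom Ww)) (isom_ip (weyl_isom Ww)).
by apply: hx; exact: weyl_root.
Qed.

(** Let [a] be the root with <omega, a^vee> = 2, and let b be a root other than a, - a with k = <a,
    b^vee> nonzero. The bound 1 at b and at s_a b gives |p| <= 1 and |p - 2 k| <= 1 for p = <omega,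
    b^vee>, so p = k; then omega = a by [irreducible_orth]. A long omega is ruled out because <phi,
    theta^vee> would exceed 1. *)
Lemma quasiminuscule_pairing omega : dominant_weight D omega -> quasiminuscule D omega ->
  omega = theta /\ forall b, b \in Phi -> b != omega -> b != - omega -> -1 <= ip omega (vee b) <= 1.
Proof.
move=> [wt dom] [_ bnd [a [[aP a2] auniq]]]; have aR := pos_root aP; have a0 := root_neq0 aR.
have bnd1 b : b \in Phi -> b != a -> b != - a -> -1 <= ip omega (vee b) <= 1.
  have pbnd d : d \in pos -> d != a -> 0 <= ip omega (vee d) <= 1.
    move=> dP da; have /andP[d0 d2] := bnd d dP; rewrite d0/=.
    have := wt d (pos_root dP) => /intrP[m mE].
    have d2' : ip omega (vee d) != 2.
      by apply: contraNneq da => d2'; apply/eqP/esym/auniq.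
    move: d2 d2'; rewrite mE -[2]/(2%:~R) ler_int eqr_int lerz1; lia.
  move=> bP ba bna; case: (root_pos bP) => h.
    by have /andP[h1 ->] := pbnd b h ba; rewrite andbT; apply: le_trans h1; rewrite oppr_le0 ler01.
  have := pbnd _ h; rewrite veeN ipNr eqr_oppLR => /(_ bna) /andP[h1 h2].
  by apply/andP; split; lra.
have E : omega = a.
  apply/eqP; rewrite -subr_eq0; apply/eqP; apply: (irreducible_orth aR) => b bP ab.
  have b0 := root_neq0 bP.
  have [->|ba] := eqVneq b a.
    by apply/eqP; rewrite -(ip_vee_eq0 _ _ a0) ipBl a2 ip_vee_self// subrr.
  have [->|bna] := eqVneq b (- a).
    by rewrite ipNr; apply/eqP; rewrite oppr_eq0 -(ip_vee_eq0 _ _ a0) ipBl a2 ip_vee_self// subrr.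
  have sP := root_refl aR bP.
  have sa : refl a b != a.
    by apply: contraNneq bna => e; rewrite -(reflK ip a0 b) e refl_self.
  have sna : refl a b != - a.
    apply: contraNneq ba => e; rewrite -(reflK ip a0 b) e (isomN (lin_isom_refl ip a0)).
    by rewrite refl_self// opprK.
  have := bnd1 _ sP sa sna; have := bnd1 _ bP ba bna.
  rewrite -(isom_vee (lin_isom_refl ip a0)) -(ip_reflC _ _ _ a0) {2}/Defs.refl ipBl ipZl a2.
  have /intrP[p pE] := wt b bP; have /intrP[k kE] := root_int bP aR.
  have kn0 : k != 0.
    by apply: contraNneq ab => k0; rewrite -(ip_vee_eq0 _ _ b0) kE k0.
  rewrite pE kE; have -> : p%:~R - 2 * k%:~R = (p - 2 * k)%:~R :> R.
    by rewrite rmorphB rmorphM.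
  rewrite -(rmorphN1 (intmul (1 : R))) !ler_int !lerz1 => /andP[p1 p2] /andP[q1 q2].
  have pk : p = k by clear -p1 p2 q1 q2 kn0; lia.
  by apply/eqP; rewrite -(ip_vee_eq0 _ _ b0) ipBl pE kE pk subrr.
split; last by move=> b bP; rewrite {1 2}E; exact: bnd1.
rewrite E.
have da : dominant D a by rewrite -E => i; rewrite -(ip_vee_ge0 _ _ (simple_neq0 D i)); apply: dom; exact: simple_pos.
case: (dominant_rootP aR da) => // aphi.
have [//|ne] := eqVneq a theta.
have nth : theta != a by rewrite eq_sym.
have pa := ip_gt0 ip a0; have tR := theta_root D; have t0 := root_neq0 tR.
have posE : 0 < ip theta a.
  by rewrite aphi; apply: dominant_root_phi_gt0 => //; exact: theta_dominant.
have e1 : ip theta (vee a) = 1.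
  by apply: (pairing1 aR tR _ nth posE); exact: theta_short.
have lt1 : ip theta theta < ip a a.
  rewrite lt_neqAle theta_short// andbT; apply: contraNneq nth => e; apply/eqP.
  exact: (dominant_root_eq tR aR (@theta_dominant _ _ _ D) da e posE).
have nth2 : theta != - a.
  by apply: contraTneq posE => ->; rewrite ipNl -leNgt oppr_le0 ltW.
have /andP[_] := bnd1 _ tR nth nth2.
have := ip_veeK ip theta a0; have := ip_veeK ip a t0; rewrite e1 E (ipC ip a theta) => <- h h1.
have pt := ip_gt0 ip t0; exfalso; nra.
Qed.

Lemma orbit_pairing omega nu b : dominant_weight D omega ->
  minuscule D omega \/ quasiminuscule D omega ->
  weyl_orbit D omega nu -> b \in Phi ->
  -1 <= ip nu (vee b) <= 1 \/ ((b = nu \/ b = - nu) /\ weyl_orbit D theta nu).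
Proof.
move=> hdom hqm [w Ww <-] bP; have [u Wu [wK uK]] := weylV Ww; have hw := weyl_isom Ww.
have uP := weyl_root Wu bP.
have pE : ip (w omega) (vee b) = ip omega (vee (u b)).
  by rewrite -{1}[b]uK -(isom_vee hw) (isom_ip hw).
case: hqm => [[_ hm]|hq].
  left; rewrite pE; case: (root_pos uP) => h.
    by have /andP[h1 ->] := hm _ h; rewrite andbT; apply: le_trans h1; rewrite oppr_le0 ler01.
  by have := hm _ h; rewrite veeN ipNr => /andP[h1 h2]; apply/andP; split; lra.
have [oE hb] := quasiminuscule_pairing hdom hq.
have [e|ne] := eqVneq (u b) omega.
  right; split; first by left; rewrite -e uK.
  by rewrite oE; exists w.
have [e|ne2] := eqVneq (u b) (- omega).
  right; split; first by right; rewrite -(isomN hw) -e uK.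
  by rewrite oE; exists w.
by left; rewrite pE; exact: hb.
Qed.

Lemma minuscule_orbit_theta omega nu : dominant_weight D omega -> minuscule D omega ->
  weyl_orbit D omega nu -> ~ weyl_orbit D theta nu.
Proof.
move=> hdom hm hnu hth; have nP := weyl_orbit_root hth.
move: hnu => [w Ww E]; have [u Wu [wK uK]] := weylV Ww.
have oP : omega \in Phi by rewrite -[omega]wK E; exact: weyl_root.
have := ip_vee_self ip (root_neq0 oP); have [_ h] := hm.
case: (root_pos oP) => /h; first by move=> /andP[_]; lra.
by rewrite veeN ipNr => /andP[]; lra.
Qed.

(** s_i permutes the positive roots other than alpha_i within the family [P], so their contributions
    cancel against the antisymmetric [y] and only alpha_i counts. It serves both for all positive
    roots and for the short ones. *)
Lemma simple_refl_sum (P : V -> bool) (f : V -> V) i y :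
  (forall a, a \in Phi -> P (refl (tnth (base D) i) a) = P a) ->
  (forall a, a \in Phi -> f (refl (tnth (base D) i) a) = refl (tnth (base D) i) (f a)) ->
  refl (tnth (base D) i) y = - y -> ip (f (tnth (base D) i)) y = 2 ->
  ip (2^-1 *: \sum_(a <- pos | P a) f a) y = (P (tnth (base D) i))%:R.
Proof.
set s := tnth (base D) i => hP hf hy h2; have sR : s \in Phi := simple_root D i.
have s0 := root_neq0 sR; have sP : s \in pos := simple_pos D i.
rewrite ipZl ip_suml big_mkcond/=; set F := fun a => if P a then ip (f a) y else 0.
rewrite -[X in _ * X]/(\sum_(a <- pos) F a).
have E : \sum_(a <- rem s pos) F a = 0.
  have e1 : \sum_(a <- pos) F a = F s + \sum_(a <- rem s pos) F a by rewrite (big_rem s sP).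
  have e2 : \sum_(a <- pos) F a = F s - \sum_(a <- rem s pos) F a.
    rewrite (big_absweyl _ _ (weyl_refl sR)) (big_rem s sP) /=; congr (_ + _).
      by rewrite /absweyl refl_self// (negbTE (posN sP)) opprK.
    rewrite -sumrN; apply: eq_big_seq => a; rewrite mem_rem_uniq ?fset_uniq// inE.
    move=> /andP[ais aP]; have aR := pos_root aP.
    rewrite /absweyl simple_refl_pos// /F hP//; case: ifP => _; last by rewrite oppr0.
    by rewrite hf// ip_reflC// hy ipNr.
  by move: e1; rewrite e2 => /addrI; lra.
rewrite (big_rem s sP)/= E addr0 /F; case: (P s); last by rewrite mulr0.
by rewrite h2 mulVf.
Qed.

End Orbits.

(** * The characters e and hat e *)

Section Characters.
Context (R : realType) (V : vectType R) (n : nat) (D : root_datum V n).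
Context (t : V -> R) (ht : parameters D t).
Implicit Types (a b x y nu : V) (w : V -> V) (i : 'I_n).
Local Notation ip := (ip D).
Local Notation vee := (vee ip).
Local Notation refl := (refl ip).
Local Notation Phi := (Defs.roots D).
Local Notation pos := (posroots D).
Local Notation hat := (hat D).
Local Notation theta := (vartheta D).
Local Notation phi := (phi D).
Local Notation al := (tnth (base D)).

(** The common form of [e_] and [hat_e], with [rs] and [rl] the parts of the half sum of coroots
    from the orbit of theta and from the remaining roots. On [chr_lattice] the floors are exact and
    it is multiplicative. *)
Definition chr (rs rl x : V) : R :=
  t theta ^ Num.floor (ip rs x) * t phi ^ Num.floor (ip rl x).

Definition chr_lattice (rs rl : V) : set V :=
  [set x | ip rs x \is a Num.int /\ ip rl x \is a Num.int].

Lemma chr_lattice0 rs rl : chr_lattice rs rl 0.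
Proof. by split; rewrite ip0r rpred0. Qed.

Lemma chr_latticeB rs rl x y : chr_lattice rs rl x -> chr_lattice rs rl y ->
  chr_lattice rs rl (x - y).
Proof. by move=> [x1 x2] [y1 y2]; split; rewrite ipBr rpredB. Qed.

Lemma chr_latticeN rs rl x : chr_lattice rs rl x -> chr_lattice rs rl (- x).
Proof. by move=> [x1 x2]; split; rewrite ipNr rpredN. Qed.

Lemma chr_latticeD rs rl x y : chr_lattice rs rl x -> chr_lattice rs rl y ->
  chr_lattice rs rl (x + y).
Proof. by move=> [x1 x2] [y1 y2]; split; rewrite ipDr rpredD. Qed.

Lemma chr_latticeZ rs rl k x : k \is a Num.int -> chr_lattice rs rl x ->
  chr_lattice rs rl (k *: x).
Proof. by move=> kI [x1 x2]; split; rewrite ipZr rpredM. Qed.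

Lemma t_theta_neq0 : t theta != 0. Proof. exact/(t_neq0 ht)/theta_root. Qed.
Lemma t_phi_neq0 : t phi != 0. Proof. exact/(t_neq0 ht)/phi_root. Qed.

Lemma chr_neq0 rs rl x : chr rs rl x != 0.
Proof. by rewrite mulf_neq0// expfz_neq0 ?t_theta_neq0 ?t_phi_neq0. Qed.

Lemma chr0 rs rl : chr rs rl 0 = 1.
Proof. by rewrite /chr !ip0r floor0 !expr0z mulr1. Qed.

Lemma chrD rs rl x y : chr_lattice rs rl x -> chr_lattice rs rl y ->
  chr rs rl (x + y) = chr rs rl x * chr rs rl y.
Proof.
move=> [/intrP[x1 x1E] /intrP[x2 x2E]] [/intrP[y1 y1E] /intrP[y2 y2E]].
rewrite /chr !ipDr x1E x2E y1E y2E -!rmorphD !intrKfloor.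
by rewrite !expfzDr ?t_theta_neq0 ?t_phi_neq0//; ring.
Qed.

Lemma chrN rs rl x : chr_lattice rs rl x -> chr rs rl (- x) = (chr rs rl x)^-1.
Proof.
move=> hx; apply: (mulfI (chr_neq0 rs rl x)).
by rewrite -chrD ?subrr ?chr0 ?mulfV ?chr_neq0//; exact: chr_latticeN.
Qed.

Let short a : bool := a \in weyl_orbit D theta.

Let short_refl i a : a \in Phi -> short (refl (al i) a) = short a.
Proof.
move=> aP; apply/idP/idP => /set_mem h; apply/mem_set.
  rewrite -(reflK ip (simple_neq0 D i) a).
  by apply: weyl_orbit_act => //; apply: weyl_refl; exact: simple_root.
by apply: weyl_orbit_act => //; apply: weyl_refl; exact: simple_root.
Qed.

Lemma chr_simple rs rl i x : ip rs x = (short (al i))%:R ->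
  ip rl x = 1 - (short (al i))%:R ->
  chr_lattice rs rl x /\ chr rs rl x = t (al i).
Proof.
rewrite /chr_lattice /chr /=; case: (boolP (short (al i))) => [/set_mem E|/negP E] /= e1 e2;
  rewrite e1 e2 ?subr0 ?subrr.
  by rewrite rpred0 rpred1 floor1 floor0 expr1z expr0z mulr1 (t_short ht E).
rewrite rpred0 rpred1 floor1 floor0 expr1z expr0z mul1r (t_long ht (simple_root D i))//.
by move=> h; apply: E; apply/mem_set.
Qed.

Local Notation lat := (chr_lattice (rhov_short D) (rhov D - rhov_short D)).
Local Notation hatlat := (chr_lattice (hatrhov_short D) (hatrhov D - hatrhov_short D)).

Lemma eE x : e_ D t x = chr (rhov_short D) (rhov D - rhov_short D) x.
Proof. by []. Qed.

Lemma hat_eE x : hat_e D t x = chr (hatrhov_short D) (hatrhov D - hatrhov_short D) x.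
Proof. by []. Qed.

Lemma e_simple_lat i : lat (al i) /\ e_ D t (al i) = t (al i).
Proof.
have s0 := simple_neq0 D i; have hr := lin_isom_refl ip s0.
have h P hP := @simple_refl_sum _ _ _ D P vee i (al i) hP
  (fun a _ => esym (isom_vee hr a)) (refl_self _ s0).
have h2 : ip (vee (al i)) (al i) = 2 by rewrite ipC ip_vee_self.
apply: chr_simple; first exact: (h short (short_refl i) h2).
rewrite ipBl; congr (_ - _); last exact: (h short (short_refl i) h2).
exact: (h xpredT (fun _ _ => erefl) h2).
Qed.

Lemma hat_e_simple_lat i : hatlat (hat (al i)) /\ hat_e D t (hat (al i)) = t (al i).
Proof.
have s0 := simple_neq0 D i; have hr := lin_isom_refl ip s0.
have hs0 : hat (al i) != 0 by rewrite hat_eq0.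
have hs : refl (al i) (hat (al i)) = - hat (al i).
  by rewrite (isom_hat _ hr) refl_self// hatN.
have h2 : ip (vee (hat (al i))) (hat (al i)) = 2 by rewrite ipC ip_vee_self.
have hf a : a \in Phi -> vee (hat (refl (al i) a)) = refl (al i) (vee (hat a)).
  by move=> _; rewrite (isom_vee hr) (isom_hat _ hr).
have h P hP := @simple_refl_sum _ _ _ D P (fun a => vee (hat a)) i (hat (al i)) hP hf hs h2.
apply: chr_simple; first exact: (h short (short_refl i)).
rewrite ipBl; congr (_ - _); last exact: (h short (short_refl i)).
exact: (h xpredT (fun _ _ => erefl)).
Qed.

Lemma e_simple i : e_ D t (al i) = t (al i).
Proof. by have [] := e_simple_lat i. Qed.

Lemma hat_e_simple i : hat_e D t (hat (al i)) = t (al i).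
Proof. by have [] := hat_e_simple_lat i. Qed.

Lemma root_lat a : a \in Phi -> lat a.
Proof.
suff h b : b \in pos -> lat b.
  by move=> /root_pos[/h//|/h/chr_latticeN]; rewrite opprK.
apply: pos_ind b => [i|b i bP _ _ IH]; first by have [] := e_simple_lat i.
rewrite -[b](subrK (ip b (vee (al i)) *: al i)); apply: chr_latticeD => //.
apply: chr_latticeZ; last by have [] := e_simple_lat i.
by apply: root_int; [exact: simple_root|exact: pos_root].
Qed.

Lemma hat_root_lat a : a \in Phi -> hatlat (hat a).
Proof.
suff h b : b \in pos -> hatlat (hat b).
  by move=> /root_pos[/h//|/h/chr_latticeN]; rewrite hatN opprK.
move: b; apply: (@pos_ind _ _ _ D (fun b => hatlat (hat b))) => [i|b i bP _ _ IH]; first by have [] := hat_e_simple_lat i.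
have s0 := simple_neq0 D i; have hr := lin_isom_refl ip s0.
move: IH; rewrite -(isom_hat _ hr) -(refl_hat D _ s0) /Defs.refl => IH.
rewrite -[hat b](subrK (ip (hat b) (vee (hat (al i))) *: hat (al i))); apply: chr_latticeD => //.
apply: chr_latticeZ; last by have [] := hat_e_simple_lat i.
by apply: hat_int; [exact: pos_root|exact: simple_root].
Qed.

Lemma e_mul a b : a \in Phi -> b \in Phi -> e_ D t (a + b) = e_ D t a * e_ D t b.
Proof. by move=> aP bP; rewrite !eE chrD//; exact: root_lat. Qed.

Lemma e_opp a : a \in Phi -> e_ D t (- a) = (e_ D t a)^-1.
Proof. by move=> aP; rewrite !eE chrN//; exact: root_lat. Qed.

Lemma e_neq0 a : e_ D t a != 0.
Proof. exact: chr_neq0. Qed.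

Lemma h_alpha0 : h_ D t * e_ D t (alpha0 D) = t (alpha0 D).
Proof. by rewrite /h_ e_opp ?alpha0_root// divfK// e_neq0. Qed.

Lemma hat_alpha0 : hat (alpha0 D) = vee (alpha0 D).
Proof. by rewrite alpha0E hatN hat_psi veeN. Qed.

Lemma hat_h_alpha0 : hat_h D t * hat_e D t (hat (alpha0 D)) = t (alpha0 D).
Proof.
rewrite /hat_h -hat_alpha0 !hat_eE chrN; last exact/hat_root_lat/alpha0_root.
by rewrite divfK// chr_neq0.
Qed.

Lemma hat_h_neq0 : hat_h D t != 0.
Proof. by rewrite mulf_neq0 ?chr_neq0// (t_neq0 ht)// alpha0_root. Qed.

End Characters.

(** In the scaled case this is |phi|^2 / |a|^2, which for short [a] of a system with two lengths
    equals <phi, theta^vee>, because <theta, phi^vee> = 1. *)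
Lemma mult_int (R : realType) (V : vectType R) (n : nat) (D : root_datum V n) (a : V) :
  a \in Defs.roots D -> mult D a \is a Num.int.
Proof.
move=> aP; have [w Ww wa] := root_conj aP; rewrite -(mult_isom a (weyl_isom Ww)).
have phiR := phi_root D; have thR := theta_root D.
have p0 := root_neq0 phiR; have t0 := root_neq0 thR.
have pp := ip_gt0 (ip D) p0; have pt := ip_gt0 (ip D) t0.
rewrite /mult hatE ipZr /hatscale; case: (kind D).
  by rewrite divfK ?divff ?rpred1// gt_eqF// ip_gt0// (root_neq0 (weyl_root Ww aP)).
suff h b : b = phi D \/ b = vartheta D -> ip D (phi D) (phi D) / ip D b b \is a Num.int.
  rewrite (_ : 2 / _ = ip D (phi D) (phi D) / ip D (w a) (w a)); first exact: h.
  by field; rewrite !gt_eqF// ip_gt0// (root_neq0 (weyl_root Ww aP)).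
case=> ->; first by rewrite divff ?rpred1// gt_eqF.
have [<-|ne] := eqVneq (vartheta D) (phi D); first by rewrite divff ?rpred1// gt_eqF.
have pos1 : 0 < ip D (vartheta D) (phi D).
  by apply: dominant_root_phi_gt0 => //; exact: theta_dominant.
have e1 := pairing1 phiR thR (theta_short phiR) ne pos1.
have := ip_veeK (ip D) (vartheta D) p0; rewrite e1 mul1r => e2.
have -> : ip D (phi D) (phi D) / ip D (vartheta D) (vartheta D) =
    ip D (phi D) (vee (ip D) (vartheta D)).
  by rewrite ip_vee (ipC (ip D) (phi D) (vartheta D)) -e2; field; rewrite gt_eqF.
exact: root_int.
Qed.

(** * Descending paths into the alcove *)

Section Paths.
Context (R : realType) (V : vectType R) (n : nat) (D : root_datum V n).
Context (t : V -> R) (ht : parameters D t) (c : nat) (hc : (1 < c)%N).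
Context (la : V) (hla : alcove_weight D c la) (omega : V).
Context (homega : dominant_weight D omega).
Context (hqm : minuscule D omega \/ quasiminuscule D omega).
Implicit Types (x nu : V) (a b : V * int) (w : V -> V) (j : 'I_n.+1).
Local Notation ip := (ip D).
Local Notation vee := (vee ip).
Local Notation refl := (refl ip).
Local Notation Phi := (Defs.roots D).
Local Notation hat := (hat D).
Local Notation vth := (vartheta D).
Local Notation sim := (affsimple D).
Local Notation apos := (affpos D).
Local Notation aeval := (affeval D c).
Local Notation arefl := (affrefl D c).
Local Notation act j := (affact D (sim j)).
Local Notation orb := (weyl_orbit D omega).

Let c_gt0 : (0 < c)%N. Proof. exact: ltnW. Qed.
Let c_ge2 : 2 <= c%:R :> R. Proof. by rewrite ler_nat. Qed.

Lemma affevalD a x y : aeval a (x + y) = aeval a x + ip y (vee a.1).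
Proof. by rewrite /affeval ipDl addrAC. Qed.

Lemma affsimple_const j :
  (j = ord0 /\ aeval (sim j) 0 = c%:R) \/ (exists2 i, j = lift ord0 i & aeval (sim j) 0 = 0).
Proof.
rewrite /affeval ip0l add0r; case: (affsimple_cases D j) => [[-> ->]|[i -> ->]] /=.
  by left; rewrite alpha0E multN mult_psi !mul1r.
by right; exists i; rewrite // mulr0 mul0r.
Qed.

Let la_pos a : apos a -> 0 <= aeval a la.
Proof. by case: hla => _ /(alcoveP D c); apply. Qed.

Let la_int a : affroot D a -> aeval a la \is a Num.int.
Proof.
move=> aR; rewrite /affeval; apply: rpredD; first by case: hla => h _; exact: h.
by rewrite rpredM ?natr_int// rpredM ?mult_int// intr_int.
Qed.

(** The reflection in such a [b] takes la + nu to [la], since its value there is 1 - 2 = -1. The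
    existence of a crossing singles out the paths that end at [la]. *)
Definition crossing nu b := [/\ apos b, b.1 = - nu & aeval b la = 1].

Lemma orbit_act nu j : orb nu -> orb (refl (sim j).1 nu).
Proof. by apply: weyl_orbit_act; apply: weyl_refl; exact: affsimple_root. Qed.

(** a(la) is a nonnegative integer and <nu, a'> is at least -2, with equality only if [a.1] is - nu.
    A negative sum leaves just these possibilities. *)
Lemma affneg_cases nu a : orb nu -> apos a -> aeval a (la + nu) < 0 ->
  [\/ [/\ aeval a la = 0, aeval a (la + nu) = -1 & ip nu (vee a.1) = -1],
      [/\ aeval a la = 0, aeval a (la + nu) = -2, a.1 = - nu & weyl_orbit D vth nu] |
      [/\ aeval a la = 1, aeval a (la + nu) = -1, a.1 = - nu & weyl_orbit D vth nu]].
Proof.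
move=> hnu aP; rewrite affevalD; have aR := affpos_root aP; have a0 := affroot_neq0 aR.
have := la_pos aP; have /intrP[e ->] := la_int aR.
have wt : weight D nu.
  by case: hnu => w Ww <-; apply: weight_weyl => //; case: homega.
have /intrP[p pE] := wt _ aR; rewrite pE -rmorphD/= ler0z ltrz0 => e0 ep.
case: (orbit_pairing homega hqm hnu aR) => [|[[anu|anu] hth]].
- rewrite pE -(rmorphN1 (intmul (1 : R))) ler_int lerz1 => /andP[p1 p2].
  have [-> ->] : e = 0 /\ p = -1 by lia.
  by apply: Or31.
- have : p%:~R = 2 :> R by rewrite -pE anu ip_vee_self// -anu.
  by rewrite -[2]/(2%:~R) => /intr_inj; lia.
have p2 : p = -2.
  apply: (@intr_inj R); rewrite -pE -[nu]opprK -anu ipNl ip_vee_self//.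
have : e = 0 \/ e = 1 by lia.
by rewrite p2; case=> ->; [apply: Or32|apply: Or33].
Qed.

(** This is where c > 1 enters: two affine roots with the same direction differ at [la] by an
    integer multiple of m c, with m c >= 2, so their values there cannot be 0 and 1. *)
Lemma crossing_unique nu a b : crossing nu b -> apos a -> a.1 = - nu -> aeval a la <> 0.
Proof.
case: a b => [a r] [b q] [bP /= be b1] aP /= ae a0; have aR := affpos_root aP.
move: a0 b1; rewrite /affeval/= be ae; move: (ip la _) => z.
set m := mult D (- nu); have m1 : 1 <= m by rewrite /m -ae; apply: mult_ge1.
move=> E1 E2; have E : m * (q - r)%:~R * c%:R = 1.
  by rewrite rmorphB/= mulrBr mulrBl; lra.
have [d0|d0] := leP (q - r) 0.
  have : (q - r)%:~R <= 0 :> R by rewrite lerz0.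
  move: E; move: (_%:~R) => d E d0'; have := mulr_ge0 (le_trans ler01 m1) (le_trans (ler0n R 2) c_ge2).
  by move=> mc; have := mulr_ge0_le0 mc d0'; lra.
have : 1 <= (q - r)%:~R :> R by rewrite ler1z; lia.
move: E; move: (_%:~R) => d E d1.
have : 1 * 1 <= m * d by apply: ler_pM.
rewrite mulr1 => md; have : 1 * 2 <= m * d * c%:R by apply: ler_pM.
by rewrite E; lra.
Qed.

Lemma affeval_inj a b : affroot D a -> a.1 = b.1 -> aeval a la = aeval b la -> a = b.
Proof.
case: a b => [a r] [b q] aR /= <-; rewrite /affeval/= => /addrI.
move=> /(mulIf (_ : c%:R != 0)) E; congr (_, _); apply: (@intr_inj R).
by apply: (mulfI (lt0r_neq0 (mult_gt0 D (root_neq0 aR)))); apply: E; rewrite pnatr_eq0 -lt0n.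
Qed.

Lemma crossing_act nu j b : aeval (sim j) la = 0 -> crossing nu b ->
  crossing (refl (sim j).1 nu) (act j b).
Proof.
move=> jla [bP be b1]; have sR := affsimple_root D j; have bR := affpos_root bP.
split.
- apply: affact_simple_pos => // E; move: b1; rewrite E jla => /eqP.
  by rewrite eq_sym oner_eq0.
- by rewrite /= be (isomN (lin_isom_refl ip (root_neq0 sR))).
- by rewrite affeval_act// affrefl_fix.
Qed.

Lemma theta_neq0P x : theta D c x <> 0%N -> exists2 a, apos a & aeval a x = -2.
Proof.
move=> h; apply: contrapT => nh; apply: h; rewrite thetaE//.
by apply: fsbig1 => a [aP a2]; exfalso; apply: nh; exists a.
Qed.

Lemma theta_alcove x : alcove D c x -> theta D c x = 0%N.
Proof.
move=> xA; apply: contrapT => /theta_neq0P[a aP a2].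
by have /(alcoveP D c)/(_ a aP) := xA; rewrite a2; lra.
Qed.

(** A value -2 would come from an affine root parallel to the crossing one and vanishing at [la]. *)
Lemma theta_crossing nu b : orb nu -> crossing nu b -> theta D c (la + nu) = 0%N.
Proof.
move=> hnu hb; apply: contrapT => /theta_neq0P[a aP a2].
have an : aeval a (la + nu) < 0 by rewrite a2; lra.
case: (affneg_cases hnu aP an) => [[_ e _]|[a0 _ ae _]|[_ e _ _]].
- by move: e; rewrite a2; lra.
- exact: (crossing_unique hb aP ae a0).
- by move: e; rewrite a2; lra.
Qed.

(** The affine root in question vanishes at [la], which therefore lies on a wall of nu. Consequently
    the exponent of h_t in [dcoef] is 0 or 1 whenever theta is nonzero. *)
Lemma theta_level nu a : orb nu -> apos a -> aeval a (la + nu) = -2 ->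
  [/\ weyl_orbit D vth nu, a.1 = - nu, aeval a la = 0 &
     ip la (hat nu) = 0 \/ ip la (hat nu) = c%:R].
Proof.
move=> hnu aP a2; have an : aeval a (la + nu) < 0 by rewrite a2; lra.
case: (affneg_cases hnu aP an) => [[_ e _]|[a0 _ ae hth]|[_ e _ _]].
- by move: e; rewrite a2; lra.
- split=> //; have aR := affpos_root aP; have an0 := affroot_neq0 aR.
  move: a0; rewrite affevalE// => /eqP; rewrite mulf_eq0 gt_eqF ?mult_gt0//= => /eqP.
  rewrite ae hatN ipNr => E; have r0 := affpos_ge0 c_gt0 aP.
  have nuR : nu \in Phi by exact: weyl_orbit_root hth.
  have zc : ip la (hat nu) <= c%:R.
    case: hla => _ hA; case: (root_pos nuR) => h.
      by have /hA/andP[] : hat nu \in hatpos D by apply/imfsetP; exists nu.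
    have /hA/andP[] : hat (- nu) \in hatpos D by apply/imfsetP; exists (- nu).
    by rewrite hatN ipNr => h1 _; have := c_ge2; lra.
  have zE : ip la (hat nu) = a.2%:~R * c%:R by lra.
  have : a.2%:~R * c%:R <= c%:R :> R by rewrite -zE.
  rewrite -[X in _ <= X]mul1r ler_pM2r ?ltr0n// lerz1 => r1.
  have : a.2 = 0 \/ a.2 = 1 by lia.
  by rewrite zE; case=> ->; [left|right]; rewrite ?mul0r ?mul1r.
- by move: e; rewrite a2; lra.
Qed.

Let orbit_theta_refl j nu : weyl_orbit D vth nu -> weyl_orbit D vth (refl (sim j).1 nu).
Proof. by apply: weyl_orbit_act; apply: weyl_refl; exact: affsimple_root. Qed.

Let sgz_c : sgz (c%:R : R) = 1.
Proof. by rewrite gtr0_sgz// ltr0n. Qed.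

(** Here e_t(-nu) = e_t(- s_j nu) e_t(A). For j > 0, e_t(A) = t_j and the pairing with [la] is
    unchanged. For j = 0 the pairing strictly decreases, hence goes from c to 0 by [theta_level],
    and the factor h_t thus released turns e_t(alpha_0) into t_0. *)
Lemma dcoef_step nu j : orb nu -> aeval (sim j) la = 0 -> ip nu (vee (sim j).1) = -1 ->
  dcoef D t c la nu = t (sim j).1 * dcoef D t c la (refl (sim j).1 nu).
Proof.
move=> hnu jla jnu; set A := (sim j).1; have sR : A \in Phi := affsimple_root D j.
have A0 := root_neq0 sR; have hr := lin_isom_refl ip A0.
have ax : aeval (sim j) (la + nu) = -1 by rewrite affevalD jla jnu add0r.
have sx : arefl (sim j) (la + nu) = la + refl A nu.
  by rewrite affrefl_add affrefl_fix.
have thE : theta D c (la + nu) = theta D c (la + refl A nu).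
  rewrite (@theta_desc _ _ _ D c c_gt0 j (la + nu)); last by rewrite ax; lra.
  rewrite sx ax asboolF// => E; lra.
rewrite /dcoef; case: ifP => [/set_mem hth|/negP nth]; last first.
  rewrite ifF ?mulr0//; apply/negP => /set_mem h; apply: nth; apply/mem_set.
  by rewrite -(reflK ip A0 nu); exact: orbit_theta_refl.
rewrite mem_set; last exact: orbit_theta_refl.
rewrite -thE; have [->|/eqP thn0] := eqVneq (theta D c (la + nu)) 0%N.
  by rewrite !mul0r mulr0.
have [a aP a2] := theta_neq0P thn0.
have nuR := weyl_orbit_root hth; have nu'R := root_refl sR nuR.
have nuE : - nu = - refl A nu + A by rewrite /Defs.refl jnu scaleN1r opprK opprD subrK.
rewrite {1}nuE (e_mul ht) ?root_opp//.
suff E : h_ D t ^ sgz (ip la (hat nu)) * e_ D t A = t A * h_ D t ^ sgz (ip la (hat (refl A nu))).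
  have -> : (theta D c (la + nu))%:R * (e_ D t (- refl A nu) * e_ D t A) * h_ D t ^ sgz (ip la (hat nu))
     = (theta D c (la + nu))%:R * e_ D t (- refl A nu) * (h_ D t ^ sgz (ip la (hat nu)) * e_ D t A).
    by ring.
  by rewrite E; ring.
have zE : ip la (hat (refl A nu)) = ip la (hat nu) - ip la (vee A) * ip (hat nu) A.
  by rewrite -(isom_hat _ hr) -(ip_reflC _ _ _ A0) /Defs.refl ipBl ipZl (ipC ip A).
have lav : ip la (vee A) = - aeval (sim j) 0.
  by have := jla; rewrite (affeval_simple D c j la) -/A => /eqP; rewrite addr_eq0 => /eqP.
have hnA : ip (hat nu) A < 0.
  have nu0 := root_neq0 nuR.
  rewrite hatE ipZl pmulr_rlt0 ?hatscale_gt0// -(ip_vee_lt0 _ _ A0) jnu.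
  by rewrite oppr_lt0 ltr01.
have sP := affact_simple_pos aP.
have [_ ae a0 lev] := theta_level hnu aP a2.
have bP : apos (act j a).
  apply: sP => E; move: ae jnu; rewrite E -/A => AE; rewrite -[nu]opprK -AE ipNl ip_vee_self//.
  lra.
have b2 : aeval (act j a) (la + refl A nu) = -2.
  by rewrite -sx (affeval_act c _ (affpos_root aP) sR) (affsimple_reflK D c_gt0).
have [_ _ _ lev'] := theta_level (orbit_act j hnu) bP b2.
rewrite -/A in lev'.
case: (affsimple_const j) => [[j0 cj]|[i ji cj]]; last first.
  rewrite zE lav cj oppr0 mul0r subr0 mulrC; congr (_ * _).
  by rewrite /A ji affsimpleS /= (e_simple ht).
have AE : A = alpha0 D by rewrite /A j0 affsimple0.
have cpos : 0 < c%:R :> R by rewrite ltr0n.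
have zlt : ip la (hat (refl A nu)) < ip la (hat nu).
  by rewrite zE lav cj mulNr opprK gtrDl nmulr_llt0// pmulr_rlt0.
have [z1 z0] : ip la (hat nu) = c%:R /\ ip la (hat (refl A nu)) = 0.
  by case: lev zlt => ->; case: lev' => ->; rewrite ?ltxx//; lra.
by rewrite z1 z0 sgz_c sgz0 expr1z expr0z mulr1 AE h_alpha0.
Qed.

Lemma desc_alcove x w : alcove D c x -> desc D c x w -> w = id.
Proof.
move=> hx hw; case: hw hx => // j y u hj _ /(alcoveP D c)/(_ _ (affsimple_pos D j)).
by rewrite leNgt hj.
Qed.

Lemma tprod_alcove x : alcove D c x -> tprod D t c x = 1.
Proof. by move=> /affnegP h; rewrite /tprod h fsbig_set0. Qed.

Lemma crossing_actE nu j b : aeval (sim j) la = 0 -> crossing (refl (sim j).1 nu) b ->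
  crossing nu (act j b).
Proof.
move=> jla /(crossing_act jla); rewrite reflK//.
exact/root_neq0/affsimple_root.
Qed.

Lemma crossing_alcove nu b : crossing nu b -> ~ alcove D c (la + nu).
Proof.
move=> [bP be b1] /(alcoveP D c)/(_ b bP); rewrite affevalD b1.
have := ip_vee_self ip (affroot_neq0 (affpos_root bP)).
by rewrite {1}be ipNl; lra.
Qed.

Lemma dcoef_theta0 nu : theta D c (la + nu) = 0%N -> dcoef D t c la nu = 0.
Proof. by rewrite /dcoef => ->; case: ifP => //; rewrite !mul0r. Qed.

(** An affine root with value -2 there would have to be - a_j, which is not positive. *)
Lemma theta_terminal nu j : orb nu -> aeval (sim j) la = 0 -> (sim j).1 = - nu ->
  theta D c (la + refl (sim j).1 nu) = 0%N.
Proof.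
move=> hnu jla jnu; have sR := affsimple_root D j.
apply: contrapT => /theta_neq0P[a aP a2].
have [_ ae a0 _] := theta_level (orbit_act j hnu) aP a2.
have E : a = affopp (sim j).
  apply: affeval_inj; first exact: affpos_root.
    have nuE : nu = - (sim j).1 by rewrite jnu opprK.
    by rewrite ae {1}nuE (isomN (lin_isom_refl ip (root_neq0 sR))) (refl_self _ (root_neq0 sR)) opprK.
  by rewrite a0 affeval_opp jla oppr0.
by move: aP; rewrite E; exact: affpos_opp (affsimple_pos D j).
Qed.

(** The initial value of the recursion in [dcoef_step]: theta is 1, and e_t(A) gives t_j, with the
    help of one factor h_t if j = 0. *)
Lemma dcoef_terminal nu j : orb nu -> aeval (sim j) la = 0 -> aeval (sim j) (la + nu) = -2 ->
  (sim j).1 = - nu -> weyl_orbit D vth nu -> dcoef D t c la nu = t (sim j).1.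
Proof.
move=> hnu jla j2 jnu hth; have sR := affsimple_root D j.
rewrite /dcoef mem_set// (@theta_desc _ _ _ D c c_gt0 j (la + nu)); last by rewrite j2; lra.
rewrite asboolT// affrefl_add affrefl_fix// theta_terminal// addn0 mul1r -jnu.
have lav : ip la (vee (sim j).1) = - aeval (sim j) 0.
  by have := jla; rewrite (affeval_simple D c j la) => /eqP; rewrite addr_eq0 => /eqP.
have nuE : nu = - (sim j).1 by rewrite jnu opprK.
case: (affsimple_const j) => [[j0 cj]|[i ji cj]].
  have AE : (sim j).1 = alpha0 D by rewrite j0 affsimple0.
  rewrite nuE hatN ipNr AE hat_alpha0 -AE lav cj opprK sgz_c expr1z mulrC AE.
  exact: h_alpha0.
rewrite nuE hatN ipNr hatE ipZr.
move: lav; rewrite cj oppr0 => /eqP; rewrite (ip_vee_eq0 _ _ (root_neq0 sR)) => /eqP ->.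
by rewrite mulr0 oppr0 sgz0 expr0z mulr1 ji affsimpleS /= (e_simple ht).
Qed.

(** The linear parts of the affine transformations generated by the s_j fixing [la]; they act on nu
    when those act on la + nu. *)
Definition local_group : set (V -> V) :=
  generated [set refl (sim j).1 | j in [set j | aeval (sim j) la = 0]].

Context (xi : V) (hxi : spectrum D t c xi).
Local Notation M x := (macdonald D t x xi).
Local Notation "x %:c" := (real_complex R x) (at level 2, format "x %:c").

(** The equation x = la + nu is a hypothesis so that nu can vary in the induction on the path. The
    alternative is decided by the existence of a crossing, which the steps fixing [la] preserve in
    both directions. *)
Lemma desc_local x w : desc D c x w -> forall nu, orb nu -> x = la + nu ->
  M x = (tprod D t c x)%:c * M (w x) + ((1 - (t vth)^-1) * dcoef D t c la nu)%:c * M la /\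
  ((w x = la /\ exists b, crossing nu b) \/
   [/\ forall b, ~ crossing nu b, w la = la & exists2 g, local_group g & w x = la + g nu]).
Proof.
elim=> {x w} [x hx|j x w jx hw IH] nu hnu xE.
  split.
    rewrite tprod_alcove// dcoef_theta0 -?xE ?theta_alcove//.
    by rewrite mulr0 rmorph0 mul0r addr0 rmorph1 mul1r.
  right; split=> //; last by exists id; first exact: generated_id.
  by move=> b /crossing_alcove; rewrite -xE.
have sR := affsimple_root D j; have A0 := root_neq0 sR.
have stay : aeval (sim j) la = 0 ->
    ((w (arefl (sim j) x) = la /\ exists b, crossing (refl (sim j).1 nu) b) \/
   [/\ forall b, ~ crossing (refl (sim j).1 nu) b, w la = la &
    exists2 g, local_group g & w (arefl (sim j) x) = la + g (refl (sim j).1 nu)]) ->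
   (((w \o arefl (sim j)) x = la /\ exists b, crossing nu b) \/
   [/\ forall b, ~ crossing nu b, (w \o arefl (sim j)) la = la &
    exists2 g, local_group g & (w \o arefl (sim j)) x = la + g nu]).
  move=> jla [[wx [b hb]]|[nb wla [g Gg wx]]].
    by left; split=> //; exists (act j b); exact: crossing_actE.
  right; split; first by move=> b /(crossing_act jla); exact: nb.
    by rewrite /= affrefl_fix.
  exists (g \o refl (sim j).1) => //; apply: generated_comp_closed => //.
  by apply: generated_sub; exists j.
have xj := jx; rewrite xE in xj.
case: (affneg_cases hnu (affsimple_pos D j) xj) => [[jla j1 jp]|[jla j2 jnu hth]|[jla j1 jnu hth]].
- have sx : arefl (sim j) x = la + refl (sim j).1 nu by rewrite xE affrefl_add affrefl_fix.
  have [IH1 IH2] := IH _ (orbit_act j hnu) sx; split; last exact: stay.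
  rewrite xE in jx *; rewrite (macdonald_step1 ht hxi j1) (tprod_desc c_gt0 ht jx).
  rewrite (dcoef_step hnu jla jp) -{1}xE IH1 xE /= !rmorphM/=; ring.
- have sx : arefl (sim j) x = la + refl (sim j).1 nu by rewrite xE affrefl_add affrefl_fix.
  have [IH1 IH2] := IH _ (orbit_act j hnu) sx; split; last exact: stay.
  rewrite xE in jx *; rewrite (macdonald_step2 ht hxi j2) (tprod_desc c_gt0 ht jx).
  rewrite (dcoef_terminal hnu jla j2 jnu hth) -{1}xE IH1 xE.
  (* The middle point x + A is [la], because A = - nu. After this step theta is 0, so no second term
     of this kind arises; the coefficient -(1 - t) is (1 - t^-1) t with t = d. *)
  rewrite dcoef_theta0 ?theta_terminal// mulr0 rmorph0 mul0r addr0 jnu addrK.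
  have tE : t (- nu) = t vth.
    by rewrite (t_opp ht) ?(t_short ht hth)//; exact: weyl_orbit_root hth.
  have t0 : t vth != 0 := t_neq0 ht (theta_root D).
  rewrite tE (_ : (1 - (t vth)^-1) * t vth = - (1 - t vth)); last by field.
  by rewrite rmorphN rmorphB rmorph1 rmorphM/=; ring.
have sx : arefl (sim j) x = la.
  have nuE : nu = - (sim j).1 by rewrite jnu opprK.
  rewrite xE affrefl_add {1}/affrefl jla scale1r [X in refl _ X]nuE.
  by rewrite (isomN (lin_isom_refl ip A0)) (refl_self _ A0) opprK subrK.
have w1 : w = id by apply: desc_alcove hw; rewrite sx; case: hla.
have hc1 : crossing nu (sim j) by split=> //; exact: affsimple_pos.
split; last by left; rewrite w1 /= sx; split=> //; exists (sim j).
rewrite dcoef_theta0; last exact: theta_crossing hc1.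
rewrite mulr0 rmorph0 mul0r addr0 (tprod_desc c_gt0 ht jx) sx w1 /= sx.
rewrite tprod_alcove ?mulr1; last by case: hla.
by rewrite xE (macdonald_step1 ht hxi j1) -xE sx.
Qed.

End Paths.

(** * The stabilizer of a point of the alcove *)

Section LocalGroup.
Context (R : realType) (V : vectType R) (n : nat) (D : root_datum V n).
Context (t : V -> R) (ht : parameters D t) (c : nat) (hc : (1 < c)%N).
Context (la : V) (hla : alcove_weight D c la).
Implicit Types (x y b nu : V) (w : V -> V) (j : 'I_n.+1).
Local Notation ip := (ip D).
Local Notation vee := (vee ip).
Local Notation refl := (refl ip).
Local Notation Phi := (Defs.roots D).
Local Notation pos := (posroots D).
Local Notation hat := (hat D).
Local Notation sim := (affsimple D).
Local Notation apos := (affpos D).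
Local Notation aeval := (affeval D c).
Local Notation act j := (affact D (sim j)).
Local Notation G := (local_group D c la).

Let c_gt0 : (0 < c)%N. Proof. exact: ltnW. Qed.
Let cR : 0 < c%:R :> R. Proof. by rewrite ltr0n. Qed.
Let la_pos a : apos a -> 0 <= aeval a la.
Proof. by case: hla => _ /(alcoveP D c); apply. Qed.
Let sim_neq0 j : (sim j).1 != 0. Proof. exact/root_neq0/affsimple_root. Qed.

Lemma hat_inj a b : a != 0 -> b != 0 -> hat a = hat b -> a = b.
Proof.
have veeK x : x != 0 -> Defs.vee ip (Defs.vee ip x) = x.
  move=> x0; rewrite /Defs.vee ipZl ipZr scalerA -[RHS]scale1r; congr (_ *: _).
  by field; rewrite gt_eqF ?ip_gt0.
move=> a0 b0; rewrite /Defs.hat; case: (kind D) => [E|].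
  by rewrite -(veeK a a0) E veeK.
apply: scalerI; rewrite mulf_neq0// invr_neq0// gt_eqF// ip_gt0//.
exact/root_neq0/phi_root.
Qed.

Lemma hatposP b : reflect (exists2 a, a \in pos & b = hat a) (b \in hatpos D).
Proof.
apply: (iffP idP) => [/imfsetP[a aP ->]|[a aP ->]]; first by exists a.
by apply/imfsetP; exists a.
Qed.

(** A wall <x, b> = c contributes - b, so that each member points to the side of its wall on which
    the alcove lies. By [local_rootsP] these are the hats of the positive affine roots vanishing at
    [la]. *)
Definition local_roots : {fset V} :=
  ([fset b in hatpos D | ip la b == 0] `|`
   [fset - b | b in [fset b in hatpos D | ip la b == c%:R]])%fset.

Definition local_simple : set V := [set hat (sim j).1 | j in [set j | aeval (sim j) la = 0]].

Lemma local_rootsP b :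
  b \in local_roots <-> exists2 a, apos a /\ aeval a la = 0 & b = hat a.1.
Proof.
split.
  rewrite !inE => /orP[/andP[/hatposP[a aP ->] /eqP a0]|/imfsetP[d]].
    exists (a, 0); last by [].
    by split; [left|rewrite affevalE ?a0 ?mul0r ?addr0 ?mulr0//; exact: pos_root].
  rewrite /= !inE => /andP[/hatposP[a aP ->] /eqP ac] ->.
  have aR := pos_root aP; exists (- a, 1); last by rewrite hatN.
  split; first by right; split=> //; exact: root_opp.
  rewrite affevalE; last exact: root_opp.
  by rewrite /= hatN ipNr ac mul1r addNr mulr0.
case=> -[a r] [aP a0] -> /=; have aR := affpos_root aP; have r0 := affpos_ge0 c_gt0 aP.
move: a0; rewrite affevalE// => /eqP; rewrite mulf_eq0 gt_eqF ?mult_gt0 ?(affroot_neq0 aR)//=.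
rewrite addr_eq0 => /eqP a0; rewrite /= in r0 aR; rewrite !inE.
have [_ hA] := hla; case: (root_pos aR) => h.
  have hP : hat a \in hatpos D by apply/hatposP; exists a.
  have /andP[h0 _] := hA _ hP; move: h0; rewrite hP a0 oppr_ge0 pmulr_lle0// lerz0 => h0.
  by rewrite (_ : r = 0) ?mul0r ?oppr0 ?eqxx//; lia.
have hP : hat (- a) \in hatpos D by apply/hatposP; exists (- a).
have /andP[_ h0] := hA _ hP; move: h0; rewrite hatN ipNr a0 opprK.
rewrite -[X in _ <= X]mul1r ler_pM2r// lerz1 => r1.
have rE : r = 1.
  case: aP => -[/= ap]; last by lia.
  by have := posN ap; rewrite h.
apply/orP; right; apply/imfsetP; exists (- hat a); last by rewrite opprK.
by rewrite !inE -hatN hP hatN ipNr a0 rE mul1r opprK eqxx.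
Qed.

(** In a = s_j a + k a_j both summands are nonnegative at [la], so if [a] vanishes there, both do;
    the induction of [affpos_ind] therefore stays among the local roots. *)
Lemma local_ind (Q : V -> Prop) :
  (forall j, aeval (sim j) la = 0 -> Q (hat (sim j).1)) ->
  (forall b j m, aeval (sim j) la = 0 -> b \in local_roots -> Q b ->
     Q (b + m.+1%:R *: hat (sim j).1)) ->
  forall b, b \in local_roots -> Q b.
Proof.
move=> Q0 QS b /local_rootsP[a [aP a0] ->]; move: a0.
move: a aP; apply: (affpos_ind c_gt0 (Q := fun a => aeval a la = 0 -> Q (hat a.1))) => // a j aP bP kP IH.
have [k k0 ->] := affeval_act_simple c la aP kP.
have := la_pos bP; have := mulr_ge0 (ltW k0) (la_pos (affsimple_pos D j)) => h1 h2 h3.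
have b0 : aeval (act j a) la = 0 by lra.
have s0 : aeval (sim j) la = 0.
  have /eqP : k * aeval (sim j) la = 0 by lra.
  by rewrite mulf_eq0 (gt_eqF k0) => /eqP.
have aR := affpos_root aP; have sR := affsimple_root D j; have sn := sim_neq0 j.
have [m mE] : exists m, ip (hat a.1) (vee (hat (sim j).1)) = m.+1%:R.
  have := kP; have /intrP[z ->] := hat_int aR sR; rewrite ltr0z.
  by case: z => // -[|m] // _; exists m.
have -> : hat a.1 = hat (act j a).1 + m.+1%:R *: hat (sim j).1.
  rewrite -mE /= -(isom_hat _ (lin_isom_refl ip sn)) -(refl_hat D _ sn).
  by rewrite /Defs.refl subrK.
apply: QS => //; last exact: IH.
by apply/local_rootsP; exists (act j a).
Qed.

Let local_groupE : G = generated [set Defs.refl ip b | b in local_simple].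
Proof.
congr (generated _); apply/seteqP; split=> [_ [j j0 <-]|_ [_ [j j0 <-] <-]].
  by exists (hat (sim j).1); [exists j|apply/funext => x; exact: refl_hat].
by exists j => //; apply/funext => x; rewrite refl_hat.
Qed.

Lemma local_group_weyl w : G w -> weyl D w.
Proof.
elim=> [|u v [j _ <-] _ IH]; first exact: weyl1.
by apply: weylM => //; exact/weyl_refl/affsimple_root.
Qed.

Lemma hatpos_opp b : b \in hatpos D -> - b \notin hatpos D.
Proof.
move=> /hatposP[a aP ->]; apply/negP => /hatposP[d dP].
rewrite -hatN => /hat_inj E; have := posN aP; rewrite E ?dP//.
  by rewrite oppr_eq0; exact: pos_neq0 aP.
exact: pos_neq0 dP.
Qed.

Let local_simple_sub b : local_simple b -> b \in local_roots.
Proof.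
by move=> [j j0 <-]; apply/local_rootsP; exists (sim j) => //; split=> //; exact: affsimple_pos.
Qed.

Let local_opp b : b \in local_roots -> - b \notin local_roots.
Proof.
have c0 : (0 : R) <> c%:R by move=> E; move: cR; rewrite -E ltxx.
rewrite !inE => h; apply/negP; move: h.
move=> /orP[/andP[bP /eqP b0]|/imfsetP[d]]; move=> /=.
  have bN := hatpos_opp bP; rewrite (negbTE bN) /= => /imfsetP[d /=].
  rewrite !inE => /andP[dP /eqP dc] /oppr_inj E; apply: c0.
  by rewrite -b0 E.
rewrite !inE => /andP[dP /eqP dc] ->; rewrite opprK dc => /orP[/andP[_ /eqP]|].
  by move=> E; apply: c0.
move=> /imfsetP[e /=]; rewrite !inE => /andP[eP _] E.
by have := hatpos_opp dP; rewrite E opprK eP.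
Qed.

Let local_permute a b : local_simple a -> b \in local_roots -> b != a ->
  refl a b \in local_roots.
Proof.
move=> [j j0 <-] /local_rootsP[d [dP d0] ->] ne; have sn := sim_neq0 j.
rewrite refl_hat// (isom_hat _ (lin_isom_refl ip sn)).
apply/local_rootsP; exists (act j d); last by [].
split; first by apply: affact_simple_pos => // E; rewrite E eqxx in ne.
rewrite affeval_act ?affrefl_fix//; [exact: affpos_root|exact: affsimple_root].
Qed.

Lemma local_reflection_group : reflection_group ip local_roots local_simple G.
Proof.
rewrite local_groupE; split.
- exact: local_simple_sub.
- exact: local_opp.
- exact: local_permute.
- move=> _ b [j _ <-] /local_rootsP[a [aP _] ->].
  by apply: hat_int; [exact: affpos_root|exact: affsimple_root].
- move=> x hx; apply: local_ind => [j j0|b j m j0 bP b0]; first by apply: hx; exists j.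
  rewrite ipDr ipZr; have : ip x (hat (sim j).1) <= 0 by apply: hx; exists j.
  by move=> h; have := mulr_ge0_le0 (ler0n R m.+1) h; lra.
- move=> x hx; apply: local_ind => [j j0|b j m j0 bP b0]; first by apply: hx; exists j.
  rewrite ipDr ipZr; have : 0 < ip x (hat (sim j).1) by apply: hx; exists j.
  by move=> h; have := mulr_gt0 (ltr0Sn R m) h; lra.
- by rewrite -local_groupE; apply: sub_finite_set (finite_weyl D) => w; exact: local_group_weyl.
- by move=> w; apply: (generated_isom local_simple_sub local_opp).
- exact: generated_id.
- by move=> u w; exact: generated_comp_closed.
- move=> w; apply: generated_inv => _ [a aS <-]; apply: reflK.
  by move: aS => [j _ <-]; rewrite hat_eq0.
- by move=> w b; apply: (generated_root local_simple_sub local_opp local_permute).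
- by move=> a aS; apply: generated_sub; exists a.
- by move=> w; apply: (generated_free local_simple_sub local_opp local_permute).
Qed.

Definition local_lattice : set V :=
  [set x | chr_lattice D (hatrhov_short D) (hatrhov D - hatrhov_short D) x /\
           ip la x / c%:R \is a Num.int].

(** On a local root - <la, b> / c is the level of the affine root, 0 or 1. So the value is hat
    e_t(b) on a wall of level 0 and hat h_t hat e_t(-b) on a wall <x, b> = c, as in the two products
    of V. *)
Definition local_chr x : R := hat_e D t x * hat_h D t ^ Num.floor (- (ip la x / c%:R)).

Let latS x y : local_lattice x -> local_lattice y -> local_lattice (x - y).
Proof.
move=> [x1 x2] [y1 y2]; split; first exact: chr_latticeB.
by rewrite ipBr mulrBl rpredB.
Qed.

Let lat0 : local_lattice 0.
Proof. by split; [exact: chr_lattice0|rewrite ip0r mul0r rpred0]. Qed.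

Let chrA x y : local_lattice x -> local_lattice y ->
  local_chr (x + y) = local_chr x * local_chr y.
Proof.
move=> [x1 /intrP[p pE]] [y1 /intrP[q qE]]; rewrite /local_chr !hat_eE chrD//.
rewrite ipDr mulrDl pE qE -!rmorphD -!rmorphN !intrKfloor.
by rewrite opprD expfzDr ?hat_h_neq0//; ring.
Qed.

Let chr_simple_root j : aeval (sim j) la = 0 -> local_chr (hat (sim j).1) = t (sim j).1.
Proof.
have sR := affsimple_root D j; rewrite affevalE// => /eqP.
rewrite mulf_eq0 gt_eqF ?mult_gt0//= addr_eq0 => /eqP E; rewrite /local_chr E.
rewrite mulNr opprK mulfK ?gt_eqF// intrKfloor.
case: (affsimple_cases D j) => [[_ ->]|[i _ ->]] /=.
  by rewrite expr1z mulrC (hat_h_alpha0 ht).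
by rewrite expr0z mulr1 (hat_e_simple ht).
Qed.

Let lat_root b : b \in local_roots -> local_lattice b.
Proof.
move=> /local_rootsP[a [aP +] ->]; have aR := affpos_root aP; rewrite affevalE// => /eqP.
rewrite mulf_eq0 gt_eqF ?mult_gt0 ?(affroot_neq0 aR)//= addr_eq0 => /eqP E.
split; first exact: (hat_root_lat ht).
by rewrite E mulNr mulfK ?gt_eqF// rpredN intr_int.
Qed.

Lemma t_local b : b \in local_roots -> exists2 a, a \in Phi & b = hat a /\ t b = t a.
Proof.
move=> /local_rootsP[a [aP _] ->]; have aR := affpos_root aP.
by exists a.1 => //; split=> //; exact: (t_hat ht).
Qed.

Lemma local_root_character :
  root_character local_roots local_simple G local_lattice local_chr t.
Proof.
split=> //.
- by rewrite /local_chr hat_eE chr0 ip0r mul0r oppr0 floor0 expr0z mulr1.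
- move=> _ [j j0 <-]; rewrite chr_simple_root// (t_hat ht)//; exact: affsimple_root.
- move=> w b d Gw /t_local[a aR [-> ->]] /t_local[e eR [-> ->]].
  have Ww := local_group_weyl Gw; have iw := weyl_isom Ww.
  have wa := weyl_root Ww aR; have wa0 := root_neq0 wa; have e0 := root_neq0 eR.
  rewrite (isom_hat _ iw) -hatN -(t_weyl ht Ww aR) => -[/hat_inj ->//|/hat_inj ->].
  - exact: (t_opp ht).
  - by [].
  - by rewrite oppr_eq0.
Qed.

Let t_lt1 a : a \in Phi -> `|t a| < 1.
Proof. by move=> aR; have /andP[h1 h2] := t_bound ht aR; rewrite ltr_norml h1. Qed.

(** Every value is a product of parameters t_j, all of absolute value below 1. This keeps 1 - chi b
    and 1 - t b chi b away from 0 in [orbit_product]. *)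
Lemma local_chr_lt1 b : b \in local_roots -> `|local_chr b| < 1.
Proof.
move: b; apply: (local_ind (Q := fun b => `|local_chr b| < 1)) => [j j0|b j m j0 bP IH].
  by rewrite chr_simple_root// t_lt1//; exact: affsimple_root.
have sR := affsimple_root D j.
have lj : local_lattice (hat (sim j).1).
  by apply/lat_root/local_simple_sub; exists j.
have hm k : local_lattice (k%:R *: hat (sim j).1) /\
    local_chr (k%:R *: hat (sim j).1) = t (sim j).1 ^+ k.
  elim: k => [|k [IHl IHk]].
    by rewrite scale0r expr0 (rc_chi0 local_root_character).
  rewrite -natr1 scalerDl scale1r chrA// IHk chr_simple_root// exprSr; split=> //.
  by rewrite -[X in _ + X]opprK; apply: latS => //; rewrite -sub0r; exact: latS.
rewrite (chrA (lat_root bP) (hm m.+1).1) (hm m.+1).2.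
rewrite normrM normrX mulr_ilt1// exprn_ilt1//; exact: t_lt1.
Qed.

(** * Summation over an orbit of the stabilizer *)

Section Vertex.
Context (omega : V) (homega : dominant_weight D omega).
Context (hqm : minuscule D omega \/ quasiminuscule D omega).
Local Notation orb := (weyl_orbit D omega).

Lemma local_chamber nu : alcove D c (la + nu) -> chamber ip local_roots nu.
Proof.
move=> /(alcoveP D c) hA b /local_rootsP[a [aP a0] ->]; have := hA a aP.
have aR := affpos_root aP; have an0 := affroot_neq0 aR.
rewrite affevalD a0 add0r ip_vee_ge0// => h.
by rewrite hatE ipZr pmulr_rge0// hatscale_gt0.
Qed.

Lemma orbit_local x w : orb x -> G w -> orb (w x).
Proof. by move=> hx /local_group_weyl Ww; exact: weyl_orbit_act. Qed.

Lemma crossing_local w x a : G w -> crossing D c la (w x) a -> exists d, crossing D c la x d.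
Proof.
move=> Gw; elim: Gw a => [a ha|u v [j j0 <-] _ IH a /(crossing_actE j0)/IH//].
by exists a.
Qed.

(** Without a crossing, every affine root negative at la + x vanishes at [la], so the hat map
    identifies these with the local roots negative on x. *)
Lemma tprod_local x : orb x -> (forall a, ~ crossing D c la x a) ->
  tprod D t c (la + x) = \prod_(b <- local_roots | ip x b < 0) t b.
Proof.
move=> hx nc; have S a : affneg D c (la + x) a ->
    [/\ apos a, aeval a la = 0 & ip x (vee a.1) < 0].
  move=> [aP an]; split=> //.
    case: (affneg_cases hc hla homega hqm hx aP an) => [[]|[]|[a1 _ ax _]]//.
    by case: (nc a).
  case: (affneg_cases hc hla homega hqm hx aP an) => [[a0 _ _]|[a0 _ _ _]|[a1 _ ax _]].
  - by move: an; rewrite affevalD a0 add0r.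
  - by move: an; rewrite affevalD a0 add0r.
  - by case: (nc a).
rewrite -big_filter fsbig_seq ?filter_uniq ?fset_uniq//.
have -> : [set` [seq b <- local_roots | ip x b < 0]] =
    (fun a : V * int => hat a.1) @` affneg D c (la + x).
  apply/seteqP; split=> [b|_ [a /S[aP a0 ax] <-]] /=.
    rewrite mem_filter => /andP[xb /local_rootsP[a [aP a0] bE]]; exists a => //; split=> //.
    have an0 := affroot_neq0 (affpos_root aP).
    rewrite affevalD a0 add0r ip_vee_lt0//; move: xb.
    by rewrite bE hatE ipZr pmulr_rlt0// hatscale_gt0.
  rewrite mem_filter; apply/andP; split; last by apply/local_rootsP; exists a.
  have an0 := affroot_neq0 (affpos_root aP); move: ax.
  by rewrite ip_vee_lt0// hatE ipZr pmulr_rlt0// hatscale_gt0.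
rewrite fsbig_image.
  apply: eq_fsbigr => a /set_mem/S[aP _ _].
  by rewrite (t_hat ht) ?(t_vee ht)//; exact: affpos_root.
move=> a d /set_mem/S[aP a0 _] /set_mem/S[dP d0 _] /= E.
have aR := affpos_root aP; have dR := affpos_root dP.
have E1 := hat_inj (affroot_neq0 aR) (affroot_neq0 dR) E.
exact: (affeval_inj hc aR E1 (etrans a0 (esym d0))).
Qed.

Lemma Vcoef_local nu : Vcoef D t c la nu =
  \prod_(b <- local_roots | 0 < ip nu b) ((1 - t b * local_chr b) / (1 - local_chr b)).
Proof.
rewrite (perm_big ([seq b <- hatpos D | ip la b == 0] ++
    [seq - b | b <- [seq b <- hatpos D | ip la b == c%:R]]))/=.
  rewrite big_cat big_map !big_filter_cond /Vcoef; congr (_ * _).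
    by apply: eq_bigr => b /andP[/eqP b0 _]; rewrite /local_chr b0 mul0r oppr0 floor0 expr0z mulr1.
  rewrite big_seq_cond [RHS]big_seq_cond.
  apply: eq_big => [b|b /andP[/hatposP[a aP bE] /andP[/eqP b0 _]]]; first by rewrite ipNr oppr_gt0.
  have aR := pos_root aP.
  rewrite /local_chr ipNr b0 mulNr opprK divff ?gt_eqF// floor1 expr1z.
  rewrite bE -[- hat a]hatN !(t_hat ht) ?root_opp// (t_opp ht)// hatN.
  by congr (_ / _); ring.
apply: uniq_perm; first exact: fset_uniq.
  rewrite cat_uniq; apply/and3P; split.
  - by rewrite filter_uniq// fset_uniq.
  - apply/hasPn => _ /mapP[b + ->]; rewrite !mem_filter => /andP[_ bP].
    by rewrite negb_and (hatpos_opp bP) orbT.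
  - by rewrite (map_inj_uniq oppr_inj) filter_uniq// fset_uniq.
move=> b; rewrite mem_cat mem_filter !inE andbC; congr (_ || _).
apply/imfsetP/mapP => -[d /= + ->].
  by rewrite !inE => dP; exists d; rewrite // mem_filter andbC.
by rewrite mem_filter => dP; exists d; rewrite // !inE andbC.
Qed.

Lemma desc_in_alcove x w : desc D c x w -> alcove D c (w x).
Proof. by elim. Qed.

Context (xi : V) (hxi : spectrum D t c xi).

(** As nu is nonzero, a path from la + x to la + nu is of the kind without crossing, so x is in the
    local orbit of nu. Conversely such an x is moved within its orbit to a point of the local
    chamber, which can only be nu. *)
Lemma Vcoef_sum nu : orb nu -> alcove D c (la + nu) -> nu != 0 ->
  \sum_(x \in [set x | orb x /\ to_alcove D c (la + x) = la + nu]) tprod D t c (la + x) =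
  Vcoef D t c la nu.
Proof.
move=> hnu hA nu0; have ch := local_chamber hA; have HG := local_reflection_group.
have HC := local_root_character.
have nc x w : G w -> x = w nu -> forall a, ~ crossing D c la x a.
  move=> Gw -> a /(crossing_local Gw)[d /crossing_alcove]; exact.
have -> : [set x | orb x /\ to_alcove D c (la + x) = la + nu] = [set w nu | w in G].
  apply/seteqP; split=> [x [hx hk]|_ [w Gw <-]] /=.
    have [_] := desc_local ht hc hla homega hqm hxi (shortest_desc D c_gt0 (la + x)) hx erefl.
    rewrite -/(to_alcove D c (la + x)) hk => -[[E _]|[_ _ [g Gg /addrI E]]].
      by move/eqP: E; rewrite -subr_eq0 addrAC subrr add0r (negbTE nu0).
    by have [g' Gg' [gK _]] := rg_inv HG Gg; exists g'; rewrite // E gK.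
  have hx := orbit_local hnu Gw; split=> //.
  have hd := shortest_desc D c_gt0 (la + w nu).
  have [_] := desc_local ht hc hla homega hqm hxi hd hx erefl.
  case=> [[_ [b /(nc _ _ Gw erefl)]]//|[_ _ [g Gg E]]].
  have := desc_in_alcove hd; rewrite /to_alcove E => hA'; congr (_ + _).
  exact/esym/(chamber_unique HG ch (local_chamber hA') (rg_comp HG Gg Gw)).
have lt1 b : b \in local_roots -> `|t b| < 1.
  by move=> /t_local[a aR [_ ->]]; exact: t_lt1.
rewrite Vcoef_local -(orbit_product HG HC ch).
- apply: eq_fsbigr => _ /set_mem[w Gw <-]; apply: tprod_local; first exact: orbit_local.
  exact: nc Gw erefl.
- move=> b bP; apply: contraTneq (local_chr_lt1 bP) => ->.
  by rewrite normr1 ltxx.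
- move=> b bP; have h : `|t b * local_chr b| < 1.
    by rewrite normrM mulr_ilt1// ?lt1 ?local_chr_lt1.
  by apply: contraTneq h => ->; rewrite normr1 ltxx.
Qed.

End Vertex.
End LocalGroup.

(** * Assembling the Pieri formula *)

Section Assembly.
Context (R : realType) (V : vectType R) (n : nat) (D : root_datum V n).
Context (t : V -> R) (ht : parameters D t) (c : nat) (hc : (1 < c)%N).
Context (la xi omega : V) (hla : alcove_weight D c la) (hxi : spectrum D t c xi).
Context (homega : dominant_weight D omega) (homega0 : omega != 0).
Context (hqm : minuscule D omega \/ quasiminuscule D omega).
Implicit Types (x nu : V).
Local Notation orb := (weyl_orbit D omega).
Local Notation M x := (macdonald D t x xi).
Local Notation kappa x := (to_alcove D c (la + x)).
Local Notation "x %:c" := (real_complex R x) (at level 2, format "x %:c").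

Let c_gt0 : (0 < c)%N. Proof. exact: ltnW. Qed.
Let finO : finite_set orb. Proof. exact: finite_weyl_orbit. Qed.

Let rc_fsum (A : set V) (f : V -> R) : finite_set A ->
  (\sum_(x \in A) f x)%:c = \sum_(x \in A) (f x)%:c.
Proof. by move=> finA; rewrite !fsbig_finite// rmorph_sum. Qed.

Let orb_neq0 x : orb x -> x != 0.
Proof.
move=> [w Ww <-]; apply: contraNneq homega0 => E; apply/eqP.
by apply: (isom_inj (weyl_isom Ww)); rewrite E (isom0 (weyl_isom Ww)).
Qed.

Let path x (hx : orb x) :=
  desc_local ht hc hla homega hqm hxi (shortest_desc D c_gt0 (la + x)) hx erefl.

(** The condition w_(la + nu) la = la in U can fail only along a path with a crossing, where theta
    and hence d vanish; the second sum in U may thus run over the whole orbit. *)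
Lemma shortest_fix x : orb x -> dcoef D t c la x != 0 -> shortest D c (la + x) la = la.
Proof.
move=> hx; apply: contra_neqP => nfix; apply: dcoef_theta0.
have [_ [[_ [b hb]]|[_ E _]]] := path hx; last by case: nfix.
exact: (theta_crossing hc hla homega hqm hx hb).
Qed.

Lemma kappa_orbit x : orb x -> kappa x <> la ->
  exists2 nu, orb nu /\ alcove_weight D c (la + nu) & kappa x = la + nu.
Proof.
move=> hx ne; have [_ [[E _]|[_ _ [g Gg E]]]] := path hx; first by case: ne.
have hg := orbit_local hx Gg; exists (g x); last exact: E.
split=> //; split; last first.
  by rewrite -E; exact: desc_in_alcove (shortest_desc D c_gt0 _).
have [w Ww <-] := hg; have [wla _] := hla; have [wom _] := homega.
move=> a aR; rewrite ipDl rpredD//; first exact: wla.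
exact: (weight_weyl Ww wom).
Qed.

Lemma pieri : orbit_sum D omega xi * M la =
  (Ucoef D t c la omega)%:c * M la +
  \sum_(nu \in [set nu | orb nu /\ alcove_weight D c (la + nu)])
    (Vcoef D t c la nu)%:c * M (la + nu).
Proof.
rewrite orbit_sum_macdonald.
have step x : orb x -> M (la + x) = (tprod D t c (la + x))%:c * M (kappa x) +
    ((1 - (t (vartheta D))^-1) * dcoef D t c la x)%:c * M la by move=> /path[].
under eq_fsbigr => x /set_mem hx do rewrite (step x hx).
rewrite fsbig_split//= /Ucoef rmorphD/= mulrDl addrAC; congr (_ + _); last first.
  have -> : \sum_(x \in [set x | orb x /\ shortest D c (la + x) la = la]) dcoef D t c la x =
      \sum_(x \in orb) dcoef D t c la x.
    rewrite [RHS](fsbigID [set x | shortest D c (la + x) la = la])//= [X in _ + X]fsbig1 ?addr0//.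
    move=> x [hx nfix]; apply/eqP; apply: contrapT => /negP/(shortest_fix hx); exact: nfix.
  by rewrite -mulr_fsuml -rc_fsum// -mulr_fsumr.
(* Paths ending at [la] give the first sum in U; the others are grouped by their end point la +
   nu. *)
pose B := [set x | kappa x = la].
rewrite (fsbigID B)//; congr (_ + _).
  rewrite rc_fsum; last by apply: sub_finite_set finO => x [].
  by rewrite mulr_fsuml; apply: eq_fsbigr => x /set_mem[_ /= ->].
set N := [set nu | _ /\ _].
have finN : finite_set N by apply: sub_finite_set finO => x [].
rewrite (@partition_fsbig _ _ _ (orb `&` ~` B) N (fun x nu => kappa x = la + nu)) //.
- apply: eq_fsbigr => nu /set_mem[hnu [wnu anu]].
  rewrite -(Vcoef_sum ht hc hla homega hqm hxi hnu anu (orb_neq0 hnu)) rc_fsum; last first.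
    by apply: sub_finite_set finO => x [].
  rewrite mulr_fsuml.
  have -> : [set x | (orb `&` ~` B) x /\ kappa x = la + nu] =
      [set x | orb x /\ kappa x = la + nu].
    apply/seteqP; split=> [x [[]]//|x [hx E]]; split=> //; split=> //.
    rewrite /B /= E => /eqP; rewrite -subr_eq0 addrAC subrr add0r.
    exact/negP/orb_neq0.
  by apply: eq_fsbigr => x /set_mem[_ ->].
- by apply: sub_finite_set finO => x [].
- move=> x [hx nB]; have [nu hnu E] := kappa_orbit hx nB; exists nu => // nu' _.
  by rewrite E; split=> [/addrI ->|->].
Qed.

(** A path ending at [la] needs a crossing, which makes the orbit point a root x with <x, x^vee> =
    2; this is impossible in a minuscule orbit. For the second sum, such an orbit is disjoint from
    that of theta. *)
Lemma Ucoef_minuscule : minuscule D omega -> Ucoef D t c la omega = 0.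
Proof.
move=> hm; rewrite /Ucoef fsbig1 => [|x [hx E]].
  rewrite fsbig1 ?mulr0 ?addr0// => x [hx _]; rewrite /dcoef memNset//.
  exact: (minuscule_orbit_theta homega hm hx).
exfalso; have [_ [[_ [b [bP be _]]]|[_ _ [g Gg]]]] := path hx.
  have xR : x \in Defs.roots D.
    by rewrite -[x]opprK -be; apply: root_opp; exact: affpos_root.
  have [|[_ /(minuscule_orbit_theta homega hm hx)//]] := orbit_pairing homega hqm hx xR.
  by rewrite ip_vee_self ?(root_neq0 xR)// => /andP[_]; lra.
rewrite -/(to_alcove D c (la + x)) E => /eqP; rewrite -subr_eq0 opprD addrA subrr add0r oppr_eq0.
by apply/negP/orb_neq0; exact: (orbit_local hx Gg).
Qed.

End Assembly.

Theorem theorem2p4 (R : realType) (n : nat) (V : vectType R)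
    (D : root_datum V n) (t : V -> R) (c : nat) (la xi omega : V)
    (ht : parameters D t) (hc : (1 < c)%N)
    (hla : alcove_weight D c la) (hxi : spectrum D t c xi)
    (homega : dominant_weight D omega) (homega0 : omega != 0)
    (hqm : minuscule D omega \/ quasiminuscule D omega) :
  orbit_sum D omega xi * macdonald D t la xi
    = real_complex R (Ucoef D t c la omega) * macdonald D t la xi
      + \sum_(nu \in [set nu | weyl_orbit D omega nu /\ alcove_weight D c (la + nu)])
          real_complex R (Vcoef D t c la nu) * macdonald D t (la + nu) xi
  /\ (minuscule D omega -> Ucoef D t c la omega = 0).
Proof.
split; first exact: (pieri ht hc hla hxi homega homega0 hqm).
exact: (Ucoef_minuscule ht hc hla hxi homega homega0 hqm).
Qed.
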